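(* Let $X_t$ be a regular one-dimensional diffusion as in the context, let $\rho>0$, let $g:D\to\mathbb{R}$ satisfy $g(x_0)>0$ for some $x_0\in(l,r)$, and put $h(p)=g(p)/\psi(p)$. Let $p^*\in(l,r)$ be such that $\tau^l_{p^*}$ is an optimal stopping time in the problem $\sup_{\tau}\mathbf{E}^xg(X_\tau)e^{-\rho\tau}\mathbf{1}_{\{\tau<\infty\}}$ over the class $\mathcal{M}^l_{\rm th}$ of threshold stopping times for all $x\in(l,r)$; moreover, assume that the right derivative $g'(p^*{+}0)$ exists and that $g(x)\ge0$ for $x>p^*$. Then $\tau^l_{p^*}$ is an optimal stopping time in this problem over the class of all stopping times for all $x\in(l,r)$, i.e. $$\sup_{\tau}\mathbf{E}^xg(X_\tau)e^{-\rho\tau}\mathbf{1}_{\{\tau<\infty\}}=\begin{cases}h(p^* )\psi(x),& x<p^*,\\ g(x),& x\ge p^*\end{cases}\qquad (x\in(l,r)),$$ where the supremum is over all stopping times $\tau$, if and only if the function $g$ is $\rho$-excessive with respect to the restriction of the process $X_t$ on $D^l_{p^*}=\{x\in D:\ x\ge p^*\}$.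
   Context: $X_t$, $t\ge0$, is a (continuous) diffusion process with values in an interval $D\subseteq\mathbb{R}$ with boundary points $-\infty\le l<r\le+\infty$ (each endpoint may or may not belong to $D$), with infinitesimal generator $\mathbb{L}f(x)=a(x)f'(x)+\frac12\sigma^2(x)f''(x)$, where $a:D\to\mathbb{R}$, $\sigma:D\to\mathbb{R}_+$. Regularity is guaranteed by the assumption: for every $x\in(l,r)$ there is $\varepsilon>0$ with $\int_{x-\varepsilon}^{x+\varepsilon}\frac{1+|a(y)|}{\sigma^2(y)}dy<\infty$. $\mathbf{E}^x$ denotes expectation for $X_0=x$. Stopping times are with respect to the natural filtration of $X$ and may take the value $+\infty$. $\psi$ and $\varphi$ denote the increasing and the decreasing fundamental solutions (positive and finite on $(l,r)$, with absolutely continuous derivatives, unique up to positive multiplicative constants) of $\mathbb{L}u=\rho u$ a.e. on $(l,r)$ associated with the process $X$; with $T_p=\inf\{t\ge0:X_t=p\}$ they satisfy $\mathbf{E}^xe^{-\rho T_p}=\psi(x)/\psi(p)$ for $x<p$ and $\mathbf{E}^xe^{-\rho T_p}=\varphi(x)/\varphi(p)$ for $x\ge p$ ($x,p\in(l,r)$). For $p\in(l,r)$, $\tau_p^l=\inf\{t\ge0: X_t\ge p\}$, and $\mathcal{M}^l_{\rm th}=\{\tau^l_p:\ p\in(l,r)\}$. For $p\in(l,r)$ let $D^l_p=\{x\in D: x\ge p\}$. The restriction of $X$ on $D^l_p$ is the process $X_{t\wedge T_p}$ started at $x>p$ (absorbed on reaching $p$). A nonnegative function $f:D^l_p\to\mathbb{R}_+$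 is called $\rho$-excessive with respect to the restriction of $X_t$ on $D^l_p$ if for all initial states $x\in(l,r)$, $x>p$, and any stopping time $\tau$, $$\mathbf{E}^xf(X_{\tau\wedge T_p})e^{-\rho(\tau\wedge T_p)}\mathbf{1}_{\{\tau\wedge T_p<\infty\}}\le f(x).$$
   Formalization: If l belongs to D and is reached from (l,r) with positive probability, g(l) ≤ limsup of g(x) as x→l+ is assumed in addition; otherwise a large g(l) at an absorbing endpoint makes the claim false. g is also assumed Borel measurable. *)

(* Defs.v *)
From mathcomp Require Import all_boot all_order all_algebra.
From mathcomp Require Import all_classical all_reals all_analysis.
From mathcomp Require Import measurable_realfun.

Set Implicit Arguments.
Unset Strict Implicit.
Unset Printing Implicit Defensive.

Import Order.TTheory GRing.Theory Num.Theory.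
Import numFieldNormedType.Exports.

Local Open Scope ring_scope.
Local Open Scope classical_set_scope.

Section state_space.
Context {R : realType}.
Implicit Types (l r : \bar R) (D : set R) (a sigma u k : R -> R).

Definition open_itv l r : set R := [set x | (l < x%:E)%E /\ (x%:E < r)%E].

(* each endpoint may or may not belong to D *)
Definition interval_with_ends D l r : Prop :=
  [/\ (l < r)%E, open_itv l r `<=` D
    & D `<=` [set x | (l <= x%:E)%E /\ (x%:E <= r)%E]].

(* The division is that of \bar R, in which 1 / 0 = +oo: with the real division
   the points where sigma vanishes would contribute 0. *)
Definition regular_coefficients D l r a sigma : Prop :=
  [/\ measurable_fun D a, measurable_fun D sigma,
      forall x, D x -> 0 <= sigma x
    & forall x, open_itv l r x -> exists2 e : R, 0 < e &
        (\int[lebesgue_measure]_(y in `[(x - e)%R, (x + e)%R])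
            ((1 + `|a y|)%:E / (sigma y ^+ 2)%:E) < +oo)%E].

Definition absolutely_continuous_on (c d : R) (f : R -> R) : Prop :=
  forall e : R, 0 < e -> exists2 delta : R, 0 < delta &
    forall s : seq (R * R),
      all (fun p => [&& c <= p.1, p.1 <= p.2 & p.2 <= d]) s ->
      pairwise (fun p q => (p.2 <= q.1) || (q.2 <= p.1)) s ->
      \sum_(p <- s) (p.2 - p.1) < delta ->
      \sum_(p <- s) `|f p.2 - f p.1| < e.

Definition diff_operator a sigma u (x : R) : R :=
  a x * derive1 u x + 2^-1 * sigma x ^+ 2 * derive1n 2 u x.

(* u has a locally absolutely continuous derivative on (l, r), and the
   differential operator maps it to k almost everywhere on (l, r) *)
Definition solves_ae l r a sigma u k : Prop :=
  [/\ forall x, open_itv l r x -> derivable u x 1,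
      forall c d, open_itv l r c -> open_itv l r d -> c <= d ->
        absolutely_continuous_on c d (derive1 u)
    & {ae lebesgue_measure, forall x : R, open_itv l r x ->
        derivable (derive1 u) x 1 /\ diff_operator a sigma u x = k x}].

End state_space.

Section process.
Context {R : realType} {d : measure_display} {T : measurableType d}.
(* time ranges over [0, +oo[; the values of X at negative times are never used *)
Implicit Types (X : R -> T -> R) (P : R -> probability T R).
Implicit Types (tau : T -> \bar R) (rho p x : R).

Definition natural_filtration X (t : R) : set (set T) :=
  <<s [set A | exists2 s : R, 0 <= s <= t &
         exists2 B : set R, measurable B & A = X s @^-1` B] >>.

Definition generated_by X : set (set T) :=
  <<s [set A | exists2 s : R, 0 <= s &
         exists2 B : set R, measurable B & A = X s @^-1` B] >>.

Definition stopping_time X tau : Prop :=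
  (forall w, 0 <= tau w)%E /\
  (forall t : R, 0 <= t -> natural_filtration X t [set w | (tau w <= t%:E)%E]).

Definition stopped_sigma_algebra X tau : set (set T) :=
  [set B | generated_by X B /\
     forall t : R, 0 <= t ->
       natural_filtration X t (B `&` [set w | (tau w <= t%:E)%E])].

(* product sigma-algebra on paths, generated by the evaluations at t >= 0 *)
Definition path_measurable : set (set (R -> R)) :=
  <<s [set A | exists2 t : R, 0 <= t &
         exists2 B : set R, measurable B & A = [set u | B (u t)]] >>.

(* (P x)_{x in D} is the family of laws of X started at x.  The process has
   infinite lifetime in D, so an endpoint that can be reached belongs to D;
   its behaviour there is unrestricted. *)
Record strong_markov_family (D : set R) X P : Prop := {
  smf_measurable : forall t : R, 0 <= t -> measurable_fun setT (X t);
  smf_state : forall (t : R) w, 0 <= t -> D (X t w);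
  smf_continuous : forall w, {within `[0%R, +oo[, continuous (X ^~ w)};
  smf_start : forall x, D x -> P x [set w | X 0 w = x] = 1%E;
  smf_kernel : forall A, generated_by X A ->
    measurable_fun D (fun x => P x A);
  smf_strong_markov : forall x tau B A, D x -> stopping_time X tau ->
    stopped_sigma_algebra X tau B -> path_measurable A ->
    P x (B `&` [set w | (tau w < +oo)%E]
           `&` [set w | A (fun s => X (fine (tau w) + s) w)])
    = (\int[P x]_(w in B `&` [set w | (tau w < +oo)%E])
         P (X (fine (tau w)) w) [set v | A (fun s => X s v)])%E }.

(* (E^x f(X_t) - f(x)) / t tends to L f(x) as t -> 0+, uniformly in x, for
   every f with compact support in (l, r) and absolutely continuous derivative
   such that L f has a continuous version k.  As a and sigma are only
   measurable, L f need not be continuous for a smooth f, whence this class of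
   test functions; it determines the scale function and the speed measure on
   (l, r), and leaves the behaviour at the endpoints free. *)
Definition has_generator (D : set R) (l r : \bar R) (a sigma : R -> R) X P
    : Prop :=
  forall (f k : R -> R) (c b : R), open_itv l r c -> open_itv l r b ->
    (forall y, ~ (c <= y <= b) -> f y = 0 /\ k y = 0) ->
    continuous k -> solves_ae l r a sigma f k ->
    forall e : R, 0 < e -> \forall t \near (0 : R)^'+, forall x, D x ->
      `| (fine ('E_(P x)[f \o X t]) - f x) / t - k x | <= e.

Definition regular_diffusion (D : set R) (l r : \bar R) (a sigma : R -> R) X P
    : Prop :=
  [/\ interval_with_ends D l r, regular_coefficients D l r a sigma,
      strong_markov_family D X P & has_generator D l r a sigma X P].

Definition hitting_time X p (w : T) : \bar R :=
  ereal_inf [set t%:E | t in [set t : R | 0 <= t /\ X t w = p]].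

Definition threshold_time X p (w : T) : \bar R :=
  ereal_inf [set t%:E | t in [set t : R | 0 <= t /\ p <= X t w]].

Definition threshold_times (l r : \bar R) X : set (T -> \bar R) :=
  [set threshold_time X p | p in open_itv l r].

(* g(X_tau) e^{- rho tau} 1_{tau < oo} *)
Definition payoff X rho (g : R -> R) tau (w : T) : R :=
  if tau w is t%:E then g (X t w) * expR (- (rho * t)) else 0.

(* When both the positive and the negative part of the payoff have infinite
   integral, the library's integral is +oo - oo = -oo, so such a stopping time
   does not contribute to a supremum. *)
Definition expected_payoff X P rho g x tau : \bar R :=
  ('E_(P x)[payoff X rho g tau])%E.

Definition value X P rho g (M : set (T -> \bar R)) x : \bar R :=
  ereal_sup [set expected_payoff X P rho g x tau | tau in M].

Definition optimal X P rho g (M : set (T -> \bar R)) x tau : Prop :=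
  M tau /\ expected_payoff X P rho g x tau = value X P rho g M x.

(* With the payoff function 1, the expected payoff of tau is
   E^x [e^{- rho tau} 1_{tau < oo}]. *)
Record fundamental_solutions (l r : \bar R) (a sigma : R -> R) X P rho
    (psi phi : R -> R) : Prop := {
  fs_psi_pos : forall x, open_itv l r x -> 0 < psi x;
  fs_phi_pos : forall x, open_itv l r x -> 0 < phi x;
  fs_psi_incr : forall x y, open_itv l r x -> open_itv l r y ->
    x < y -> psi x < psi y;
  fs_phi_decr : forall x y, open_itv l r x -> open_itv l r y ->
    x < y -> phi y < phi x;
  fs_psi_ode : solves_ae l r a sigma psi (fun x => rho * psi x);
  fs_phi_ode : solves_ae l r a sigma phi (fun x => rho * phi x);
  fs_psi_hit : forall x p, open_itv l r x -> open_itv l r p -> x < p ->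
    expected_payoff X P rho (fun=> 1) x (hitting_time X p)
    = (psi x / psi p)%:E;
  fs_phi_hit : forall x p, open_itv l r x -> open_itv l r p -> p <= x ->
    expected_payoff X P rho (fun=> 1) x (hitting_time X p)
    = (phi x / phi p)%:E }.

(* f is nonnegative and rho-excessive with respect to the restriction of X on
   {x in D | p <= x}, i.e. to X absorbed on reaching p *)
Definition excessive_on_restriction (D : set R) (l r : \bar R) X P rho p
    (f : R -> R) : Prop :=
  (forall x, D x -> p <= x -> 0 <= f x) /\
  (forall x tau, open_itv l r x -> p < x -> stopping_time X tau ->
     (expected_payoff X P rho f x
        (fun w => Order.min (tau w) (hitting_time X p w)) <= (f x)%:E)%E).

(* Concerns only a left endpoint y = l that belongs to D and is reached from
   (l, r) with positive probability: g(y) must not exceed limsup g(x) as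
   x -> y+ (true in particular if g is right-continuous at y).  Threshold times
   with thresholds in (l, r) and the process on {x >= p} ignore g(y), whereas
   stopping on reaching y yields g(y). *)
Definition left_end_condition (D : set R) (l r : \bar R) X P (g : R -> R)
    : Prop :=
  forall y : R, y%:E = l -> D y ->
    (exists2 x, open_itv l r x &
       (0 < P x [set w | hitting_time X y w < +oo])%E) ->
    ((g y)%:E <= limf_esup (EFin \o g) (y^'+))%E.

End process.

(* Main.v *)
(* Write [b] for pstar and [C = g b / psi b]. Optimality among thresholds says
   that [g / psi] is maximal at [b] on [(l, r)], so that [g <= C * psi]
   there. Fix [q] in the interval from [b] to [r] and cut the time axis at
   the successive passages [b -> q -> b -> q -> ...]. Between a passage at
   [b] and the next one at [q], the payoff is dominated by [C * psi], which
   is a martingale up to the hitting time of [q]; between a passage at [q]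
   and the next one at [b], excessivity bounds the gain by [g q <= C * psi
   q]. These inequalities telescope, and the passage times tend to infinity
   because paths are continuous, so no stopping time does better than [C *
   psi x] for [x <= b] and [g x] for [x >= b].

   Two points are delicate. Excessivity concerns stopping times of a process
   that starts in [(l, r)], whereas the stopping time in force after a
   passage at [q] may depend on the earlier path, and starting points at [r]
   are not covered. One therefore stops on a time grid: the Snell envelope
   of the grid problem dominates the gain whatever information is used, and
   it is attained at [q] by a stopping rule that depends only on the current
   position and on the number of steps left, to which excessivity applies.
   The mesh then tends to 0, by Fatou's lemma and the lower semicontinuity
   of [g] on the interval from [b] to [r] included. Secondly, the behaviour
   of the process at the ends is arbitrary, so that the bounds there are
   obtained as limits along starting points that approach an end reached
   with positive probability. *)

Require Import Defs.
From mathcomp Require Import all_boot all_order all_algebra.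
From mathcomp Require Import all_classical all_reals all_analysis.
From mathcomp Require Import measurable_realfun.
From mathcomp Require Import ring lra.
Import Order.TTheory GRing.Theory Num.Theory.
Import numFieldNormedType.Exports.
Import HBNNSimple.
Set Implicit Arguments.
Unset Strict Implicit.
Unset Printing Implicit Defensive.
Local Open Scope ring_scope.
Local Open Scope classical_set_scope.

(** The candidate value is [C * psi] below [b] and [g] above it. With [g] merely measurable away
    from [b], no generator inequality applies to this function, and pasting the two pieces at [b] is
    the obstacle. The gap between [b] and [q] removes it: as [g <= C * psi] on both sides of [b],
    the bound by [C * psi] remains usable beyond [b], up to [q], and the two estimates overlap. What
    is given away at [q] has the right sign, since [g q <= C * psi q]. Every crossing time ends at a
    known point, so the value of continuing is a constant times the discount, and only integrals of
    discounts over events [s <= tau] have to be chained.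

    The gain is replaced by its positive part, extended by 0 outside [D]. All integrals then live in
    [[0, +oo]], and neither integrability nor finiteness of the Snell envelope has to be known
    beforehand. *)

(** The functional monotone class argument that carries statements about events over to nonnegative
    functionals. A simple function is rebuilt from its finite range as a sum of scaled indicators,
    all terms of which are nonnegative. *)
Lemma ge0_measurable_ind (R : realType) (d : measure_display)
    (T : measurableType d) (C : (T -> \bar R) -> Prop) :
  (forall A, measurable A -> C (fun x => (\1_A x)%:E)) ->
  (forall (c : R) f, 0 <= c -> measurable_fun setT f ->
    (forall x, (0 <= f x)%E) -> C f -> C (fun x => (c%:E * f x)%E)) ->
  (forall f g, measurable_fun setT f -> (forall x, (0 <= f x)%E) ->
    measurable_fun setT g -> (forall x, (0 <= g x)%E) ->
    C f -> C g -> C (fun x => (f x + g x)%E)) ->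
  (forall f : nat -> T -> \bar R, (forall n, measurable_fun setT (f n)) ->
    (forall n x, (0 <= f n x)%E) ->
    (forall x, {homo f ^~ x : n m / (n <= m)%N >-> (n <= m)%E}) ->
    (forall n, C (f n)) -> C (fun x => limn (f ^~ x))) ->
  forall f, measurable_fun setT f -> (forall x, (0 <= f x)%E) -> C f.
Proof.
move=> C1 CZ CD Clim f mf f0.
pose fn := nnsfun_approx measurableT mf.
have -> : f = (fun x => limn (fun n => (fn n x)%:E)).
  apply/funext => x; apply/esym/cvg_lim => //.
  exact: cvg_nnsfun_approx.
apply: Clim.
- by move=> n; apply/measurable_EFinP.
- by move=> n x; rewrite lee_fin.
- move=> x n m nm; rewrite lee_fin.
  by have /lefP := nd_nnsfun_approx measurableT mf nm; apply.
move=> n; move: (fn n) => {}fn; pose s := finmap.enum_fset (fset_set (range fn)).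
pose g k := (fun x => \sum_(i < k) (s`_i * \1_(fn @^-1` [set s`_i]) x)%:E)%E.
have s0 i : (i < size s)%N -> 0 <= s`_i.
  move=> /(mem_nth 0); rewrite /s in_fset_set// inE => -[x _ <-].
  exact: fun_ge0.
have mset i : measurable (fn @^-1` [set s`_i]).
  exact: measurable_sfunP.
have -> : (fun x => (fn x)%:E) = g (size s).
  by apply/funext => x; rewrite /g sumEFin fimfunEord.
(* Measurability and nonnegativity of the partial sums are carried along with [C], because the
   clause for sums asks for them. *)
suff : forall k, (k <= size s)%N ->
    [/\ C (g k), measurable_fun setT (g k) & forall x, (0 <= g k x)%E].
  by move=> /(_ (size s))[].
elim=> [_|k IH ks].
- have -> : g 0%N = fun=> 0%E by apply/funext => x; rewrite /g big_ord0.
  split => //; have := C1 _ measurable0.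
  by congr C; apply/funext => x; rewrite indic0.
- have [Cg mg g0] := IH (ltnW ks).
  have -> : g k.+1 = fun x =>
      (g k x + (s`_k)%:E * (\1_(fn @^-1` [set s`_k]) x)%:E)%E.
    by apply/funext => x; rewrite /g big_ord_recr/= EFinM.
  have mi : measurable_fun setT
      (fun x => ((\1_(fn @^-1` [set s`_k]) x)%:E : \bar R)).
    by apply/measurable_EFinP; exact: measurable_indic.
  have i0 x : (0 <= ((\1_(fn @^-1` [set s`_k]) x)%:E : \bar R))%E.
    by rewrite lee_fin.
  have mci : measurable_fun setT
      (fun x => ((s`_k)%:E * (\1_(fn @^-1` [set s`_k]) x)%:E)%E).
    exact: measurable_funeM.
  have ci0 x : (0 <= (s`_k)%:E * (\1_(fn @^-1` [set s`_k]) x)%:E)%E.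
    by rewrite mule_ge0// lee_fin s0.
  split.
  + apply: CD => //; apply: CZ => //; [exact: s0|exact: C1].
  + exact: emeasurable_funD.
  + by move=> x; rewrite adde_ge0.
Qed.

(** * Hitting times along a continuous path *)

Section paths.
Context {R : realType}.
Implicit Types (u c : R -> R) (s t p : R).

Definition continuous_path u := {within `[0, +oo[, continuous u}.

(** Hitting a point and exceeding a level both have the form [c (u t) <= 0] with [c] continuous
    ([dist_to], [deficit]), so one passage time into a closed target serves for both. The starting
    time is extended: from [+oo] the set is empty and the result is [+oo], so passages can be
    iterated without case distinctions. *)
Definition first_after c (s : \bar R) u : \bar R :=
  ereal_inf [set t%:E | t in [set t | [/\ 0 <= t, (s <= t%:E)%E & c (u t) <= 0]]].

Lemma continuous_pathP u m (e : R) : continuous_path u -> 0 <= m -> 0 < e ->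
  exists2 delta : R, 0 < delta &
    forall t, 0 <= t -> `|t - m| < delta -> `|u t - u m| < e.
Proof.
move=> cu m0 e0.
have mA : `[0, +oo[%classic m by rewrite /= in_itv/= m0.
have : \forall t \near within `[0, +oo[%classic (nbhs m), `|u m - u t| < e.
  rewrite nbhs_subspace_in//.
  by have /cvgrPdist_lt /(_ _ e0) := cu m.
rewrite near_withinE => /nbhs_ballP[delta /= d0 H].
exists delta => // t t0 tm.
rewrite distrC; apply: H => /=; first by rewrite distrC in tm.
by rewrite in_itv/= t0.
Qed.

Lemma continuous_path_itv u (a b : R) : continuous_path u -> 0 <= a ->
  {within `[a, b], continuous u}.
Proof.
move=> cu a0; apply: continuous_subspaceW cu => t /=.
by rewrite !in_itv/= => /andP[/(le_trans a0) ->].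
Qed.

Lemma continuous_path_comp u c : continuous_path u -> continuous c ->
  continuous_path (c \o u).
Proof.
move=> cu cc x.
exact: (cvg_comp _ _ (cu x) (cc (u x))).
Qed.

Lemma continuous_path_shift u (a : R) : continuous_path u -> 0 <= a ->
  continuous_path (fun t => u (a + t)).
Proof.
move=> cu a0; apply/subspace_continuousP => m.
rewrite /= in_itv/= andbT => m0; apply/cvgrPdist_lt => e e0.
have [delta d0 H] := continuous_pathP cu (addr_ge0 a0 m0) e0.
rewrite near_withinE; apply/nbhs_ballP; exists delta => //= t.
rewrite /ball/= in_itv/= andbT distrC => tm t0; rewrite distrC.
apply: H; first by rewrite addr_ge0.
by rewrite opprD addrACA subrr add0r.
Qed.

Lemma first_after_ge c (s : \bar R) u : (s <= first_after c s u)%E.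
Proof. by apply: le_ereal_inf_tmp => _ [t [_ st _] <-]. Qed.

Lemma first_after_ge0 c (s : \bar R) u : (0 <= first_after c s u)%E.
Proof. by apply: le_ereal_inf_tmp => _ [t [t0 _ _] <-]; rewrite lee_fin. Qed.

Lemma first_after_le c (s : \bar R) u t : 0 <= t -> (s <= t%:E)%E ->
  c (u t) <= 0 -> (first_after c s u <= t%:E)%E.
Proof. by move=> t0 st ct; apply: ereal_inf_lbound; exists t. Qed.

(** The target is closed: were [c] positive at time [t], continuity would keep it positive for a
    while, and no passage could occur at or just after [t]. *)
Lemma first_after_attained c (s : \bar R) u t :
  continuous c -> continuous_path u -> first_after c s u = t%:E ->
  [/\ 0 <= t, (s <= t%:E)%E & c (u t) <= 0].
Proof.
move=> cc cu ft.
have t0 : 0 <= t by rewrite -lee_fin -ft first_after_ge0.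
split => //; first by rewrite -ft first_after_ge.
rewrite leNgt; apply/negP => ct.
have [delta d0 H] := continuous_pathP (continuous_path_comp cu cc) t0 ct.
have /ereal_inf_lt : (first_after c s u < (t + delta)%:E)%E.
  by rewrite ft lte_fin ltrDl.
case.
move=> _ [t' [t'0 st' ct'] <-]; rewrite lte_fin => t't.
have tt' : t <= t' by rewrite -lee_fin -ft first_after_le.
have /= := H t' t'0; rewrite ger0_norm ?subr_ge0// ltrBlDl => /(_ t't).
by rewrite ltr_norml => /andP[+ _]; lra.
Qed.

Lemma first_after_case c (s : \bar R) u : continuous c -> continuous_path u ->
  first_after c s u = +oo%E \/
  exists t, [/\ first_after c s u = t%:E, 0 <= t, (s <= t%:E)%E & c (u t) <= 0].
Proof.
move=> cc cu; case E : (first_after c s u) => [t| |]; last 2 first.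
- by left.
- by have := first_after_ge0 c s u; rewrite E.
by right; exists t; have [] := first_after_attained cc cu E.
Qed.

Lemma first_after_leP c (s : \bar R) u t : continuous c -> continuous_path u ->
  (first_after c s u <= t%:E)%E <->
  exists t', [/\ 0 <= t', (s <= t'%:E)%E, c (u t') <= 0 & t' <= t].
Proof.
move=> cc cu; split => [|[t' [t'0 st' ct' t't]]]; last first.
  by apply: (le_trans (first_after_le t'0 st' ct')); rewrite lee_fin.
have [->//|[t' [-> t'0 st' ct']]] := first_after_case s cc cu.
by rewrite lee_fin => t't; exists t'.
Qed.

(** A countable dense family of times in [[0, t]] that contains both end points and is indexed by
    all of [rat]. Events described by such times involve countable operations only and belong to the
    past of [t]. *)
Definition clamp (q : rat) t : R := Num.max 0 (Num.min (ratr q) t).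

Lemma clamp_itv q t : 0 <= t -> 0 <= clamp q t <= t.
Proof.
by move=> t0; rewrite /clamp le_max lexx/= ge_max t0/= ge_min lexx orbT.
Qed.

Lemma clamp_dense (s t e : R) : 0 <= s -> s <= t -> 0 < e ->
  exists q, s <= clamp q t < s + e.
Proof.
move=> s0 st e0; have se : s < s + e by rewrite ltrDl.
have [q] := rat_in_itvoo se.
rewrite in_itv/= => /andP[sq qe]; exists q.
rewrite /clamp le_max le_min (ltW sq) st orbT/= gt_max gt_min qe/= andbT.
by rewrite (le_lt_trans s0)// ltrDl.
Qed.

(** Compactness of the time interval: if the continuous function [c \o u] takes values below every
    [1 / (n + 1)], then its minimum is at most 0. The right-hand side involves countably many times,
    all at most [t], which is what makes passage times stopping times. *)
Lemma first_after_le_rat c (s : \bar R) u t : continuous c ->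
  continuous_path u -> 0 <= t ->
  (first_after c s u <= t%:E)%E <->
  forall n : nat, exists q : rat,
    (s <= (clamp q t)%:E)%E /\ c (u (clamp q t)) < n.+1%:R^-1.
Proof.
move=> cc cu t0; split.
- move=> /(first_after_leP s t cc cu)[t' [t'0 st' ct' t't]] n.
  have n0 : (0 : R) < n.+1%:R^-1 by rewrite invr_gt0.
  have [delta d0 H] := continuous_pathP (continuous_path_comp cu cc) t'0 n0.
  have [q /andP[q1 q2]] := clamp_dense t'0 t't d0.
  exists q; split.
    by apply: (le_trans st'); rewrite lee_fin.
  have := H (clamp q t) (le_trans t'0 q1).
  rewrite ger0_norm ?subr_ge0// ltrBlDl => /(_ q2).
  rewrite ltr_norml => /andP[_] /=.
  by move: ct'; move: (_^-1) (c _) (c _) => ? ? ?; lra.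
- move=> H; have [q0 [sq0 _]] := H 0%N.
  (* [s] may be negative or infinite; the condition for [n = 0] bounds it by [t], so the minimum is
     taken over a genuine compact interval from [a] to [t]. *)
  pose a := fine (maxe 0%E s).
  have [a0 sa] : 0 <= a /\ maxe 0%E s = a%:E.
    have : (maxe 0%E s <= t%:E)%E.
      rewrite ge_max lee_fin t0/= (le_trans sq0)// lee_fin.
      by have /andP[] := clamp_itv q0 t0.
    have : (0%E <= maxe 0%E s)%E by rewrite le_max lexx.
    by rewrite /a; case: (maxe 0%E s) => //= m.
  have ac q : (s <= (clamp q t)%:E)%E -> a <= clamp q t.
    move=> sq; rewrite -lee_fin -sa ge_max sq lee_fin andbT.
    by have /andP[] := clamp_itv q t0.
  have at' : a <= t by rewrite (le_trans (ac _ sq0))//; have /andP[] := clamp_itv q0 t0.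
  have [m] := EVT_min at' (continuous_path_itv (b := t) (continuous_path_comp cu cc) a0).
  rewrite in_itv/= => /andP[am mt] Hm.
  apply/(first_after_leP s t cc cu); exists m; split => //.
  + exact: le_trans am.
  + apply: (@le_trans _ _ a%:E); last by rewrite lee_fin.
    by rewrite -sa le_max lexx orbT.
  + rewrite leNgt; apply/negP => cm.
    have [n Hn] : exists n : nat, n.+1%:R^-1 < c (u m).
      have [k] := ltr_add_invr cm.
      by rewrite add0r; exists k.
    have [q [sq cq]] := H n.
    have := Hm (clamp q t); rewrite in_itv/= ac//=.
    have /andP[_ ->] := clamp_itv q t0 => /(_ isT) /= h.
    by have := le_lt_trans h cq; rewrite ltNge (ltW Hn).
Qed.

Lemma first_after_shift c s u : 0 <= s -> continuous c -> continuous_path u ->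
  first_after c s%:E u = (s%:E + first_after c 0%E (fun t => u (s + t)%R))%E.
Proof.
move=> s0 cc cu; apply/eqP; rewrite eq_le; apply/andP; split.
- have [->|[t [-> t0 _ ct]]] :=
    first_after_case 0%E cc (continuous_path_shift cu s0).
    by rewrite addey// leey.
  by rewrite -EFinD first_after_le ?addr_ge0// lee_fin lerDl.
- have [->|[t [-> t0 st ct]]] := first_after_case s%:E cc cu.
    by rewrite leey.
  rewrite lee_fin in st.
  have -> : t%:E = (s%:E + (t - s)%:E)%E by rewrite -EFinD addrC subrK.
  rewrite leeD2l// first_after_le ?subr_ge0// ?lee_fin ?subr_ge0//.
  by rewrite addrC subrK.
Qed.

(** A search for the target may be restarted at any moment before its success. A passage time thus
    becomes a passage time after an intermediate stopping time, the form to which the strong Markov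
    property applies. *)
Lemma first_after_restart c (s s' : \bar R) u :
  continuous c -> continuous_path u -> (s <= s')%E ->
  (s' <= first_after c s u)%E -> first_after c s u = first_after c s' u.
Proof.
move=> cc cu ss' s'f; apply/eqP; rewrite eq_le; apply/andP; split.
- have [->|[t [-> t0 st ct]]] := first_after_case s' cc cu; first exact: leey.
  by rewrite first_after_le// (le_trans ss').
- have [->|[t [E t0 st ct]]] := first_after_case s cc cu; first exact: leey.
  by rewrite E first_after_le// -E.
Qed.

Lemma first_after_mono c (s s' : \bar R) u : (s <= s')%E ->
  (first_after c s u <= first_after c s' u)%E.
Proof.
move=> ss'; apply: le_ereal_inf_tmp => _ [t [t0 st ct] <-].
by apply: first_after_le => //; apply: le_trans st.
Qed.

Definition dist_to p : R -> R := fun y => `|y - p|.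
Definition deficit p : R -> R := fun y => p - y.

Lemma continuous_dist_to p : continuous (dist_to p).
Proof.
move=> y; apply: (@cvg_norm _ _ _ _ _ (fun y => y - p)).
by apply: cvgB => //; exact: cvg_cst.
Qed.

Lemma continuous_deficit p : continuous (deficit p).
Proof. by move=> y; apply: cvgB => //; exact: cvg_cst. Qed.

Lemma dist_to_le0 p y : (dist_to p y <= 0) = (y == p).
Proof. by rewrite /dist_to normr_le0 subr_eq0. Qed.

Lemma deficit_le0 p y : (deficit p y <= 0) = (p <= y).
Proof. by rewrite /deficit subr_le0. Qed.

Notation hit_after p := (first_after (dist_to p)).

Lemma hit_after_ivt u (a b p : R) : continuous_path u -> 0 <= a -> a <= b ->
  Num.min (u a) (u b) <= p <= Num.max (u a) (u b) ->
  (hit_after p a%:E u <= b%:E)%E.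
Proof.
move=> cu a0 ab pu.
have [m] := IVT ab (continuous_path_itv cu a0) pu.
rewrite in_itv/= => /andP[am mb] um.
apply: (@le_trans _ _ m%:E); last by rewrite lee_fin.
by rewrite first_after_le ?lee_fin// ?(le_trans a0)// dist_to_le0 um.
Qed.

End paths.

Notation hit_after p := (first_after (dist_to p)).

(** * Sigma-algebras given as sets of sets *)

Section sigma_algebra_closure.
Context {T : pointedType} {S : set (set T)} (hS : sigma_algebra setT S).

(** A sigma-algebra coincides with the one it generates, so the library's measurability lemmas
    become available for the filtration and for stopped sigma-algebras. *)
Lemma sigma_algebra_measurable A :
  S A = measurable (A : set (g_sigma_algebraType S)).
Proof. by rewrite -[in LHS](sigma_algebra_id hS). Qed.

Lemma sigma_algebraT : S setT.
Proof. by rewrite sigma_algebra_measurable; exact: measurableT. Qed.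

Lemma sigma_algebraC A : S A -> S (~` A).
Proof. by rewrite !sigma_algebra_measurable; exact: measurableC. Qed.

Lemma sigma_algebraI A B : S A -> S B -> S (A `&` B).
Proof. by rewrite !sigma_algebra_measurable; exact: measurableI. Qed.

Lemma sigma_algebraU A B : S A -> S B -> S (A `|` B).
Proof. by rewrite !sigma_algebra_measurable; exact: measurableU. Qed.

Lemma sigma_algebraD A B : S A -> S B -> S (A `\` B).
Proof. by rewrite !sigma_algebra_measurable; exact: measurableD. Qed.

Lemma sigma_algebra_bigcupT (F : nat -> set T) :
  (forall n, S (F n)) -> S (\bigcup_n F n).
Proof.
move=> SF; rewrite sigma_algebra_measurable.
by apply: bigcupT_measurable => n; rewrite -sigma_algebra_measurable.
Qed.

Lemma sigma_algebra_bigcapT (F : nat -> set T) :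
  (forall n, S (F n)) -> S (\bigcap_n F n).
Proof.
move=> SF; rewrite sigma_algebra_measurable.
by apply: bigcapT_measurable => n; rewrite -sigma_algebra_measurable.
Qed.

Lemma sigma_algebra_rat (F : rat -> set T) :
  (forall q, S (F q)) -> S (\bigcup_q F q).
Proof.
move=> SF; rewrite sigma_algebra_measurable.
by apply: bigcupT_measurable_rat => q; rewrite -sigma_algebra_measurable.
Qed.

End sigma_algebra_closure.

Lemma measurable_fun_ereal_le (R : realType) (d : measure_display)
    (T : measurableType d) (f : T -> \bar R) :
  (forall w, (0 <= f w)%E) ->
  (forall t : R, 0 <= t -> measurable [set w | (f w <= t%:E)%E]) ->
  measurable_fun setT f.
Proof.
move=> f0 mf; apply: (measurability _ (ErealGenOInfty.measurableE R)).
move=> _ [_ [t ->] <-]; rewrite setTI.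
have [t0|t0] := leP 0 t.
  rewrite (_ : _ @^-1` _ = ~` [set w | (f w <= t%:E)%E]).
    by apply: measurableC; exact: mf.
  apply/funext => w; apply/propext => /=; rewrite in_itv/= andbT ltNge.
  by split => /negP.
rewrite (_ : _ @^-1` _ = setT)//; apply/seteqP; split => w //= _.
by rewrite in_itv/= andbT (lt_le_trans _ (f0 w))// lte_fin.
Qed.

(** * Stopping times of the natural filtration *)

Section stopping_times.
Context {R : realType} {d : measure_display} {T : measurableType d}.
Context {X : R -> T -> R} (mX : forall t : R, 0 <= t -> measurable_fun setT (X t))
  (cX : forall w, continuous_path (X ^~ w)).
Implicit Types (sigma tau : T -> \bar R) (A B : set T) (s t : R).

Local Notation nf := (natural_filtration X).
Local Notation stopped := (stopped_sigma_algebra X).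

Lemma natural_filtration_sa t : sigma_algebra setT (nf t).
Proof. exact: smallest_sigma_algebra. Qed.

Lemma generated_by_sa : sigma_algebra setT (generated_by X).
Proof. exact: smallest_sigma_algebra. Qed.

Lemma natural_filtrationS s t A : s <= t -> nf s A -> nf t A.
Proof.
move=> st; apply: sub_sigma_algebra2 => _ [u /andP[u0 us] [B mB ->]].
by exists u; [rewrite u0 (le_trans us)|exists B].
Qed.

Lemma natural_filtration_preimage s t (B : set R) :
  0 <= s <= t -> measurable B -> nf t (X s @^-1` B).
Proof. by move=> st mB; apply: sub_sigma_algebra; exists s => //; exists B. Qed.

Lemma natural_filtration_generated t A : nf t A -> generated_by X A.
Proof.
apply: sub_sigma_algebra2 => _ [u /andP[u0 us] [B mB ->]].
by exists u => //; exists B.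
Qed.

Lemma generated_measurable A : generated_by X A -> measurable A.
Proof.
move: A; apply: smallest_sub.
  split; first exact: measurable0.
    by move=> A mA; rewrite setTD; exact: measurableC.
  by move=> F mF; exact: bigcupT_measurable.
move=> _ [s s0 [B mB ->]].
by rewrite -[X in measurable X]setTI; exact: mX.
Qed.

Lemma stopped_sa sigma : stopping_time X sigma -> sigma_algebra setT (stopped sigma).
Proof.
move=> [_ st]; split.
- split; first by case: generated_by_sa.
  by move=> t _; rewrite set0I; case: (natural_filtration_sa t).
- move=> A [gA nA]; rewrite setTD; split.
    exact: (sigma_algebraC generated_by_sa).
  move=> t t0; rewrite (_ : _ `&` _ = [set w | (sigma w <= t%:E)%E] `\`
    (A `&` [set w | (sigma w <= t%:E)%E])).
    by apply: (sigma_algebraD (natural_filtration_sa t)); [exact: st|exact: nA].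
  apply/seteqP; split => w /=; first by move=> [aw sw]; split => // -[].
  by move=> [sw H]; split => // aw; apply: H.
- move=> F sF; split.
    by apply: (sigma_algebra_bigcupT generated_by_sa) => n; case: (sF n).
  move=> t t0; rewrite setI_bigcupl.
  by apply: (sigma_algebra_bigcupT (natural_filtration_sa t)) => n; case: (sF n) => _; exact.
Qed.

Lemma stopped_generated sigma A : stopped sigma A -> generated_by X A.
Proof. by case. Qed.

Lemma stopped_measurable sigma A : stopped sigma A -> measurable A.
Proof. by move/stopped_generated/generated_measurable. Qed.

Lemma stopping_time_le_lt sigma t : stopping_time X sigma -> 0 <= t ->
  nf t [set w | (t%:E < sigma w)%E].
Proof.
move=> [_ st] t0; rewrite (_ : mkset _ = ~` [set w | (sigma w <= t%:E)%E]).
  by apply: (sigma_algebraC (natural_filtration_sa t)); exact: st.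
by apply/seteqP; split => w /=; [rewrite ltNge => /negP|move=> /negP; rewrite -ltNge].
Qed.

Lemma stopping_time_generated sigma (e : \bar R) : stopping_time X sigma ->
  generated_by X [set w | (sigma w <= e)%E].
Proof.
move=> [s0 st]; case: e => [t| |].
- have [t0|t0] := leP 0 t.
    by apply: (@natural_filtration_generated t); exact: st.
  rewrite (_ : mkset _ = set0); first by case: generated_by_sa.
  apply/seteqP; split => w //=; apply/negP; rewrite -ltNge.
  by apply: lt_le_trans (s0 w); rewrite lte_fin.
- rewrite (_ : mkset _ = setT); first exact: (sigma_algebraT generated_by_sa).
  by apply/seteqP; split => w //= _; exact: leey.
- rewrite (_ : mkset _ = set0); first by case: generated_by_sa.
  apply/seteqP; split => w //=; apply/negP; rewrite -ltNge.
  exact: lt_le_trans (s0 w).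
Qed.

Lemma stopping_time_measurable sigma : stopping_time X sigma ->
  measurable_fun setT sigma.
Proof.
move=> st; apply: measurable_fun_ereal_le; first by case: st.
by move=> t t0; apply: generated_measurable; exact: stopping_time_generated.
Qed.

(* Turns a comparison of two random times into a countable union of events. *)
Lemma lt_clamp (a b : \bar R) t : 0 <= t -> (0 <= a)%E -> (a <= t%:E)%E ->
  (a < b)%E -> exists q, (a <= (clamp q t)%:E)%E /\ ((clamp q t)%:E < b)%E.
Proof.
move=> t0 a0 at' ab.
have [x Ex] : exists x, a = x%:E.
  by case: a a0 at' {ab} => [x| |] // _ _; exists x.
move: a0 at' ab; rewrite Ex !lee_fin => x0 xt xb.
have [q Hq] : exists q, x <= clamp q t /\ ((clamp q t)%:E < b)%E.
  case: b xb => [y| |] //; last first.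
    by move=> _; have [q /andP[? _]] := clamp_dense x0 xt ltr01; exists q; rewrite ltry.
  rewrite lte_fin -subr_gt0 => /(clamp_dense x0 xt)[q].
  by rewrite addrC subrK => /andP[? ?]; exists q; rewrite lte_fin.
by exists q; rewrite lee_fin.
Qed.

(** Here and below, [_r] and [_l] tell whether the sigma-algebra is that of [tau] or that of
    [sigma]. On [tau <= t], the inequality [tau < sigma] is witnessed by one of the countably many
    times [clamp q t] between the two, and each such witness is an event of the past of [t]. *)
Lemma stopped_lt_r sigma tau : stopping_time X sigma -> stopping_time X tau ->
  stopped tau [set w | (tau w < sigma w)%E].
Proof.
move=> st tt.
have key t : 0 <= t ->
    nf t ([set w | (tau w < sigma w)%E] `&` [set w | (tau w <= t%:E)%E]).
  move=> t0; rewrite (_ : _ `&` _ = \bigcup_q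
    ([set w | (tau w <= (clamp q t)%:E)%E] `&` [set w | ((clamp q t)%:E < sigma w)%E])).
    apply: (sigma_algebra_rat (natural_filtration_sa t)) => q.
    have /andP[c0 ct] := clamp_itv q t0.
    apply: (natural_filtrationS ct).
    apply: (sigma_algebraI (natural_filtration_sa _)).
    - by case: tt => _; exact.
    - exact: stopping_time_le_lt.
  apply/seteqP; split => w /=.
  - move=> [ts tle]; have [q [? ?]] := lt_clamp t0 (tt.1 w) tle ts.
    by exists q.
  - move=> [q _ /= [tq qs]]; split; first exact: le_lt_trans qs.
    by apply: (le_trans tq); rewrite lee_fin; have /andP[] := clamp_itv q t0.
split => //.
rewrite (_ : mkset _ = \bigcup_n ([set w | (tau w < sigma w)%E] `&`
  [set w | (tau w <= n%:R%:E)%E])).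
  apply: (sigma_algebra_bigcupT generated_by_sa) => n.
  by apply: (@natural_filtration_generated n%:R); exact: key.
apply/seteqP; split => w /=; last by move=> [n _ []].
move=> ts; case E : (tau w) => [x| |].
- exists (Num.truncn x).+1 => //=; rewrite E; split; first by rewrite -E.
  by rewrite lee_fin ltW// truncnS_gt.
- by move: ts; rewrite E; case: (sigma w).
- by have := tt.1 w; rewrite E.
Qed.

Lemma stopped_le_r sigma tau : stopping_time X sigma -> stopping_time X tau ->
  stopped tau [set w | (sigma w <= tau w)%E].
Proof.
move=> st tt; rewrite (_ : mkset _ = ~` [set w | (tau w < sigma w)%E]).
  by apply: (sigma_algebraC (stopped_sa tt)); exact: stopped_lt_r.
by apply/seteqP; split => w /=; [rewrite leNgt => /negP|move=> /negP; rewrite -leNgt].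
Qed.

Lemma stopped_le_l sigma tau : stopping_time X sigma -> stopping_time X tau ->
  stopped sigma [set w | (sigma w <= tau w)%E].
Proof.
move=> st tt.
have gle : generated_by X [set w | (sigma w <= tau w)%E].
  exact: (stopped_le_r st tt).1.
split => // t t0.
(* The complement inside [sigma <= t] is described: there [tau < sigma] forces [tau <= t], so that a
   separating time exists. *)
rewrite (_ : _ `&` _ = [set w | (sigma w <= t%:E)%E] `\` (\bigcup_q
    ([set w | (tau w <= (clamp q t)%:E)%E] `&`
     ([set w | ((clamp q t)%:E < sigma w)%E] `&` [set w | (sigma w <= t%:E)%E])))).
  apply: (sigma_algebraD (natural_filtration_sa t)); first by case: st => _; exact.
  apply: (sigma_algebra_rat (natural_filtration_sa t)) => q.
  have /andP[c0 ct] := clamp_itv q t0.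
  apply: (sigma_algebraI (natural_filtration_sa t)).
    by apply: (natural_filtrationS ct); case: tt => _; exact.
  apply: (sigma_algebraI (natural_filtration_sa t)).
    by apply: (natural_filtrationS ct); exact: stopping_time_le_lt.
  by case: st => _; exact.
apply/seteqP; split => w /=.
- move=> [lst sle]; split => // -[q _ /= [tq [qs _]]].
  by have := lt_le_trans (le_lt_trans tq qs) lst; rewrite ltxx.
- move=> [sle H]; split => //; rewrite leNgt; apply/negP => ts.
  have [q [? ?]] := lt_clamp t0 (tt.1 w) (le_trans (ltW ts) sle) ts.
  by apply: H; exists q.
Qed.

Lemma stopped_lt_l sigma tau : stopping_time X sigma -> stopping_time X tau ->
  stopped sigma [set w | (tau w < sigma w)%E].
Proof.
move=> st tt; rewrite (_ : mkset _ = ~` [set w | (sigma w <= tau w)%E]).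
  by apply: (sigma_algebraC (stopped_sa st)); exact: stopped_le_l.
by apply/seteqP; split => w /=; [rewrite ltNge => /negP|move=> /negP; rewrite -ltNge].
Qed.

Lemma stopped_mono sigma tau A : stopping_time X tau ->
  (forall w, (sigma w <= tau w)%E) -> stopped sigma A -> stopped tau A.
Proof.
move=> tt le [gA nA]; split => // t t0.
rewrite (_ : _ `&` _ = (A `&` [set w | (sigma w <= t%:E)%E]) `&`
   [set w | (tau w <= t%:E)%E]).
  by apply: (sigma_algebraI (natural_filtration_sa t)); [exact: nA|case: tt => _; exact].
apply/seteqP; split => w /=; last by move=> [[]].
by move=> [aw tw]; split => //; split => //; exact: le_trans tw.
Qed.

Lemma stopping_time_cst s : 0 <= s -> stopping_time X (fun=> s%:E).
Proof.
move=> s0; split => // t t0; have [st|st] := leP s t.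
- rewrite (_ : mkset _ = setT); first exact: (sigma_algebraT (natural_filtration_sa _)).
  by apply/seteqP; split => w //= _; rewrite lee_fin.
- rewrite (_ : mkset _ = set0); first by case: (natural_filtration_sa t).
  by apply/seteqP; split => w //=; rewrite lee_fin leNgt st.
Qed.

Lemma stopping_time_shift sigma s : 0 <= s -> stopping_time X sigma ->
  stopping_time X (fun w => sigma w + s%:E)%E.
Proof.
move=> s0 st; split; first by move=> w; rewrite adde_ge0//; case: st.
move=> t t0; have [le_st|lt_ts] := leP s t.
- apply: (@natural_filtrationS (t - s)); first by rewrite gerBl.
  rewrite (_ : mkset _ = [set w | (sigma w <= (t - s)%:E)%E]).
    by case: st => _; apply; rewrite subr_ge0.
  by apply/seteqP; split => w /=; rewrite EFinB leeBrDr.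
- rewrite (_ : mkset _ = set0); first by case: (natural_filtration_sa t).
  apply/seteqP; split => w //=; apply/negP; rewrite -ltNge.
  apply: (@lt_le_trans _ _ s%:E); first by rewrite lte_fin.
  by rewrite leeDr//; case: st.
Qed.

Lemma stopping_time_min sigma tau : stopping_time X sigma -> stopping_time X tau ->
  stopping_time X (fun w => Order.min (sigma w) (tau w)).
Proof.
move=> [s0 st] [t0 tt]; split; first by move=> w; rewrite le_min s0 t0.
move=> t t0'; rewrite (_ : mkset _ =
  [set w | (sigma w <= t%:E)%E] `|` [set w | (tau w <= t%:E)%E]).
  by apply: (sigma_algebraU (natural_filtration_sa t)); [exact: st|exact: tt].
by apply/seteqP; split => w /=; rewrite ge_min => /orP.
Qed.

(** The closed target and the continuity of every path give the stopping property for the raw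
    natural filtration: by [first_after_le_rat], passage by time [t] depends on positions at
    countably many times up to [t]. *)
Lemma stopping_time_first_after c sigma : continuous c -> stopping_time X sigma ->
  stopping_time X (fun w => first_after c (sigma w) (X ^~ w)).
Proof.
move=> cc [s0 st]; split; first by move=> w; exact: first_after_ge0.
move=> t t0; rewrite (_ : mkset _ = \bigcap_n \bigcup_q
    ([set w | (sigma w <= (clamp q t)%:E)%E] `&`
     X (clamp q t) @^-1` (c @^-1` [set y | y < n.+1%:R^-1]))).
  apply: (sigma_algebra_bigcapT (natural_filtration_sa t)) => n.
  apply: (sigma_algebra_rat (natural_filtration_sa t)) => q.
  have cqt := clamp_itv q t0; have /andP[c0 ct] := cqt.
  apply: (sigma_algebraI (natural_filtration_sa t)).
    by apply: (natural_filtrationS ct); exact: st.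
  apply: natural_filtration_preimage => //.
  rewrite -[X in measurable X]setTI.
  apply: (continuous_measurable_fun cc) => //.
  by rewrite -set_itvNyo; exact: measurable_itv.
apply/seteqP; split => w /=.
- move=> /(first_after_le_rat _ cc (@cX w) t0) H n _.
  by have [q [? ?]] := H n; exists q.
- move=> H; apply/(first_after_le_rat _ cc (@cX w) t0) => n.
  by have [q _ [? ?]] := H n I; exists q.
Qed.

End stopping_times.

(** * Discounting at possibly infinite times *)

Section discount.
Context {R : realType} (rho : R).

(** The value 0 at [+oo] takes over the role of the indicator of finiteness, so that a payoff is a
    plain product, as in [payoffE]. *)
Definition edisc (t : \bar R) : R :=
  if t is s%:E then expR (- (rho * s)) else 0.

Lemma edisc_ge0 t : 0 <= edisc t.
Proof. by case: t => //= s; exact: expR_ge0. Qed.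

Lemma measurable_edisc : measurable_fun setT edisc.
Proof.
rewrite (_ : edisc = fun t => \1_[set x : \bar R | x \is a fin_num] t *
    expR (- rho * fine t)).
  apply: measurable_funM.
  - apply: measurable_indic; rewrite -[X in measurable X]setTI.
    exact: emeasurable_fin_num.
  - apply: (measurableT_comp (f := expR)) => //.
    by apply: measurable_funM => //; exact: fine_measurable.
apply/funext => -[t| |] /=.
- by rewrite indicE mem_set// mul1r mulNr.
- by rewrite indicE memNset ?mul0r.
- by rewrite indicE memNset ?mul0r.
Qed.

End discount.

(** * Integrals with weights measurable for a sub-sigma-algebra *)

Section integral_tools.
Context {R : realType} {d : measure_display} {T : measurableType d}.
Variable mu : {measure set T -> \bar R}.
Local Open Scope ereal_scope.

Lemma integral_vanish (A B : set T) (h : T -> \bar R) :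
  (forall w, B w -> ~ A w -> h w = 0) ->
  \int[mu]_(w in B) h w = \int[mu]_(w in B `&` A) h w.
Proof.
move=> hA; rewrite [LHS]integral_mkcond [RHS]integral_mkcond.
apply: eq_integral => w _; rewrite /patch.
have [wB|wB] := boolP (w \in B); last first.
  by rewrite ifF//; apply/negP; rewrite in_setI (negbTE wB).
rewrite in_setI wB/=; have [//|wA] := boolP (w \in A).
by apply: hA; [rewrite -in_setE|rewrite notin_setE in wA].
Qed.

(** The pull-out property of conditional expectations, stated without them and for possibly infinite
    nonnegative integrands: equality over all events of [S] extends to weights measurable for [S],
    by the monotone class argument in [Z]. *)
Lemma integral_weight (S : set (set T)) (E : set T) (Y1 Y2 : T -> \bar R) :
  sigma_algebra setT S -> (forall A, S A -> measurable A) -> measurable E ->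
  measurable_fun setT Y1 -> measurable_fun setT Y2 ->
  (forall w, 0 <= Y1 w) -> (forall w, 0 <= Y2 w) ->
  (forall B, S B -> \int[mu]_(w in B `&` E) Y1 w = \int[mu]_(w in B `&` E) Y2 w) ->
  forall Z : T -> \bar R,
    measurable_fun setT (Z : g_sigma_algebraType S -> \bar R) ->
    (forall w, 0 <= Z w) ->
    \int[mu]_(w in E) (Z w * Y1 w) = \int[mu]_(w in E) (Z w * Y2 w).
Proof.
move=> hS Sm mE mY1 mY2 Y10 Y20 H Z mZ Z0.
have mT (f : T -> \bar R) : measurable_fun setT (f : g_sigma_algebraType S -> \bar R) ->
    measurable_fun setT f.
  move=> mf _ V mV; apply: Sm; rewrite (sigma_algebra_measurable hS).
  exact: mf.
have mM (f g : T -> \bar R) : measurable_fun setT (f : g_sigma_algebraType S -> \bar R) ->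
    measurable_fun setT g -> measurable_fun E (fun w => f w * g w).
  by move=> mf mg; apply: measurable_funTS; apply: emeasurable_funM => //; exact: mT.
move: Z mZ Z0; apply: (@ge0_measurable_ind R _ (g_sigma_algebraType S) (fun Z =>
  \int[mu]_(w in E) (Z w * Y1 w) = \int[mu]_(w in E) (Z w * Y2 w))).
- move=> B mB.
  have SB : S B by rewrite (sigma_algebra_measurable hS).
  have ind (Y : T -> \bar R) : (forall w, 0 <= Y w) ->
      \int[mu]_(w in E) ((\1_B w)%:E * Y w) = \int[mu]_(w in B `&` E) Y w.
    move=> Y0; rewrite (@integral_vanish B); last first.
      by move=> w _ wB; rewrite indicE memNset// mul0e.
    rewrite setIC; apply: eq_integral => w; rewrite in_setI => /andP[wB _].
    by rewrite indicE wB mul1e.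
  by rewrite !ind// H.
- move=> c f c0 mf f0 IH.
  under eq_integral do rewrite -muleA.
  under [RHS]eq_integral do rewrite -muleA.
  rewrite !ge0_integralZl//; try exact: mM.
  + by rewrite IH.
  + by move=> w _; rewrite mule_ge0.
  + by move=> w _; rewrite mule_ge0.
- move=> f g mf f0 mg g0 IHf IHg.
  under eq_integral do rewrite ge0_muleDl//.
  under [RHS]eq_integral do rewrite ge0_muleDl//.
  rewrite !ge0_integralD//; try exact: mM.
  + by rewrite IHf IHg.
  + by move=> w _; rewrite mule_ge0.
  + by move=> w _; rewrite mule_ge0.
  + by move=> w _; rewrite mule_ge0.
  + by move=> w _; rewrite mule_ge0.
- move=> f mf f0 ndf IH.
  have key (Y : T -> \bar R) : measurable_fun setT Y -> (forall w, 0 <= Y w) ->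
      \int[mu]_(w in E) (limn (f ^~ w) * Y w) =
      limn (fun n => \int[mu]_(w in E) (f n w * Y w)).
    move=> mY Y0; rewrite -monotone_convergence//; first last.
    + by move=> w _ n m nm; rewrite lee_wpmul2r//; exact: ndf.
    + by move=> n w _; rewrite mule_ge0.
    + by move=> n; exact: mM.
    apply: eq_integral => w _; apply/esym/cvg_lim => //.
    have fw : f ^~ w @ \oo --> limn (f ^~ w).
      exact/ereal_nondecreasing_is_cvgn/ndf.
    (* The product is continuous except at the form [0 * +oo], so a vanishing factor and a vanishing
       limit are treated apart; a vanishing limit forces all terms to vanish by monotonicity. *)
    have [->|Yneq0] := eqVneq (Y w) 0.
      by under eq_fun do rewrite mule0; rewrite mule0; exact: cvg_cst.
    have [L0|Lneq0] := eqVneq (limn (f ^~ w)) 0.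
      rewrite L0 mul0e; under eq_fun => n.
        rewrite (_ : f n w = 0) ?mul0e; last first.
          apply/eqP; rewrite eq_le f0 andbT -L0.
          have -> : limn (f ^~ w) = ereal_sup (range (f ^~ w)).
            by apply/cvg_lim => //; exact/ereal_nondecreasing_cvgn/ndf.
          by apply: ereal_sup_ubound; exists n.
        over.
      exact: cvg_cst.
    apply: cvgeM => //; last exact: cvg_cst.
    by rewrite mule_defE (negbTE Yneq0) (negbTE Lneq0).
  rewrite !key//; congr (limn _); apply/funext => n; exact: IH.
Qed.

End integral_tools.

(** * The strong Markov property for path functionals *)

Section strong_markov.
Context {R : realType} {d : measure_display} {T : measurableType d}.
Context {D : set R} {X : R -> T -> R} {P : R -> probability T R}.
Hypothesis mD : measurable D.
Hypothesis SM : strong_markov_family D X P.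
Local Open Scope ereal_scope.

Let mX := smf_measurable SM.
Let cX : forall w, continuous_path (X ^~ w) := fun w => smf_continuous SM (w := w).

(** Round [Y] up to a multiple of [1 / (n + 1)]. The rounded time takes countably many values, so
    the position at that time is measurable, and path continuity passes to the limit. *)
Lemma measurable_value_at (Y : T -> R) : measurable_fun setT Y ->
  (forall w, (0 <= Y w)%R) -> measurable_fun setT (fun w => X (Y w) w).
Proof.
move=> mY Y0; apply/measurable_EFinP.
pose k n w := Num.truncn (n.+1%:R * Y w)%R.
apply: (@emeasurable_fun_cvg _ _ _ _ (fun n w =>
  (X ((k n w).+1%:R / n.+1%:R)%R w)%:E)).
- move=> n; apply/measurable_EFinP => _ B mB; rewrite setTI.
  rewrite (_ : _ @^-1` B = \bigcup_m ((fun w => (n.+1%:R * Y w)%R) @^-1` `[m%:R, m.+1%:R[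
     `&` X (m.+1%:R / n.+1%:R)%R @^-1` B)); last first.
    apply/seteqP; split => w /=.
    + move=> BX; exists (k n w) => //=; rewrite in_itv/=.
      by rewrite truncn_itv// mulr_ge0.
    + move=> [m _ /= []]; rewrite in_itv/= => mk BX.
      by rewrite /k (truncn_def mk).
  apply: bigcupT_measurable => m; apply: measurableI.
  + rewrite -[X in measurable X]setTI.
    by apply: (measurable_funM (measurable_cst _) mY) => //; exact: measurable_itv.
  + rewrite -[X in measurable X]setTI; exact: mX.
- move=> w _; apply: cvg_EFin; first by near=> n.
  apply/cvgrPdist_lt => e e0.
  have [delta d0 H] := continuous_pathP (@cX w) (Y0 w) e0.
  have [N _ HN] := near_infty_natSinv_lt (PosNum d0).
  exists N => // n /= /HN /= nd; rewrite distrC; apply: H.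
    by rewrite divr_ge0.
  have n0 : (0 < n.+1%:R :> R)%R by rewrite ltr0n.
  have /andP[k1 k2] := truncn_itv (mulr_ge0 (ltW n0) (Y0 w)).
  rewrite (_ : (_ / _ - _ = ((k n w).+1%:R - n.+1%:R * Y w) / n.+1%:R)%R); last first.
    by rewrite mulrBl [(n.+1%:R * _)%R]mulrC mulfK ?gt_eqF.
  rewrite normrM [`|_^-1|%R]ger0_norm ?invr_ge0 ?(ltW n0)//.
  apply: le_lt_trans nd; rewrite ler_piMl ?invr_ge0 ?(ltW n0)//.
  rewrite ler_norml; apply/andP; split.
    by rewrite (@le_trans _ _ 0%R)// ?oppr_le0// subr_ge0 ltW.
  by rewrite -natr1 lerBlDl lerD2r.
Unshelve. all: by end_near.
Qed.

Lemma measurable_stopped_value tau : stopping_time X tau ->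
  measurable_fun setT (fun w => X (fine (tau w)) w).
Proof.
move=> st; apply: measurable_value_at.
  by apply: (measurableT_comp (f := fine)) => //; exact: (stopping_time_measurable mX st).
by move=> w; rewrite fine_ge0//; case: st.
Qed.

Definition path_space := g_sigma_algebraType [set A : set (R -> R) |
  exists2 t : R, (0 <= t)%R & exists2 B : set R, measurable B & A = [set u | B (u t)]].

Lemma path_preimage (S : set (set T)) (V : R -> T -> R) (A : set (R -> R)) :
  sigma_algebra setT S ->
  (forall t B, (0 <= t)%R -> measurable B -> S (V t @^-1` B)) ->
  path_measurable A -> S [set w | A (V ^~ w)].
Proof.
move=> hS SV; move: A; apply: smallest_sub.
  split.
  - by case: hS.
  - move=> A SA; rewrite setTD; exact: (sigma_algebraC hS SA).
  - by move=> F SF; exact: (sigma_algebra_bigcupT hS SF).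
by move=> _ [t t0 [B mB ->]]; exact: SV.
Qed.

Lemma generated_by_path (A : set (R -> R)) : path_measurable A ->
  generated_by X [set w | A (X ^~ w)].
Proof.
apply: path_preimage; first exact: generated_by_sa.
by move=> t B t0 mB; apply: sub_sigma_algebra; exists t => //; exists B.
Qed.

Lemma measurable_path (V : R -> T -> R) :
  (forall t, (0 <= t)%R -> measurable_fun setT (V t)) ->
  measurable_fun setT ((fun w => V ^~ w) : T -> path_space).
Proof.
move=> mV _ A mA; rewrite setTI.
apply: (@path_preimage measurable V A) => //.
  split; first exact: measurable0.
    by move=> B mB; rewrite setTD; exact: measurableC.
  by move=> F mF; exact: bigcupT_measurable.
by move=> t B t0 mB; rewrite -[Z in measurable Z]setTI; exact: mV.
Qed.

Lemma measurable_shifted_path tau : stopping_time X tau ->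
  measurable_fun setT
    ((fun w t => X (fine (tau w) + t)%R w) : T -> path_space).
Proof.
move=> st; apply: measurable_path => t t0.
apply: (measurable_value_at (Y := fun w => (fine (tau w) + t)%R)).
  apply: measurable_funD => //.
  by apply: (measurableT_comp (f := fine)) => //; exact: (stopping_time_measurable mX st).
by move=> w; rewrite addr_ge0// fine_ge0//; case: st.
Qed.

Definition path_expectation (F : (R -> R) -> \bar R) (y : R) : \bar R :=
  \int[P y]_v F (X ^~ v).

Lemma path_expectation_ge0 F y : (forall u, 0 <= F u) -> 0 <= path_expectation F y.
Proof. by move=> F0; apply: integral_ge0 => v _. Qed.

Lemma measurable_comp_path (F : path_space -> \bar R) :
  measurable_fun setT F -> measurable_fun setT (fun v => F (X ^~ v)).
Proof.
move=> mF; apply: (measurableT_comp mF).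
exact: (@measurable_path X mX).
Qed.

Lemma measurable_path_expectation (F : path_space -> \bar R) :
  measurable_fun setT F -> (forall u, 0 <= F u) ->
  measurable_fun D (path_expectation F).
Proof.
move: F; apply: ge0_measurable_ind.
- move=> A mA; rewrite (_ : path_expectation _ = fun y => P y [set v | A (X ^~ v)]).
    by apply: smf_kernel SM _ _; exact: generated_by_path.
  apply/funext => y; rewrite /path_expectation.
  rewrite -[Z in P y Z]setIT -integral_indic//.
  by apply: (generated_measurable mX); exact: generated_by_path.
- move=> c F c0 mF F0 IH.
  rewrite (_ : path_expectation _ = fun y => c%:E * path_expectation F y).
    exact: measurable_funeM.
  apply/funext => y; rewrite /path_expectation ge0_integralZl//.
  exact: measurable_comp_path.
- move=> F G mF F0 mG G0 IHF IHG.
  rewrite (_ : path_expectation _ = fun y => path_expectation F y + path_expectation G y).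
    exact: emeasurable_funD.
  apply/funext => y; rewrite /path_expectation ge0_integralD//;
    exact: measurable_comp_path.
- move=> F mF F0 ndF IH.
  rewrite (_ : path_expectation _ = fun y => limn (fun n => path_expectation (F n) y)).
    apply: emeasurable_fun_cvg IH _ => y Dy.
    apply: ereal_nondecreasing_is_cvgn => n m nm.
    apply: ge0_le_integral => //; try exact: measurable_comp_path.
    by move=> v _; exact: ndF.
  apply/funext => y; rewrite /path_expectation monotone_convergence//.
  by move=> n; exact: measurable_comp_path.
Qed.

Lemma measurable_path_expectation_at (F : path_space -> \bar R) tau :
  measurable_fun setT F -> (forall u, 0 <= F u) -> stopping_time X tau ->
  measurable_fun setT (fun w => path_expectation F (X (fine (tau w)) w)).
Proof.
move=> mF F0 st.
apply: (measurable_comp mD _ (measurable_path_expectation mF F0)).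
  move=> _ [w _ <-]; apply: smf_state SM _ _ _.
  by rewrite fine_ge0//; case: st.
exact: measurable_stopped_value.
Qed.

Lemma strong_markov_path x tau B (F : path_space -> \bar R) :
  D x -> stopping_time X tau -> stopped_sigma_algebra X tau B ->
  measurable_fun setT F -> (forall u, 0 <= F u) ->
  \int[P x]_(w in B `&` [set w | tau w < +oo]) F (fun t => X (fine (tau w) + t)%R w)
  = \int[P x]_(w in B `&` [set w | tau w < +oo])
      path_expectation F (X (fine (tau w)) w).
Proof.
move=> Dx st sB mF F0.
have mE : measurable (B `&` [set w | tau w < +oo]).
  apply: measurableI; first exact: (stopped_measurable mX sB).
  rewrite -[Z in measurable Z]setTI.
  by apply: emeasurable_fun_infty_o => //; exact: (stopping_time_measurable mX st).
have mC (G : path_space -> \bar R) : measurable_fun setT G ->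
    measurable_fun (B `&` [set w | tau w < +oo])
      (fun w => G (fun t => X (fine (tau w) + t)%R w)).
  move=> mG; apply: measurable_funTS.
  by apply: (measurableT_comp mG); exact: measurable_shifted_path.
have mK (G : path_space -> \bar R) : measurable_fun setT G -> (forall u, 0 <= G u) ->
    measurable_fun (B `&` [set w | tau w < +oo])
      (fun w => path_expectation G (X (fine (tau w)) w)).
  by move=> mG G0; apply: measurable_funTS; exact: measurable_path_expectation_at.
move: F mF F0; apply: ge0_measurable_ind.
- move=> A mA; rewrite [LHS]integral_indic//; last first.
    by rewrite -[Z in measurable Z]setTI; exact: measurable_shifted_path.
  rewrite setIC; apply: (etrans (smf_strong_markov SM Dx st sB mA)).
  apply: eq_integral => w _; rewrite /path_expectation.
  rewrite -[Z in P _ Z]setIT -integral_indic//.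
  by apply: (generated_measurable mX); exact: generated_by_path.
- move=> c F c0 mF F0 IH; rewrite ge0_integralZl//; last exact: mC.
  rewrite IH -ge0_integralZl//; last first.
  + by move=> w _; exact: path_expectation_ge0.
  + exact: mK.
  apply: eq_integral => w _; rewrite /path_expectation ge0_integralZl//.
  exact: measurable_comp_path.
- move=> F G mF F0 mG G0 IHF IHG; rewrite ge0_integralD//; try exact: mC.
  rewrite IHF IHG -ge0_integralD//; try exact: mK.
  + apply: eq_integral => w _; rewrite /path_expectation ge0_integralD//;
    exact: measurable_comp_path.
  + by move=> w _; exact: path_expectation_ge0.
  + by move=> w _; exact: path_expectation_ge0.
- move=> F mF F0 ndF IH.
  rewrite (monotone_convergence _ mE (fun n => mC _ (mF n))); first last.
  + by move=> w _ n m nm; exact: ndF.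
  + by [].
  under eq_fun do rewrite IH.
  rewrite -monotone_convergence//.
  + apply: eq_integral => w _; rewrite /path_expectation monotone_convergence//.
    by move=> n; exact: measurable_comp_path.
  + by move=> n; exact: mK.
  + by move=> n w _; exact: path_expectation_ge0.
  + move=> w _ n m nm; apply: ge0_le_integral => //; try exact: measurable_comp_path.
    by move=> v _; exact: ndF.
Qed.

(* The functionals of interest are defined through uncountable infima and are
   measurable for the product sigma-algebra only on continuous paths. *)
Definition path_functional (F : (R -> R) -> \bar R) : Prop :=
  (forall u, 0 <= F u) /\ exists F' : path_space -> \bar R,
    [/\ measurable_fun setT F', forall u, 0 <= F' u
      & forall u, continuous_path u -> F u = F' u].

Lemma path_functional_measurable F : path_functional F ->
  measurable_fun setT (fun v => F (X ^~ v)).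
Proof.
move=> [F0 [F' [mF' F'0 FF']]].
rewrite (_ : (fun v => _) = fun v => F' (X ^~ v)); first exact: measurable_comp_path.
by apply/funext => v; rewrite FF'.
Qed.

Lemma path_functional_measurable_expectation F : path_functional F ->
  measurable_fun D (path_expectation F).
Proof.
move=> [F0 [F' [mF' F'0 FF']]].
rewrite (_ : path_expectation F = path_expectation F').
  exact: measurable_path_expectation.
by apply/funext => y; apply: eq_integral => v _; rewrite FF'.
Qed.

(** The weight [\1_B * edisc rho tau] is measurable for the stopped sigma-algebra, so
    [integral_weight] inserts it into the strong Markov property. It vanishes where [tau] is
    infinite, so the conventional value of [fine] at [+oo] is harmless. *)
Lemma strong_markov_discounted rho x tau B F :
  D x -> stopping_time X tau -> stopped_sigma_algebra X tau B ->
  path_functional F ->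
  \int[P x]_(w in B) ((edisc rho (tau w))%:E * F (fun t => X (fine (tau w) + t)%R w))
  = \int[P x]_(w in B)
      ((edisc rho (tau w))%:E * path_expectation F (X (fine (tau w)) w)).
Proof.
move=> Dx st sB [F0 [F' [mF' F'0 FF']]].
have mfin : measurable [set w | tau w < +oo].
  rewrite -[Z in measurable Z]setTI.
  by apply: emeasurable_fun_infty_o => //; exact: (stopping_time_measurable mX st).
have -> : path_expectation F = path_expectation F'.
  by apply/funext => y; apply: eq_integral => v _; rewrite FF'.
under eq_integral => w _.
  rewrite FF'; last first.
    apply: (@continuous_path_shift R (X ^~ w)) => //.
    by rewrite fine_ge0//; case: st.
  over.
have edisc0 w : ~ tau w < +oo -> edisc rho (tau w) = 0%R.
  by case: (tau w) => //= t; rewrite ltry.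
have red (Y : T -> \bar R) : \int[P x]_(w in B) ((edisc rho (tau w))%:E * Y w) =
    \int[P x]_(w in [set w | tau w < +oo]) ((\1_B w * edisc rho (tau w))%:E * Y w).
  rewrite (@integral_vanish _ _ _ _ [set w | tau w < +oo]); last first.
    by move=> w _ /edisc0 ->; rewrite mul0e.
  rewrite [RHS](@integral_vanish _ _ _ _ B); last first.
    by move=> w _ wB; rewrite indicE memNset// mul0r mul0e.
  rewrite setIC; apply: eq_integral => w; rewrite in_setI => /andP[_ wB].
  by rewrite indicE wB mul1r.
rewrite !red; apply: (integral_weight (S := stopped_sigma_algebra X tau)).
- exact: stopped_sa.
- by move=> A; exact: (stopped_measurable mX).
- exact: mfin.
- by apply: (measurableT_comp mF'); exact: measurable_shifted_path.
- exact: measurable_path_expectation_at.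
- by move=> w; exact: F'0.
- by move=> w; exact: path_expectation_ge0.
- by move=> A sA; exact: strong_markov_path.
- apply/measurable_EFinP; apply: measurable_funM.
    apply: (@measurable_indic _ (g_sigma_algebraType (stopped_sigma_algebra X tau))).
    by rewrite -(sigma_algebra_measurable (stopped_sa st)).
  apply: (measurableT_comp (measurable_edisc rho)).
  apply: (@measurable_fun_ereal_le _ _ (g_sigma_algebraType (stopped_sigma_algebra X tau))).
    by case: st.
  move=> t t0; rewrite -(sigma_algebra_measurable (stopped_sa st)).
  exact: (stopped_le_l st (stopping_time_cst t0)).
- by move=> w; rewrite lee_fin mulr_ge0// edisc_ge0.
Qed.

End strong_markov.

Arguments path_expectation {R d T} X P F y : rename.

Section discount_theory.
Context {R : realType} {rho : R}.

Lemma ediscD (s : R) (t : \bar R) :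
  edisc rho (s%:E + t)%E = edisc rho s%:E * edisc rho t.
Proof.
case: t => [t| |] /=; rewrite ?mulr0//.
by rewrite mulrDr opprD expRD.
Qed.

Lemma edisc0 : edisc rho 0%E = 1.
Proof. by rewrite /edisc /= mulr0 oppr0 expR0. Qed.

Hypothesis rho0 : 0 < rho.

Lemma edisc_anti (s t : \bar R) : (0 <= s)%E -> (s <= t)%E ->
  edisc rho t <= edisc rho s.
Proof.
move: s t => [s| |] [t| |] //=.
  rewrite !lee_fin => s0 st; rewrite ler_expR lerN2 ler_wpM2l//.
  exact: ltW.
Qed.

Lemma edisc_le1 (t : \bar R) : (0 <= t)%E -> edisc rho t <= 1.
Proof. by move=> t0; rewrite -edisc0; apply: edisc_anti. Qed.

End discount_theory.

(** * Passage times as measurable functions on the path space *)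

Section measurable_hitting.
Context {R : realType}.
Implicit Types (c u : R -> R) (t : R).

Let reached c t : set (R -> R) :=
  [set u | forall n : nat, exists q : rat, c (u (clamp q t)) < n.+1%:R^-1].

(** A substitute for [first_after c 0] that looks at countably many coordinates of the path, and is
    therefore measurable for the product sigma-algebra. The two agree on continuous paths, where
    [reached c t] means that the target is met by time [t]. *)
Definition first_rat c u : \bar R :=
  ereal_inf [set (ratr q)%:E | q in [set q : rat | 0 <= (ratr q : R) /\ reached c (ratr q) u]].

Lemma first_ratE c u : continuous c -> continuous_path u ->
  first_rat c u = first_after c 0%E u.
Proof.
move=> cc cu.
have reachedP t : 0 <= t -> reached c t u <-> (first_after c 0%E u <= t%:E)%E.
  move=> t0; split => [H|/(first_after_le_rat _ cc cu t0) H n].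
    apply/(first_after_le_rat _ cc cu t0) => n; have [q Hq] := H n.
    by exists q; split => //; rewrite lee_fin; have /andP[] := clamp_itv q t0.
  by have [q [_ Hq]] := H n; exists q.
apply/eqP; rewrite eq_le; apply/andP; split; last first.
  by apply: le_ereal_inf_tmp => _ [q [q0 /(reachedP _ q0) ?] <-].
have [->|[t [E t0 _ ct]]] := first_after_case 0%E cc cu; first exact: leey.
rewrite E; apply/lee_addgt0Pr => e e0.
have te : t < t + e by rewrite ltrDl.
have [q] := rat_in_itvoo te; rewrite in_itv/= => /andP[tq qe].
have q0 : 0 <= ratr q :> R by rewrite (le_trans t0)// ltW.
apply: (@le_trans _ _ (ratr q)%:E); last by rewrite -EFinD lee_fin ltW.
apply: ereal_inf_lbound; exists q => //; split => //.
by apply/reachedP => //; rewrite E lee_fin ltW.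
Qed.

Lemma measurable_evaluation t : 0 <= t ->
  measurable_fun setT ((fun u => u t) : @path_space R -> R).
Proof.
move=> t0 _ B mB; rewrite setTI; apply: sub_sigma_algebra.
by exists t => //; exists B.
Qed.

Lemma measurable_first_rat c : continuous c ->
  measurable_fun setT (first_rat c : @path_space R -> \bar R).
Proof.
move=> cc.
have mreached t : 0 <= t -> measurable (reached c t : set path_space).
  move=> t0; rewrite (_ : reached c t = \bigcap_n \bigcup_q
      ((fun u => u (clamp q t)) @^-1` (c @^-1` [set y | y < n.+1%:R^-1]))).
    apply: bigcapT_measurable => n; apply: bigcupT_measurable_rat => q.
    have /andP[c0 _] := clamp_itv q t0.
    rewrite -[X in measurable X]setTI; apply: (measurable_evaluation c0) => //.
    rewrite -[X in measurable X]setTI.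
    apply: (continuous_measurable_fun cc) => //.
    by rewrite -set_itvNyo; exact: measurable_itv.
  apply/seteqP; split => u /= H n; first by move=> _; have [q ?] := H n; exists q.
  by have [q _ ?] := H n I; exists q.
apply: measurable_fun_ereal_le.
  by move=> u; apply: le_ereal_inf_tmp => _ [q [q0 _] <-]; rewrite lee_fin.
move=> t t0; rewrite (_ : mkset _ = \bigcap_n \bigcup_q
  (if (0 <= (ratr q : R)) && (ratr q < t + n.+1%:R^-1) then reached c (ratr q) else set0)).
  apply: bigcapT_measurable => n; apply: bigcupT_measurable_rat => q.
  by case: ifPn => [/andP[q0 _]|_]; [exact: mreached|exact: measurable0].
apply/seteqP; split => u /=.
- move=> ut n _; have : (first_rat c u < (t + n.+1%:R^-1)%:E)%E.
    by rewrite (le_lt_trans ut)// lte_fin ltrDl invr_gt0.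
  move=> /ereal_inf_lt[_ [q [q0 rq] <-]]; rewrite lte_fin => qt.
  by exists q => //; rewrite q0 qt.
- move=> H; apply/lee_addgt0Pr => e e0.
  have [N _ HN] := near_infty_natSinv_lt (PosNum e0).
  have [q _] := H N I; case: ifPn => // /andP[q0 qt] rq.
  apply: (@le_trans _ _ (ratr q)%:E); first by apply: ereal_inf_lbound; exists q.
  rewrite -EFinD lee_fin (le_trans (ltW qt))// lerD2l ltW//.
  by have := HN N (leqnn _).
Qed.

End measurable_hitting.

Section functionals.
Context {R : realType} (rho : R).
Local Open Scope ereal_scope.
Implicit Types (u : R -> R) (p z : R).

Definition hit_functional z u : \bar R := (edisc rho (hit_after z 0%E u))%:E.

(** What waiting for [z] yields, per unit of gain at [z], in the process absorbed at [p]. It is of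
    interest mainly when [z] is the right end of the state space. *)
Definition reach_functional z p u : \bar R :=
  if hit_after z 0 u < hit_after p 0 u then hit_functional z u else 0.

(* One step of length [delta] of the process absorbed at [p]: reward [c] on
   absorption, [v] otherwise. *)
Definition step_functional p (c delta : R) (v : R -> \bar R) u : \bar R :=
  if hit_after p 0 u <= delta%:E then (c * edisc rho (hit_after p 0%E u))%:E
  else (edisc rho delta%:E)%:E * v (u delta).

Let mhit z : measurable_fun setT (first_rat (dist_to z) : @path_space R -> \bar R).
Proof. by apply: measurable_first_rat; exact: continuous_dist_to. Qed.

Let hitE z u : continuous_path u -> first_rat (dist_to z) u = hit_after z 0 u.
Proof. by move=> cu; rewrite first_ratE//; exact: continuous_dist_to. Qed.

Lemma path_functional_hit z : path_functional (hit_functional z).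
Proof.
split; first by move=> u; rewrite lee_fin edisc_ge0.
exists (fun u => (edisc rho (first_rat (dist_to z) u))%:E); split.
- by apply/measurable_EFinP; exact: (measurableT_comp (measurable_edisc rho)).
- by move=> u; rewrite lee_fin edisc_ge0.
- by move=> u cu; rewrite hitE.
Qed.

Lemma path_functional_reach z p : path_functional (reach_functional z p).
Proof.
split; first by move=> u; rewrite /reach_functional; case: ifPn; rewrite // lee_fin edisc_ge0.
exists (fun u => if first_rat (dist_to z) u < first_rat (dist_to p) u then
   (edisc rho (first_rat (dist_to z) u))%:E else 0); split.
- apply: measurable_fun_ifT => //.
    exact: (@measurable_fun_lte _ path_space).
  by apply/measurable_EFinP; exact: (measurableT_comp (measurable_edisc rho)).
- by move=> u; case: ifPn; rewrite // lee_fin edisc_ge0.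
- by move=> u cu; rewrite /reach_functional /hit_functional !hitE.
Qed.

Lemma path_functional_step p (c delta : R) (v : R -> \bar R) :
  (0 <= c)%R -> (0 <= delta)%R -> measurable_fun setT v -> (forall y, 0 <= v y) ->
  path_functional (step_functional p c delta v).
Proof.
move=> c0 d0 mv v0; split.
  move=> u; rewrite /step_functional; case: ifPn => _.
    by rewrite lee_fin mulr_ge0// edisc_ge0.
  by rewrite mule_ge0// lee_fin edisc_ge0.
exists (fun u => if first_rat (dist_to p) u <= delta%:E then
   (c * edisc rho (first_rat (dist_to p) u))%:E
  else (edisc rho delta%:E)%:E * v (u delta)); split.
- apply: measurable_fun_ifT.
  + exact: (@measurable_fun_lee _ path_space).
  + apply/measurable_EFinP; apply: measurable_funM => //.
    exact: (measurableT_comp (measurable_edisc rho)).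
  + apply: measurable_funeM; apply: (measurableT_comp mv).
    exact: measurable_evaluation.
- move=> u; case: ifPn => _; first by rewrite lee_fin mulr_ge0// edisc_ge0.
  by rewrite mule_ge0// lee_fin edisc_ge0.
- by move=> u cu; rewrite /step_functional hitE.
Qed.

End functionals.

Section pathwise_restart.
Context {R : realType} {rho : R}.
Implicit Types (u : R -> R) (s : \bar R) (p z : R).
Local Open Scope ereal_scope.

Lemma hit_after_infty z u : hit_after z +oo u = +oo.
Proof. by apply/eqP; rewrite eq_le leey/=; exact: first_after_ge. Qed.

(** With its two companions below, this identifies the discount at [s] times a functional of the
    shifted path, as in the strong Markov property, with a quantity of the unshifted path. At
    [s = +oo] both sides vanish. *)
Lemma hit_functional_restart z s u : continuous_path u -> 0 <= s ->
  (edisc rho s)%:E * hit_functional rho z (fun t => u (fine s + t)%R) =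
  (edisc rho (hit_after z s u))%:E.
Proof.
move=> cu; case: s => [s| |]//; last by rewrite hit_after_infty mul0e.
rewrite lee_fin => s0; rewrite first_after_shift//; last exact: continuous_dist_to.
by rewrite ediscD EFinM.
Qed.

Lemma reach_functional_restart z p s u : continuous_path u -> 0 <= s ->
  (edisc rho s)%:E * reach_functional rho z p (fun t => u (fine s + t)%R) =
  if hit_after z s u < hit_after p s u then (edisc rho (hit_after z s u))%:E else 0.
Proof.
move=> cu s0; rewrite -hit_functional_restart// /reach_functional.
case: s s0 => [s| |]// s0; last by rewrite !hit_after_infty ltxx mul0e.
rewrite !(@first_after_shift _ _ s)//; try exact: continuous_dist_to.
by rewrite lteD2lE//= ; case: ifPn; rewrite ?mule0.
Qed.

Lemma step_functional_restart p (c delta : R) (v : R -> \bar R) s u :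
  continuous_path u -> 0 <= s -> (0 <= delta)%R ->
  (edisc rho s)%:E * step_functional rho p c delta v (fun t => u (fine s + t)%R) =
  if hit_after p s u <= s + delta%:E then (c * edisc rho (hit_after p s u))%:E
  else (edisc rho (s + delta%:E))%:E * v (u (fine s + delta)%R).
Proof.
move=> cu s0 d0; rewrite /step_functional.
case: s s0 => [s| |]// s0; last by rewrite !hit_after_infty lexx mul0e mulr0.
rewrite !(@first_after_shift _ _ s)//; try exact: continuous_dist_to.
rewrite leeD2lE//; case: ifPn => _.
  by rewrite ediscD -EFinM mulrCA.
by rewrite ediscD EFinM muleA.
Qed.

End pathwise_restart.

(** * Inequalities between consecutive crossing times *)

Section phases.
Context {R : realType} {d : measure_display} {T : measurableType d}.
Context {D : set R} {X : R -> T -> R} {P : R -> probability T R} {rho : R}.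
Hypothesis mD : measurable D.
Hypothesis SM : strong_markov_family D X P.
Hypothesis rho0 : 0 < rho.
Local Open Scope ereal_scope.

Let mX := smf_measurable SM.
Let cX : forall w, continuous_path (X ^~ w) := fun w => smf_continuous SM (w := w).

Lemma hitting_timeE p w : hitting_time X p w = hit_after p 0 (X ^~ w).
Proof.
rewrite /hitting_time /first_after; congr ereal_inf; apply/seteqP; split.
- move=> _ [t [t0 Xt] <-]; exists t => //; split => //.
  by rewrite dist_to_le0 Xt.
- by move=> _ [t [t0 _ Xt] <-]; exists t => //; split => //; apply/eqP; rewrite -dist_to_le0.
Qed.

Lemma threshold_timeE p w : threshold_time X p w = first_after (deficit p) 0 (X ^~ w).
Proof.
rewrite /threshold_time /first_after; congr ereal_inf; apply/seteqP; split.
- move=> _ [t [t0 Xt] <-]; exists t => //; split => //.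
  by rewrite deficit_le0.
- by move=> _ [t [t0 _ Xt] <-]; exists t => //; split => //; rewrite -deficit_le0.
Qed.

Lemma payoffE f tau w :
  payoff X rho f tau w = (f (X (fine (tau w)) w) * edisc rho (tau w))%R.
Proof. by rewrite /payoff; case: (tau w) => //= *; rewrite mulr0. Qed.

Lemma measurable_edisc_at tau : stopping_time X tau ->
  measurable_fun setT (fun w => (edisc rho (tau w))%:E).
Proof.
move=> st; apply/measurable_EFinP; apply: (measurableT_comp (measurable_edisc rho)).
exact: (stopping_time_measurable mX st).
Qed.

Lemma measurable_payoff f tau : measurable_fun setT f -> stopping_time X tau ->
  measurable_fun setT (fun w => (payoff X rho f tau w)%:E).
Proof.
move=> mf st; under eq_fun do rewrite payoffE.
apply/measurable_EFinP; apply: measurable_funM.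
  by apply: (measurableT_comp mf); exact: (measurable_stopped_value SM).
by apply/measurable_EFinP; exact: measurable_edisc_at.
Qed.

Lemma payoff_ge0 f tau w : (forall y, (0 <= f y)%R) -> (0 <= payoff X rho f tau w)%R.
Proof. by move=> f0; rewrite payoffE mulr_ge0// edisc_ge0. Qed.

Lemma stopping_time_hit z sigma : stopping_time X sigma ->
  stopping_time X (fun w => hit_after z (sigma w) (X ^~ w)).
Proof. by apply: stopping_time_first_after => //; exact: continuous_dist_to. Qed.

Lemma measurable_functional_at F tau : path_functional F -> stopping_time X tau ->
  measurable_fun setT (fun w => path_expectation X P F (X (fine (tau w)) w)).
Proof.
move=> pF st.
apply: (measurable_comp mD _ (path_functional_measurable_expectation SM pF)).
  move=> _ [w _ <-]; apply: (smf_state SM).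
  by rewrite fine_ge0//; case: st.
exact: (measurable_stopped_value SM).
Qed.

Lemma strong_markov_hit x sigma B z : D x -> stopping_time X sigma ->
  stopped_sigma_algebra X sigma B ->
  \int[P x]_(w in B) (edisc rho (hit_after z (sigma w) (X ^~ w)))%:E =
  \int[P x]_(w in B) ((edisc rho (sigma w))%:E *
    path_expectation X P (hit_functional rho z) (X (fine (sigma w)) w)).
Proof.
move=> Dx st sB.
rewrite -(strong_markov_discounted mD SM rho Dx st sB (path_functional_hit rho z)).
apply: eq_integral => w _; rewrite (@hit_functional_restart _ _ _ _ (X ^~ w))//.
by case: st.
Qed.

Lemma strong_markov_reach x sigma B z p : D x -> stopping_time X sigma ->
  stopped_sigma_algebra X sigma B ->
  \int[P x]_(w in B) (if hit_after z (sigma w) (X ^~ w) < hit_after p (sigma w) (X ^~ w)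
     then (edisc rho (hit_after z (sigma w) (X ^~ w)))%:E else 0) =
  \int[P x]_(w in B) ((edisc rho (sigma w))%:E *
    path_expectation X P (reach_functional rho z p) (X (fine (sigma w)) w)).
Proof.
move=> Dx st sB.
rewrite -(strong_markov_discounted mD SM rho Dx st sB (path_functional_reach rho z p)).
apply: eq_integral => w _; rewrite (@reach_functional_restart _ _ _ _ _ (X ^~ w))//.
by case: st.
Qed.

Lemma strong_markov_step x sigma B p (c delta : R) v : D x -> stopping_time X sigma ->
  stopped_sigma_algebra X sigma B ->
  (0 <= c)%R -> (0 <= delta)%R -> measurable_fun setT v -> (forall y, 0 <= v y) ->
  \int[P x]_(w in B)
    (if hit_after p (sigma w) (X ^~ w) <= sigma w + delta%:E
     then (c * edisc rho (hit_after p (sigma w) (X ^~ w)))%:E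
     else (edisc rho (sigma w + delta%:E))%:E * v (X (fine (sigma w) + delta)%R w)) =
  \int[P x]_(w in B) ((edisc rho (sigma w))%:E *
    path_expectation X P (step_functional rho p c delta v) (X (fine (sigma w)) w)).
Proof.
move=> Dx st sB c0 d0 mv v0.
rewrite -(strong_markov_discounted mD SM rho Dx st sB
  (path_functional_step rho p c0 d0 mv v0)).
apply: eq_integral => w _.
rewrite (@step_functional_restart _ _ _ _ _ _ _ (X ^~ w))//.
by case: st.
Qed.

(* The two inequalities between consecutive crossing times have this shape:
   [c] bounds what is gained by stopping after [sigma], given that [c'] is
   what can still be gained from the next crossing time [sigma'] on. *)
Definition crossing_inequality x f (tau sigma sigma' : T -> \bar R) (c c' : R) :=
  \int[P x]_(w in [set w | sigma w <= tau w] `&` [set w | tau w < sigma' w])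
     (payoff X rho f tau w)%:E +
  c'%:E * \int[P x]_(w in [set w | sigma' w <= tau w]) (edisc rho (sigma' w))%:E
  <= c%:E * \int[P x]_(w in [set w | sigma w <= tau w]) (edisc rho (sigma w))%:E.

Lemma measurable_le_times sigma tau : stopping_time X sigma -> stopping_time X tau ->
  measurable [set w | sigma w <= tau w].
Proof. by move=> st tt; apply: (stopped_measurable mX (stopped_le_l st tt)). Qed.

Lemma measurable_lt_times sigma tau : stopping_time X sigma -> stopping_time X tau ->
  measurable [set w | tau w < sigma w].
Proof. by move=> st tt; apply: (stopped_measurable mX (stopped_lt_l st tt)). Qed.

(** Stopping before [sigma'] is no better than waiting for [z] and receiving [c'] there. By the
    strong Markov property at [tau], the payoff on [sigma <= tau < sigma'] is thus replaced by [c']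
    times the discount at [sigma']; the same property at [sigma], where the process is at [y],
    evaluates the total. *)
Lemma crossing_up x (f : R -> R) (tau sigma : T -> \bar R) (z c c' y : R) : D x ->
  measurable_fun setT f -> (forall y, (0 <= f y)%R) -> (0 <= c)%R -> (0 <= c')%R ->
  stopping_time X tau -> stopping_time X sigma ->
  {ae P x, forall w, sigma w <= tau w -> tau w < hit_after z (sigma w) (X ^~ w) ->
    (f (X (fine (tau w)) w))%:E <=
    c'%:E * path_expectation X P (hit_functional rho z) (X (fine (tau w)) w)} ->
  {ae P x, forall w, sigma w < +oo -> X (fine (sigma w)) w = y} ->
  c'%:E * path_expectation X P (hit_functional rho z) y = c%:E ->
  crossing_inequality x f tau sigma (fun w => hit_after z (sigma w) (X ^~ w)) c c'.
Proof.
move=> Dx mf f0 c0 c'0 tt st fle Xy cc'; rewrite /crossing_inequality.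
set sigma' := fun w => hit_after z (sigma w) (X ^~ w).
have st' : stopping_time X sigma' by exact: stopping_time_hit.
set B := _ `&` _.
have sB : stopped_sigma_algebra X tau B.
  apply: (sigma_algebraI (stopped_sa tt)); first exact: stopped_le_r.
  exact: stopped_lt_r.
have mB : measurable B by exact: (stopped_measurable mX sB).
have mC : measurable [set w | sigma' w <= tau w] by exact: measurable_le_times.
have mE s : stopping_time X s -> forall A, measurable_fun A (fun w => (edisc rho (s w))%:E).
  by move=> ss A; apply: measurable_funTS; exact: measurable_edisc_at.
have e0 s w : 0 <= (edisc rho s)%:E by move=> *; rewrite lee_fin edisc_ge0.
have pu : path_functional (hit_functional rho z) by exact: path_functional_hit.
set u := path_expectation X P (hit_functional rho z) in fle cc' *.
have u0 y' : 0 <= u y' by apply: path_expectation_ge0; case: pu.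
have step1 : \int[P x]_(w in B) (payoff X rho f tau w)%:E <=
    c'%:E * \int[P x]_(w in B) (edisc rho (sigma' w))%:E.
  (* On [B] the passage at [z] is still to come at time [tau], so [sigma'] is also the passage after
     [tau]. *)
  rewrite (_ : \int[P x]_(w in B) (edisc rho (sigma' w))%:E =
      \int[P x]_(w in B) (edisc rho (hit_after z (tau w) (X ^~ w)))%:E); last first.
    apply: eq_integral => w; rewrite inE => -[/= s1 s2]; congr (edisc _ _)%:E.
    apply: first_after_restart => //; first exact: continuous_dist_to.
    exact: ltW.
  rewrite (strong_markov_hit z Dx tt sB) -ge0_integralZl//; first last.
  - by move=> w _; rewrite mule_ge0// lee_fin edisc_ge0.
  - apply: emeasurable_funM; first exact: mE.
    by apply: measurable_funTS; exact: measurable_functional_at.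
  apply: ae_ge0_le_integral => //.
  - by move=> w _; rewrite lee_fin payoff_ge0.
  - by apply: measurable_funTS; exact: measurable_payoff.
  - by move=> w _; rewrite !mule_ge0// lee_fin edisc_ge0.
  - apply: measurable_funeM; apply: emeasurable_funM; first exact: mE.
    by apply: measurable_funTS; exact: measurable_functional_at.
  - apply: filterS fle => w H [/= s1 s2].
    rewrite payoffE EFinM muleC muleCA lee_wpmul2l ?lee_fin ?edisc_ge0//.
    exact: H.
apply: (le_trans (leeD2r _ step1)).
rewrite -ge0_muleDr; try by apply: integral_ge0 => w _; rewrite lee_fin edisc_ge0.
rewrite -ge0_integral_setU//; first last.
- apply/disj_setPS => w [[_ /= s1] /= s2].
  by have := lt_le_trans s1 s2; rewrite ltxx.
- by move=> w _; rewrite lee_fin edisc_ge0.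
- exact: mE.
(* The two parts add up to an event known at [sigma], which allows the second use of the strong
   Markov property. *)
rewrite (_ : B `|` _ = [set w | sigma w <= tau w]); last first.
  apply/seteqP; split => w /=.
    by move=> [[]//|]; apply: le_trans; exact: first_after_ge.
  by move=> s1; have [s2|s2] := leP (sigma' w) (tau w); [right|left].
rewrite (strong_markov_hit z Dx st (stopped_le_l st tt)).
rewrite -!ge0_integralZl//; try exact: measurable_le_times; first last.
- by move=> w _; rewrite mule_ge0// lee_fin edisc_ge0.
- apply: emeasurable_funM; first exact: mE.
  by apply: measurable_funTS; exact: measurable_functional_at.
- by move=> w _; rewrite lee_fin edisc_ge0.
- exact: mE.
apply: ae_ge0_le_integral.
- exact: measurable_le_times.
- by move=> w _; rewrite !mule_ge0// lee_fin edisc_ge0.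
- apply: measurable_funeM; apply: emeasurable_funM; first exact: mE.
  by apply: measurable_funTS; exact: measurable_functional_at.
- by move=> w _; rewrite mule_ge0// lee_fin edisc_ge0.
- by apply: measurable_funeM; exact: mE.
- apply: filterS Xy => w H _.
  rewrite muleCA muleC; case E : (sigma w) => [s| |] /=.
  + by rewrite -[s]/(fine s%:E) -E H ?E ?ltry// cc'.
  + by rewrite !mule0.
  + by rewrite !mule0.
Qed.

End phases.

(** * Limits of discounts and reverse Fatou *)

Section limits.
Context {R : realType}.

Lemma limn_einf_ge (u : nat -> \bar R) (v : R) :
  (forall e : R, 0 < e -> exists N : nat, forall n, (N <= n)%N -> ((v - e)%:E <= u n)%E) ->
  (v%:E <= limn_einf u)%E.
Proof.
move=> H; apply/lee_addgt0Pr => e e0; have [N HN] := H e e0.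
rewrite -leeBlDr// -EFinB.
rewrite limn_einf_lim (cvg_lim _ (@cvg_einfs_sup _ u))//.
apply: (@le_trans _ _ (einfs u N)); last by apply: ereal_sup_ubound; exists N.
by apply: le_ereal_inf_tmp => _ [n /= Nn <-]; exact: HN.
Qed.

Lemma continuous_path_lim u (t_ : nat -> R) (t : R) : continuous_path u ->
  (forall n, 0 <= t_ n) -> t_ n @[n --> \oo] --> t ->
  u (t_ n) @[n --> \oo] --> u t.
Proof.
move=> cu t0 tt.
have t'0 : 0 <= t.
  by apply: (cvgr_to_ge tt); apply: nearW.
apply/cvgrPdist_lt => e e0.
have [delta d0 H] := continuous_pathP cu t'0 e0.
move/cvgrPdist_lt : tt => /(_ _ d0); apply: filterS => n.
by rewrite distrC => /(H _ (t0 n)); rewrite distrC.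
Qed.

Variable rho : R.
Hypothesis rho0 : 0 < rho.

(* Upper semicontinuity of the discount along a nondecreasing sequence of
   times; there is nothing to check when the times escape to infinity. *)
Lemma edisc_limsup (S : nat -> \bar R) (e : R) :
  (forall n, (0 <= S n)%E) ->
  (forall n m, (n <= m)%N -> (S n <= S m)%E) -> 0 <= e ->
  (forall (s_ : nat -> R) (s : R), (forall n, S n = (s_ n)%:E) ->
     s_ n @[n --> \oo] --> s -> edisc rho s%:E <= e) ->
  forall eps : R, 0 < eps ->
    exists N : nat, forall n, (N <= n)%N -> edisc rho (S n) <= e + eps.
Proof.
move=> S0 Smono e0 He eps eps0; apply: contrapT => /forallNP noN.
have Sgt N : e + eps < edisc rho (S N).
  rewrite ltNge; apply/negP => le; apply: (noN N) => n Nn.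
  by apply: le_trans le; apply: edisc_anti => //; exact: Smono.
pose s_ n := fine (S n).
have SE n : S n = (s_ n)%:E.
  rewrite /s_; have := Sgt n; have : 0 < e + eps by rewrite ltr_wpDl.
  by case: (S n) => //= h h'; have := lt_trans h h'; rewrite ltxx.
have s_nd : nondecreasing_seq s_.
  by move=> n m nm; rewrite -lee_fin -!SE Smono.
(* As [e >= 0], the discounts stay above [eps], which bounds the times and excludes an escape to
   infinity. *)
have s_ub n : s_ n <= - (ln eps / rho).
  have := Sgt n; rewrite SE /= => lt.
  have lt' : eps < expR (- (rho * s_ n)) by lra.
  have : ln eps < - (rho * s_ n) by rewrite -ltr_expR lnK.
  move=> h; rewrite lerNr ler_pdivrMr// mulNr [s_ n * _]mulrC.
  exact: ltW.
have cs : cvgn s_.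
  apply: nondecreasing_is_cvgn => //; exists (- (ln eps / rho)) => _ [n _ <-].
  exact: s_ub.
have es := He s_ _ SE cs.
have : e + eps <= edisc rho (limn s_)%:E.
  have c1 : edisc rho (s_ n)%:E @[n --> \oo] --> edisc rho (limn s_)%:E.
    have c2 : - (rho * s_ n) @[n --> \oo] --> - (rho * limn s_).
      by apply: cvgN; apply: cvgMl_tmp.
    rewrite /edisc; apply: continuous_cvg c2.
    exact: continuous_expR.
  by apply: (cvgr_to_ge c1); apply: nearW => n; rewrite -SE ltW.
by lra.
Qed.
End limits.

Section limits_probability.
Context {R : realType} {d : measure_display} {T : measurableType d}.
Variable mu : probability T R.
Local Open Scope ereal_scope.

(** Reverse Fatou, from Fatou's lemma applied to [1 - e_ n]; the constant 1 is an integrable bound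
    since [mu] is a probability. *)
Lemma integral_limsup (e_ : nat -> T -> R) (e : T -> R) (a : R) :
  (forall n, measurable_fun setT (e_ n)) -> measurable_fun setT e ->
  (forall n w, (0 <= e_ n w <= 1)%R) -> (forall w, (0 <= e w <= 1)%R) ->
  {ae mu, forall w, forall eps : R, (0 < eps)%R ->
    exists N : nat, forall n, (N <= n)%N -> (e_ n w <= e w + eps)%R} ->
  (forall n, a%:E <= \int[mu]_w (e_ n w)%:E) -> a%:E <= \int[mu]_w (e w)%:E.
Proof.
move=> me_ me e_01 e01 lim ale.
have compl (h : T -> R) : measurable_fun setT h -> (forall w, (0 <= h w <= 1)%R) ->
    \int[mu]_w (1 - h w)%:E + \int[mu]_w (h w)%:E = 1.
  move=> mh h01; rewrite -ge0_integralD//.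
  - under eq_integral do rewrite -EFinD subrK.
    by rewrite integral_cst//; rewrite [X in 1 * X]probability_setT mule1.
  - by move=> w _; rewrite lee_fin subr_ge0; have /andP[] := h01 w.
  - by apply/measurable_EFinP; exact: measurable_funB.
  - by move=> w _; rewrite lee_fin; have /andP[] := h01 w.
  - exact/measurable_EFinP.
have fin (h : T -> R) : measurable_fun setT h -> (forall w, (0 <= h w <= 1)%R) ->
    exists2 x, \int[mu]_w (h w)%:E = x%:E & \int[mu]_w (1 - h w)%:E = (1 - x)%:E.
  move=> mh h01; have := compl h mh h01.
  have : 0 <= \int[mu]_w (h w)%:E.
    by apply: integral_ge0 => w _; rewrite lee_fin; have /andP[] := h01 w.
  have : 0 <= \int[mu]_w (1 - h w)%:E.
    by apply: integral_ge0 => w _; rewrite lee_fin subr_ge0; have /andP[] := h01 w.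
  case: (\int[mu]_w (h w)%:E) => [x| |]; case: (\int[mu]_w (1 - h w)%:E) => [y| |] //.
  by move=> _ _ [<-]; exists x => //; rewrite addrK.
have mc (h : T -> R) : measurable_fun setT h ->
    measurable_fun setT (fun w => (1 - h w)%:E).
  by move=> mh; apply/measurable_EFinP; exact: measurable_funB.
have fatou1 := fatou mu measurableT (fun n => mc _ (me_ n)).
have [x Ex E1x] := fin e me e01.
have : \int[mu]_w (1 - e w)%:E <= (1 - a)%:E.
  apply: (@le_trans _ _ (\int[mu]_w limn_einf (fun n => (1 - e_ n w)%:E))).
    apply: ae_ge0_le_integral => //.
    - by move=> w _; rewrite lee_fin subr_ge0; have /andP[] := e01 w.
    - exact: mc.
    - move=> w _; apply: (limn_einf_ge (v := 0%R)) => eps eps0; exists 0%N => n _.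
      by rewrite lee_fin sub0r; have /andP[_] := e_01 n w; lra.
    - under eq_fun do rewrite limn_einf_lim.
      apply: (emeasurable_fun_cvg (fun n w => einfs (fun n => (1 - e_ n w)%:E) n)).
        by move=> n; apply: measurable_fun_einfs => m; exact: mc.
      by move=> w _; exact: is_cvg_einfs.
    - apply: filterS lim => w lim _; apply: limn_einf_ge => eps eps0.
      have [N HN] := lim _ eps0; exists N => n /HN.
      by rewrite lee_fin; lra.
  apply: (le_trans (fatou1 _)).
    by move=> n w _; rewrite lee_fin subr_ge0; have /andP[] := e_01 n w.
  rewrite limn_einf_lim (cvg_lim _ (@cvg_einfs_sup _ _))//.
  apply: ge_ereal_sup => _ [n _ <-]; apply: (@le_trans _ _ (\int[mu]_w (1 - e_ n w)%:E)).
    by apply: ereal_inf_lbound; exists n => /=.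
  have [y Ey ->] := fin _ (me_ n) (e_01 n).
  by have := ale n; rewrite Ey !lee_fin; lra.
by rewrite E1x Ex !lee_fin; lra.
Qed.

End limits_probability.

(** * Limits at the ends of the state space *)

Section endpoints.
Context {R : realType} {d : measure_display} {T : measurableType d}.
Context {D : set R} {X : R -> T -> R} {P : R -> probability T R} {rho : R}.
Hypothesis mD : measurable D.
Hypothesis SM : strong_markov_family D X P.
Hypothesis rho0 : 0 < rho.
Local Open Scope ereal_scope.

Let mX := smf_measurable SM.
Let cX : forall w, continuous_path (X ^~ w) := fun w => smf_continuous SM (w := w).

Lemma ae_start x : D x -> {ae P x, forall w, X 0%R w = x}.
Proof.
move=> Dx; have mA : measurable [set w | X 0%R w = x].
  rewrite -[Z in measurable Z]setTI.
  exact: (mX (lexx 0%R) measurableT (measurable_set1 x)).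
exists (~` [set w | X 0%R w = x]); split => //.
- exact: measurableC.
- rewrite (@probability_setC _ _ _ (P x))// (smf_start SM Dx).
  by rewrite subee.
Qed.

Lemma ae_edisc (mu : probability T R) (S : T -> \bar R) :
  measurable_fun setT (fun w => (edisc rho (S w))%:E) ->
  (forall w, 0 <= S w) ->
  \int[mu]_w (edisc rho (S w))%:E = 0 -> {ae mu, forall w, S w = +oo}.
Proof.
move=> mS S0 I0.
have : ae_eq mu setT (fun w => (edisc rho (S w))%:E) (cst 0).
  apply/(ae_eq_integral_abs mu measurableT mS).
  rewrite -[RHS]I0; apply: eq_integral => w _.
  by rewrite gee0_abs// lee_fin edisc_ge0.
apply: filterS => w /(_ I); have := S0 w; case: (S w) => //= t _ [] /eqP.
by rewrite gt_eqF// expR_gt0.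
Qed.

Lemma hit_after_between (u : R -> R) (y y' : R) : continuous_path u ->
  (Num.min (u 0) y' <= y <= Num.max (u 0) y')%R ->
  hit_after y 0 u <= hit_after y' 0 u.
Proof.
move=> cu yy'.
have [->|[t [-> t0 _]]] := first_after_case 0 (@continuous_dist_to _ y') cu.
  exact: leey.
by rewrite dist_to_le0 => /eqP ut; apply: hit_after_ivt => //; rewrite ut.
Qed.

Lemma stopping_time0 : stopping_time X (fun=> 0).
Proof. exact: stopping_time_cst. Qed.

Lemma hit_after_at (u : R -> R) s z : continuous_path u ->
  hit_after z s u < +oo -> u (fine (hit_after z s u)) = z.
Proof.
move=> cu; have [->//|[t [-> t0 _]]] := first_after_case s (@continuous_dist_to _ z) cu.
by rewrite dist_to_le0 => /eqP.
Qed.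

Lemma edisc_integral_fin (mu : probability T R) (S : T -> \bar R) :
  measurable_fun setT (fun w => (edisc rho (S w))%:E) -> (forall w, 0 <= S w) ->
  exists2 E : R, (0 <= E)%R & \int[mu]_w (edisc rho (S w))%:E = E%:E.
Proof.
move=> mS S0.
have : \int[mu]_w (edisc rho (S w))%:E <= 1.
  apply: (@le_trans _ _ (\int[mu]_w (cst 1 w))).
    apply: ge0_le_integral => //.
    - by move=> w _; rewrite lee_fin edisc_ge0.
    - by move=> w _; rewrite lee_fin edisc_le1.
  by rewrite integral_cst//; rewrite [X in 1 * X]probability_setT mule1.
have : 0 <= \int[mu]_w (edisc rho (S w))%:E.
  by apply: integral_ge0 => w _; rewrite lee_fin edisc_ge0.
by case: (\int[mu]_w _) => // E E0 _; exists E.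
Qed.

(* If the point [b] is reached from [x0], then what holds for starting points
   approaching [b] passes to the limit, even though the process may behave in
   an arbitrary way at [b]. *)
Lemma hit_expectation_limit x0 (b z K c : R) (y_ : nat -> R) :
  D x0 -> (0 <= K)%R -> (0 <= c)%R ->
  (forall n, b <= y_ n <= x0)%R -> (forall n m, (n <= m)%N -> (y_ m <= y_ n)%R) ->
  y_ n @[n --> \oo] --> b ->
  (forall n, K%:E <= c%:E * path_expectation X P (hit_functional rho z) (y_ n)) ->
  0 < P x0 [set w | hit_after b 0 (X ^~ w) < +oo] ->
  K%:E <= c%:E * path_expectation X P (hit_functional rho z) b.
Proof.
move=> Dx0 K0 c0 y_b y_mono y_cvg Ky Pb.
set u := path_expectation X P (hit_functional rho z).
have pu : path_functional (hit_functional rho z) by exact: path_functional_hit.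
have u0 y : 0 <= u y by apply: path_expectation_ge0; case: pu.
have [cE|cneq0] := eqVneq c 0%R.
  by apply: (le_trans (Ky 0%N)); rewrite cE !mul0e.
have {}c0 : (0 < c)%R by rewrite lt_neqAle eq_sym cneq0.
pose Tb w := hit_after b 0 (X ^~ w).
pose Ty n w := hit_after (y_ n) 0 (X ^~ w).
have sTb : stopping_time X Tb by apply: (stopping_time_hit SM); exact: stopping_time0.
have sTy n : stopping_time X (Ty n) by apply: (stopping_time_hit SM); exact: stopping_time0.
have sT S : stopping_time X S -> stopped_sigma_algebra X S setT.
  by move=> sS; exact: (sigma_algebraT (stopped_sa sS)).
have mE S : stopping_time X S -> measurable_fun setT (fun w => (edisc rho (S w))%:E).
  exact: (measurable_edisc_at SM).
have markov y S : stopping_time X S -> (forall w, S w < +oo -> X (fine (S w)) w = y) ->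
    \int[P x0]_w (edisc rho (hit_after z (S w) (X ^~ w)))%:E =
    u y * \int[P x0]_w (edisc rho (S w))%:E.
  move=> sS SX; rewrite (strong_markov_hit mD SM z Dx0 sS (sT _ sS)).
  rewrite -ge0_integralZl//; last 2 first.
  - exact: mE.
  - by move=> w _; rewrite lee_fin edisc_ge0.
  apply: eq_integral => w _; rewrite muleC -/u.
  case E : (S w) => [s| |]; last 2 first.
  - by rewrite !mule0.
  - by rewrite !mule0.
  by rewrite -E SX// E ltry.
have [E E0 EE] := edisc_integral_fin (P x0) (mE _ sTb) (fun w => sTb.1 w).
(* This is where [b] being reached with positive probability enters; [E] is cancelled at the end. *)
have Egt0 : (0 < E)%R.
  rewrite lt_neqAle E0 andbT; apply/eqP => E00.
  have := ae_edisc (mu := P x0) (mE _ sTb) (fun w => sTb.1 w).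
  rewrite EE -E00 => /(_ erefl)[N [mN N0 sub]].
  suff : P x0 [set w | Tb w < +oo] <= 0 by rewrite leNgt Pb.
  rewrite -N0; apply: le_measure; rewrite ?inE//.
    rewrite -[Z in measurable Z]setTI.
    apply: emeasurable_fun_infty_o => //; exact: (stopping_time_measurable mX sTb).
  by move=> w /= lt; apply: sub => /= eq; rewrite eq in lt.
(* Restarting at the passage at [y_ n], the expected discount factors as [u (y_ n) * F]. The
   hypothesis bounds [u (y_ n)] below, and [E <= F] because the path meets [y_ n] on its way from
   [x0] to [b]. *)
have bnd n : (K * E / c)%:E <=
    \int[P x0]_w (edisc rho (hit_after z (Ty n w) (X ^~ w)))%:E.
  rewrite (markov (y_ n) (Ty n)) //; last by move=> w; exact: hit_after_at.
  have [F F0 FE] := edisc_integral_fin (P x0) (mE _ (sTy n)) (fun w => (sTy n).1 w).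
  have EF : (E <= F)%R.
    rewrite -lee_fin -EE -FE; apply: ae_ge0_le_integral => //.
    - by move=> w _; rewrite lee_fin edisc_ge0.
    - exact: mE.
    - by move=> w _; rewrite lee_fin edisc_ge0.
    - exact: mE.
    - apply: filterS (ae_start Dx0) => w Xw _; rewrite lee_fin.
      apply: edisc_anti => //; first exact: (sTy n).1.
      apply: hit_after_between => //.
      by rewrite Xw ge_min le_max; have /andP[-> ->] := y_b n; rewrite !orbT.
  rewrite FE; have := Ky n; rewrite -/u; have := u0 (y_ n).
  case: (u (y_ n)) => [v v0| _ _|] //.
    rewrite -!EFinM !lee_fin ler_pdivrMr// => h.
    rewrite lee_fin in v0; rewrite [(v * F * c)%R](_ : _ = (c * v * F)%R); last by ring.
    by rewrite ler_pM.
  by rewrite gt0_mulye ?lte_fin ?(lt_le_trans Egt0)// leey.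
have lim : (K * E / c)%:E <=
    \int[P x0]_w (edisc rho (hit_after z (Tb w) (X ^~ w)))%:E.
  apply: (integral_limsup (e_ := fun n w => edisc rho (hit_after z (Ty n w) (X ^~ w)))) => //.
  - move=> n; apply/measurable_EFinP; apply: mE; exact: (stopping_time_hit SM).
  - by apply/measurable_EFinP; apply: mE; exact: (stopping_time_hit SM).
  - by move=> n w; rewrite edisc_ge0 edisc_le1// first_after_ge0.
  - by move=> w; rewrite edisc_ge0 edisc_le1// first_after_ge0.
  apply: filterS (ae_start Dx0) => w Xw.
  apply: edisc_limsup => //.
  - by move=> n; exact: first_after_ge0.
  - move=> n m nm; apply: first_after_mono; apply: hit_after_between => //.
    by rewrite Xw ge_min le_max y_mono// orbT; have /andP[_ ->] := y_b n.
  - exact: edisc_ge0.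
  move=> s_ s Ss s_s.
  have s_fin n : X (s_ n) w = z /\ (0 <= s_ n)%R.
    have [t0 _] := first_after_attained (@continuous_dist_to _ z) (@cX w) (Ss n).
    by rewrite dist_to_le0 => /eqP.
  pose t_ n := fine (Ty n w).
  have Tt n : Ty n w = (t_ n)%:E.
    have : Ty n w <= (s_ n)%:E by rewrite -Ss first_after_ge.
    rewrite /t_; have := (sTy n).1 w; by case: (Ty n w).
  have t_s n : (t_ n <= s_ n)%R by rewrite -lee_fin -Tt -Ss first_after_ge.
  have t_0 n : (0 <= t_ n)%R by rewrite -lee_fin -Tt (sTy n).1.
  have t_nd : nondecreasing_seq t_.
    move=> n m nm; rewrite -lee_fin -!Tt; apply: hit_after_between => //.
    by rewrite Xw ge_min le_max y_mono// orbT; have /andP[_ ->] := y_b n.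
  have s_nd n m : (n <= m)%N -> (s_ n <= s_ m)%R.
    by move=> nm; rewrite -lee_fin -!Ss; apply: first_after_mono; rewrite !Tt lee_fin t_nd.
  have s_le n : (s_ n <= s)%R.
    apply: (cvgr_to_ge s_s); exists n => // m /= nm; exact: s_nd.
  have ct : cvgn t_.
    apply: nondecreasing_is_cvgn => //; exists s => _ [n _ <-].
    exact: le_trans (s_le n).
  have lim_s : (limn t_ <= s)%R.
    by apply: (cvgr_to_le ct); apply: nearW => n; exact: le_trans (s_le n).
  have lim_0 : (0 <= limn t_)%R by apply: (cvgr_to_ge ct); exact: nearW.
  (* The passages at [y_ n] increase to a time at which the path sits at [b]. Hence the limit [s] of
     the subsequent visits to [z] comes after the passage at [b]. *)
  have Xlim : X (limn t_) w = b.
    have c1 := continuous_path_lim (@cX w) t_0 ct.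
    apply: (cvg_unique _ c1) => //.
    rewrite (_ : (fun n => _) = y_)//; apply/funext => n.
    have := @hit_after_at (X ^~ w) 0 (y_ n) (@cX w).
    by rewrite -/(Ty n w) Tt ltry => /(_ isT).
  have Xs : X s w = z.
    have c1 := continuous_path_lim (@cX w) (fun n => (s_fin n).2) s_s.
    apply: (cvg_unique _ c1) => //.
    rewrite (_ : (fun n => _) = cst z); first exact: cvg_cst.
    by apply/funext => n; have [] := s_fin n.
  apply: edisc_anti => //; first exact: first_after_ge0.
  apply: first_after_le; rewrite ?dist_to_le0 ?Xs//.
    exact: le_trans lim_s.
  apply: (@le_trans _ _ (limn t_)%:E); last by rewrite lee_fin.
  by apply: first_after_le; rewrite ?dist_to_le0 ?Xlim.
move: lim; rewrite (markov b Tb)//; last by move=> w; exact: hit_after_at.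
rewrite EE -/u; case: (u b) (u0 b) => [v v0| _ _|] //.
  rewrite -!EFinM !lee_fin ler_pdivrMr// => h.
  by rewrite -(ler_pM2r Egt0); lra.
by rewrite gt0_muley ?lte_fin// leey.
Qed.

End endpoints.

(** * Lower semicontinuity at the right end *)

Section right_endpoint.
Context {R : realType} {d : measure_display} {T : measurableType d}.
Context {D : set R} {X : R -> T -> R} {P : R -> probability T R} {rho : R}.
Hypothesis mD : measurable D.
Hypothesis SM : strong_markov_family D X P.
Hypothesis rho0 : 0 < rho.
Local Open Scope ereal_scope.

Let mX := smf_measurable SM.
Let cX : forall w, continuous_path (X ^~ w) := fun w => smf_continuous SM (w := w).

(** Writing [reach_functional] as the discount of a time, infinite when [p] comes first, makes
    [edisc_limsup] applicable to it. *)
Definition reach_time z p (u : R -> R) : \bar R :=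
  if hit_after z 0 u < hit_after p 0 u then hit_after z 0 u else +oo.

Lemma reach_functionalE z p u :
  reach_functional rho z p u = (edisc rho (reach_time z p u))%:E.
Proof. by rewrite /reach_functional /reach_time; case: ifPn. Qed.

Lemma reach_time_ge0 z p u : 0 <= reach_time z p u.
Proof. by rewrite /reach_time; case: ifPn => // _; exact: first_after_ge0. Qed.

Lemma measurable_reach z p :
  measurable_fun setT (fun w => (edisc rho (reach_time z p (X ^~ w)))%:E).
Proof.
under eq_fun do rewrite -reach_functionalE.
by apply: (path_functional_measurable SM); exact: path_functional_reach.
Qed.

Lemma reach_timeS (u : R -> R) (p q y y' : R) : continuous_path u ->
  u 0%R = q -> (q <= y <= y')%R -> reach_time y p u <= reach_time y' p u.
Proof.
move=> cu u0 /andP[qy yy']; rewrite /reach_time.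
have le : hit_after y 0 u <= hit_after y' 0 u.
  by apply: hit_after_between => //; rewrite u0 ge_min le_max qy yy' orbT.
case: ifPn => [_|]; case: ifPn => [lt'|_]; rewrite ?leey//.
by rewrite (le_lt_trans le lt').
Qed.

(** A continuous path from [q] meets [y] before [z]. If [p] comes before [y], both discounts vanish;
    otherwise the search for [z] and for [p] restarts at [y]. *)
Lemma strong_markov_reach_at q y z p : D q -> (q <= y <= z)%R ->
  \int[P q]_w (edisc rho (reach_time z p (X ^~ w)))%:E =
  path_expectation X P (reach_functional rho z p) y *
  \int[P q]_w (edisc rho (reach_time y p (X ^~ w)))%:E.
Proof.
move=> Dq /andP[qy yz].
pose Ty w := hit_after y 0 (X ^~ w); pose Tp w := hit_after p 0 (X ^~ w).
have sTy : stopping_time X Ty by apply: (stopping_time_hit SM); exact: stopping_time0.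
have sTp : stopping_time X Tp by apply: (stopping_time_hit SM); exact: stopping_time0.
pose B := [set w | Ty w < Tp w].
have sB : stopped_sigma_algebra X Ty B by exact: stopped_lt_r.
have mB : measurable B by exact: (stopped_measurable mX sB).
have pr := path_functional_reach rho z p.
have := strong_markov_reach (rho := rho) mD SM z p Dq sTy sB.
rewrite (_ : \int[P q]_(w in B) _ = \int[P q]_w (edisc rho (reach_time z p (X ^~ w)))%:E).
  move=> ->.
  rewrite [X in _ = _ * X](@integral_vanish _ _ _ _ B); last first.
    by move=> w _ wB; rewrite /reach_time ifF//; apply/negP.
  rewrite setTI -ge0_integralZl//; last 3 first.
  - exact: (measurable_funTS (measurable_reach _ _)).
  - by move=> w _; rewrite lee_fin edisc_ge0.
  - by apply: path_expectation_ge0; case: pr.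
  apply: eq_integral => w; rewrite inE => wB.
  rewrite muleC /reach_time [in RHS]ifT//; congr (path_expectation _ _ _ _ * _).
  exact: (@hit_after_at _ (X ^~ w) 0 y (@cX w) (lt_le_trans wB (leey _))).
have mL : measurable_fun setT (fun w => if hit_after z (Ty w) (X ^~ w) <
     hit_after p (Ty w) (X ^~ w)
     then (edisc rho (hit_after z (Ty w) (X ^~ w)))%:E else 0).
  have st' v : stopping_time X (fun w => hit_after v (Ty w) (X ^~ w)).
    exact: (stopping_time_hit SM).
  apply: measurable_fun_ifT => //.
    apply: (@measurable_fun_lte _ T R setT); exact: (stopping_time_measurable mX (st' _)).
  exact: (measurable_edisc_at SM (st' z)).
rewrite [RHS](_ : _ = \int[P q]_(w in B) (edisc rho (reach_time z p (X ^~ w)))%:E).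
  apply: ge0_ae_eq_integral => //.
  - exact: measurable_funTS.
  - exact: (measurable_funTS (measurable_reach _ _)).
  - by move=> w _; case: ifPn; rewrite // lee_fin edisc_ge0.
  - by move=> w _; rewrite lee_fin edisc_ge0.
  apply: filterS (ae_start SM Dq) => w Xw wB.
  have Ez : hit_after z (Ty w) (X ^~ w) = hit_after z 0 (X ^~ w).
    apply/esym/first_after_restart => //; try exact: continuous_dist_to.
      exact: first_after_ge0.
    by apply: hit_after_between => //; rewrite Xw ge_min le_max qy yz orbT.
  have Ep : hit_after p (Ty w) (X ^~ w) = hit_after p 0 (X ^~ w).
    apply/esym/first_after_restart => //; try exact: continuous_dist_to.
      exact: first_after_ge0.
    exact: ltW.
  by rewrite /reach_time Ez Ep; case: ifPn.
have mS v : measurable_fun setT (fun w => (edisc rho (reach_time v p (X ^~ w)))%:E).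
  exact: measurable_reach.
rewrite [RHS]integral_mkcond; apply: ge0_ae_eq_integral => //.
- by apply/(measurable_restrictT _ mB); exact: measurable_funTS.
- by move=> w _; rewrite lee_fin edisc_ge0.
- by move=> w _; rewrite /patch; case: ifPn; rewrite // lee_fin edisc_ge0.
apply: filterS (ae_start SM Dq) => w Xw _; rewrite /patch; case: ifPn => //.
rewrite notin_setE => wB; suff -> : reach_time z p (X ^~ w) = +oo by [].
rewrite /reach_time ifF//; apply/negP => lt; apply: wB; apply: le_lt_trans lt.
by apply: hit_after_between => //; rewrite Xw ge_min le_max qy yz orbT.
Qed.

(** Write [E] for the expected discount of reaching [z] from [q] before [p]. Were [f y < c] at
    points [y] arbitrarily close to [z], the factorization of [E] at [y] and the bound on [f y]
    would give an expected discount of reaching [y] of at least [f z * E / c]. As [y] tends to [z],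
    the limsup of these discounts is at most [E], which contradicts [c < f z]. *)
Lemma reach_expectation_limit q z p (f : R -> R) (c : R) :
  D q -> (q < z)%R -> p != z -> (0 <= c)%R -> (0 <= f z)%R ->
  (forall y, (q < y < z)%R ->
    (f z)%:E * path_expectation X P (reach_functional rho z p) y <= (f y)%:E) ->
  path_expectation X P (reach_functional rho z p) q != 0 ->
  (c < f z)%R ->
  exists2 eta : R, (0 < eta)%R & forall y, (z - eta < y < z)%R -> (c <= f y)%R.
Proof.
move=> Dq qz pz c0 fz0 fy Eneq0 cfz; apply: contrapT => noeta.
pose x_ n := (z - (z - q) / n.+2%:R)%R.
have zq0 : (0 < z - q)%R by rewrite subr_gt0.
have x_z n : (x_ n < z)%R by rewrite /x_ ltrBlDr ltrDl divr_gt0.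
have q_x n : (q < x_ n)%R.
  rewrite /x_ ltrBrDl -ltrBrDr ltr_pdivrMr// ltr_pMr//.
  by rewrite ltr1n.
have x_mono n m : (n <= m)%N -> (x_ n <= x_ m)%R.
  move=> nm; rewrite /x_ lerD2l lerN2 ler_pM2l// lef_pV2 ?posrE//.
  by rewrite ler_nat !ltnS.
have x_cvg : x_ n @[n --> \oo] --> z.
  rewrite -[X in _ --> X]subr0; apply: cvgB; first exact: cvg_cst.
  rewrite -[X in _ --> X](mulr0 (z - q)%R); apply: cvgMl_tmp.
  by have := @cvg_harmonic R; rewrite -(cvg_shiftS (@harmonic R : nat -> R^o)).
have pick n : exists y, (x_ n < y < z)%R /\ (f y < c)%R.
  apply: contrapT => /forallNP no; apply: noeta; exists (z - x_ n)%R.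
    by rewrite subr_gt0.
  move=> y; rewrite opprB addrC subrK => yz; rewrite leNgt; apply/negP => fyc.
  by apply: (no y).
have EE y : path_expectation X P (reach_functional rho z p) y =
    \int[P y]_w (edisc rho (reach_time z p (X ^~ w)))%:E.
  by apply: eq_integral => w _; rewrite reach_functionalE.
have [E E0 Eint] := edisc_integral_fin rho0 (P q) (measurable_reach z p)
  (fun w => reach_time_ge0 z p (X ^~ w)).
have Egt0 : (0 < E)%R.
  by rewrite lt_neqAle E0 andbT eq_sym; move: Eneq0; rewrite EE Eint.
have cgt0 : (0 < c)%R.
  rewrite lt_neqAle c0 andbT; apply/eqP => c00.
  have [y [/andP[xy yz]]] := pick 0%N; rewrite -c00 => fy0.
  have := fy y; rewrite yz (lt_trans (q_x 0%N) xy) => /(_ isT).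
  apply/negP; rewrite -ltNge; apply: (@lt_le_trans _ _ 0); first by rewrite lte_fin.
  apply: mule_ge0; first by rewrite lee_fin.
  by apply: path_expectation_ge0 => u; case: (path_functional_reach rho z p).
(* The bad point [y] produced by [pick n] lies beyond [x_ n], so reaching [x_ n] is at least as
   early. Using the monotone sequence [x_] avoids any order among the bad points. *)
have bnd n : (f z * E / c)%:E <= \int[P q]_w (edisc rho (reach_time (x_ n) p (X ^~ w)))%:E.
  have [y [/andP[xy yz] fyc]] := pick n.
  have qy : (q < y)%R by exact: lt_trans xy.
  have [F F0 Fint] := edisc_integral_fin rho0 (P q) (measurable_reach y p)
    (fun w => reach_time_ge0 y p (X ^~ w)).
  apply: (@le_trans _ _ F%:E); last first.
    rewrite -Fint; apply: ae_ge0_le_integral => //.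
    - by move=> w _; rewrite lee_fin edisc_ge0.
    - exact: measurable_reach.
    - by move=> w _; rewrite lee_fin edisc_ge0.
    - exact: measurable_reach.
    - apply: filterS (ae_start SM Dq) => w Xw _; rewrite lee_fin.
      apply: edisc_anti => //; first exact: reach_time_ge0.
      by apply: (@reach_timeS (X ^~ w) p q); rewrite // !ltW.
  have qyz : (q <= y <= z)%R by rewrite !ltW.
  have := strong_markov_reach_at p Dq qyz; rewrite Eint Fint.
  have := fy y; rewrite qy yz => /(_ isT).
  have : 0 <= path_expectation X P (reach_functional rho z p) y.
    by apply: path_expectation_ge0 => u; case: (path_functional_reach rho z p).
  case: (path_expectation _ _ _ _) => [v| |] //.
    rewrite -!EFinM !lee_fin => v0 fzv [Ev].
    rewrite ler_pdivrMr// Ev mulrA [(F * c)%R]mulrC ler_wpM2r//.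
    by rewrite (le_trans fzv)// ltW.
  move=> _; rewrite gt0_muley ?lte_fin ?(le_lt_trans c0)//.
have lim : (f z * E / c)%:E <= E%:E.
  rewrite -Eint.
  apply: (integral_limsup (e_ := fun n w => edisc rho (reach_time (x_ n) p (X ^~ w)))) => //.
  - by move=> n; apply/measurable_EFinP; exact: measurable_reach.
  - by apply/measurable_EFinP; exact: measurable_reach.
  - by move=> n w; rewrite edisc_ge0 edisc_le1// reach_time_ge0.
  - by move=> w; rewrite edisc_ge0 edisc_le1// reach_time_ge0.
  apply: filterS (ae_start SM Dq) => w Xw.
  apply: edisc_limsup => //.
  - by move=> n; exact: reach_time_ge0.
  - move=> n m nm; apply: (@reach_timeS (X ^~ w) p q) => //.
    by rewrite (ltW (q_x n)) x_mono.
  - exact: edisc_ge0.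
  move=> s_ s Ss s_s.
  have s_fin n : hit_after (x_ n) 0 (X ^~ w) = (s_ n)%:E /\ (s_ n)%:E < hit_after p 0 (X ^~ w).
    have := Ss n; rewrite /reach_time; case: ifPn => // lt E1.
    by rewrite -E1.
  have s_0 n : (0 <= s_ n)%R by rewrite -lee_fin -(s_fin n).1 first_after_ge0.
  have s_nd n m : (n <= m)%N -> (s_ n <= s_ m)%R.
    move=> nm; rewrite -lee_fin -!Ss; apply: (@reach_timeS (X ^~ w) p q) => //.
    by rewrite (ltW (q_x n)) x_mono.
  have s0 : (0 <= s)%R by apply: (cvgr_to_ge s_s); exact: nearW.
  have Xs : X s w = z.
    have c1 := continuous_path_lim (@cX w) s_0 s_s.
    apply: (cvg_unique _ c1) => //.
    rewrite (_ : (fun n => _) = x_)//; apply/funext => n.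
    have := @hit_after_at _ (X ^~ w) 0 (x_ n) (@cX w).
    by rewrite (s_fin n).1 ltry => /(_ isT).
  have Tz : hit_after z 0 (X ^~ w) <= s%:E.
    by apply: first_after_le => //; rewrite dist_to_le0 Xs.
  (* Every [s_ n] precedes the passage at [p], so the limit is at most that passage; equality is
     excluded because the path is at [z], distinct from [p], at time [s]. *)
  have Tp : s%:E < hit_after p 0 (X ^~ w).
    have [->|[t [Et t0 _]]] := first_after_case 0 (@continuous_dist_to _ p) (@cX w).
      by rewrite ltry.
    rewrite dist_to_le0 => /eqP Xt; rewrite Et lte_fin lt_neqAle; apply/andP; split.
      by apply: contra pz => /eqP st; rewrite -Xt -st Xs.
    apply: (cvgr_to_le s_s); apply: nearW => n.
    by rewrite ltW// -lte_fin -Et; case: (s_fin n).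
  rewrite /reach_time (le_lt_trans Tz Tp).
  by apply: edisc_anti => //; exact: first_after_ge0.
move: lim; rewrite lee_fin ler_pdivrMr// [(E * c)%R]mulrC ler_pM2r//.
by rewrite leNgt cfz.
Qed.

End right_endpoint.

Lemma measurable_mem_set (d : measure_display) (T : measurableType d) (A : set T) :
  measurable A -> measurable_fun setT (fun w => w \in A).
Proof.
move=> mA _; apply: (measurable_fun_bool true) => //.
rewrite (_ : _ @^-1` _ = A) ?setTI//.
by apply/seteqP; split => w /=; [exact: set_mem|exact: mem_set].
Qed.

(** * Optimal stopping on a time grid *)

Section grid.
Context {R : realType} {d : measure_display} {T : measurableType d}.
Context {D : set R} {X : R -> T -> R} {P : R -> probability T R} {rho : R}.
Hypothesis mD : measurable D.
Hypothesis SM : strong_markov_family D X P.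
Hypothesis rho0 : 0 < rho.
Context {f : R -> R} {p : R} {delta : R} {sigma : T -> \bar R}.
Hypothesis mf : measurable_fun setT f.
Hypothesis f0 : forall y, 0 <= f y.
Hypothesis delta0 : 0 < delta.
Hypothesis st : stopping_time X sigma.
Local Open Scope ereal_scope.

Let mX := smf_measurable SM.
Let cX : forall w, continuous_path (X ^~ w) := fun w => smf_continuous SM (w := w).
Let sigma' w := hit_after p (sigma w) (X ^~ w).

Definition grid_time (k : nat) (w : T) : \bar R := sigma w + (k%:R * delta)%:E.

Lemma grid_time0 w : grid_time 0 w = sigma w.
Proof. by rewrite /grid_time mul0r adde0. Qed.

Lemma grid_timeS k w : grid_time k.+1 w = grid_time k w + delta%:E.
Proof. by rewrite /grid_time -addeA -EFinD -natr1 mulrDl mul1r. Qed.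

Lemma grid_time_le j k w : (j <= k)%N -> grid_time j w <= grid_time k w.
Proof.
by move=> jk; rewrite leeD2l// lee_fin ler_wpM2r ?ler_nat// ltW.
Qed.

Lemma stopping_time_grid k : stopping_time X (grid_time k).
Proof. by apply: stopping_time_shift => //; rewrite mulr_ge0// ltW. Qed.

Definition grid_alive k : set T := [set w | grid_time k w < sigma' w].

Let st' : stopping_time X sigma'.
Proof. exact: (stopping_time_hit SM). Qed.

Lemma stopped_grid_alive k : stopped_sigma_algebra X (grid_time k) (grid_alive k).
Proof. by apply: stopped_lt_r => //; exact: stopping_time_grid. Qed.

Lemma grid_aliveS k : grid_alive k.+1 `<=` grid_alive k.
Proof. by move=> w; apply: le_lt_trans; exact: grid_time_le. Qed.

Lemma hit_after_grid k w : grid_alive k w ->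
  hit_after p (grid_time k w) (X ^~ w) = sigma' w.
Proof.
move=> al; apply/esym/first_after_restart => //.
- exact: continuous_dist_to.
- by rewrite -(grid_time0 w) grid_time_le.
- exact: ltW.
Qed.

(** Cut off outside [D], where nothing is known about the laws [P y], so as to be measurable on the
    whole line. *)
Definition step_expectation (v : R -> \bar R) : R -> \bar R :=
  path_expectation X P (step_functional rho p (f p) delta v) \_ D.

(** The dynamic programming recursion for the process absorbed at [p]; the reward on absorption is
    contained in the step functional. *)
Fixpoint snell N : R -> \bar R :=
  if N is N'.+1 then fun y => maxe (f y)%:E (step_expectation (snell N') y)
  else EFin \o f.

Definition stop_value k w : \bar R :=
  (edisc rho (grid_time k w) * f (X (fine (grid_time k w)) w))%:E.

(* The discounted reward from the time [grid_time k] on, [N] steps being left;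
   [A N k] is the event that one stops at once. *)
Fixpoint reward (A : nat -> nat -> set T) N k w : \bar R :=
  if N is N'.+1 then
    if w \in A N k then stop_value k w
    else if sigma' w <= grid_time k.+1 w then (f p * edisc rho (sigma' w))%:E
    else reward A N' k.+1 w
  else stop_value k w.

Lemma stop_value_ge0 k w : 0 <= stop_value k w.
Proof. by rewrite lee_fin mulr_ge0// edisc_ge0. Qed.

Lemma reward_ge0 A N k w : 0 <= reward A N k w.
Proof.
elim: N k => [|N IH] k /=; first exact: stop_value_ge0.
case: ifPn => _; first exact: stop_value_ge0.
by case: ifPn => // _; rewrite lee_fin mulr_ge0// edisc_ge0.
Qed.

Lemma step_expectation_ge0 v y : (forall y, 0 <= v y) -> measurable_fun setT v ->
  0 <= step_expectation v y.
Proof.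
move=> v0 mv; rewrite /step_expectation /patch; case: ifPn => // _.
apply: path_expectation_ge0.
by case: (path_functional_step rho p (f0 p) (ltW delta0) mv v0).
Qed.

Lemma measurable_step_expectation v : (forall y, 0 <= v y) ->
  measurable_fun setT v -> measurable_fun setT (step_expectation v).
Proof.
move=> v0 mv; apply/(measurable_restrictT _ mD).
apply: (path_functional_measurable_expectation SM).
exact: path_functional_step (ltW delta0) mv v0.
Qed.

Lemma snell_ge0_measurable N :
  (forall y, 0 <= snell N y) /\ measurable_fun setT (snell N).
Proof.
elim: N => [|N [v0 mv]] /=; first by split; [move=> y; rewrite lee_fin|apply/measurable_EFinP].
split; first by move=> y; rewrite le_max lee_fin f0.
apply: measurable_maxe; first exact/measurable_EFinP.
exact: measurable_step_expectation.
Qed.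

Lemma measurable_grid_value v k : measurable_fun setT v ->
  measurable_fun setT (fun w => v (X (fine (grid_time k w)) w) : \bar R).
Proof.
move=> mv; apply: (measurableT_comp mv).
exact: (measurable_stopped_value SM (stopping_time_grid k)).
Qed.

Lemma measurable_grid_edisc k : measurable_fun setT (fun w => (edisc rho (grid_time k w))%:E).
Proof. exact: (measurable_edisc_at SM (stopping_time_grid k)). Qed.

Lemma measurable_stop_value k : measurable_fun setT (stop_value k).
Proof.
rewrite (_ : stop_value k = fun w => (edisc rho (grid_time k w))%:E *
    (EFin \o f) (X (fine (grid_time k w)) w)); last first.
  by apply/funext => w; rewrite /stop_value EFinM.
apply: emeasurable_funM; first exact: measurable_grid_edisc.
by apply: (@measurable_grid_value (EFin \o f)); apply/measurable_EFinP.
Qed.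

Lemma measurable_absorbed k : measurable [set w | sigma' w <= grid_time k w].
Proof. by apply: (measurable_le_times SM) => //; exact: stopping_time_grid. Qed.

Lemma measurable_reward A N k : (forall N k, measurable (A N k)) ->
  measurable_fun setT (reward A N k).
Proof.
move=> mA; elim: N k => [|N IH] k /=; first exact: measurable_stop_value.
apply: measurable_fun_ifT.
- exact: measurable_mem_set.
- exact: measurable_stop_value.
apply: measurable_fun_ifT => //.
- apply: (@measurable_fun_lee _ T R setT); first exact: (stopping_time_measurable mX st').
  exact: (stopping_time_measurable mX (stopping_time_grid _)).
- apply/measurable_EFinP; apply: measurable_funM => //.
  by apply/measurable_EFinP; exact: (measurable_edisc_at SM st').
Qed.

Variable x : R.
Hypothesis Dx : D x.

Let step_reward v k w : \bar R :=
  if sigma' w <= grid_time k.+1 w then (f p * edisc rho (sigma' w))%:E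
  else (edisc rho (grid_time k.+1 w))%:E * v (X (fine (grid_time k.+1 w)) w).

Let value_at v k w := (edisc rho (grid_time k w))%:E * v (X (fine (grid_time k w)) w) : \bar R.

Let value_at_ge0 v k w : (forall y, 0 <= v y) -> 0 <= value_at v k w.
Proof. by move=> v0; rewrite mule_ge0// lee_fin edisc_ge0. Qed.

Let measurable_value_at v k : measurable_fun setT v -> measurable_fun setT (value_at v k).
Proof.
move=> mv; apply: emeasurable_funM; first exact: measurable_grid_edisc.
exact: measurable_grid_value.
Qed.

(** The strong Markov property at one grid time. As long as the process is alive, its next passage
    at [p] is still [sigma']. *)
Lemma grid_step v k E : measurable_fun setT v -> (forall y, 0 <= v y) ->
  stopped_sigma_algebra X (grid_time k) E ->
  \int[P x]_(w in E `&` grid_alive k) step_reward v k w =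
  \int[P x]_(w in E `&` grid_alive k) value_at (step_expectation v) k w.
Proof.
move=> mv v0 sE.
have sB : stopped_sigma_algebra X (grid_time k) (E `&` grid_alive k).
  apply: (sigma_algebraI (stopped_sa (stopping_time_grid k)) sE).
  exact: stopped_grid_alive.
have H := strong_markov_step mD SM (rho := rho) p Dx (stopping_time_grid k) sB
  (f0 p) (ltW delta0) mv v0.
apply: etrans; [apply: etrans; [|exact: H]|].
  apply: eq_integral => w; rewrite inE => -[_ al].
  rewrite hit_after_grid// -grid_timeS /step_reward.
  case: ifPn => // _; congr (_ * v (X _ w)); rewrite grid_timeS fineD//.
  rewrite ge0_fin_numE; first exact: (lt_le_trans al (leey _)).
  by case: (stopping_time_grid k).
apply: eq_integral => w _.
rewrite /value_at /step_expectation patchE mem_set//; apply: (smf_state SM).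
by rewrite fine_ge0//; case: (stopping_time_grid k).
Qed.

Let aliveI E k : measurable E -> measurable (E `&` grid_alive k).
Proof.
by move=> mE; apply: measurableI => //; exact: (stopped_measurable mX (stopped_grid_alive k)).
Qed.

Lemma integral_split_step (h : T -> \bar R) k E : measurable E ->
  measurable_fun setT h -> (forall w, 0 <= h w) ->
  \int[P x]_(w in E `&` grid_alive k)
    (if sigma' w <= grid_time k.+1 w then (f p * edisc rho (sigma' w))%:E else h w) =
  \int[P x]_(w in E `&` grid_alive k `&` [set w | sigma' w <= grid_time k.+1 w])
    (f p * edisc rho (sigma' w))%:E +
  \int[P x]_(w in E `&` grid_alive k.+1) h w.
Proof.
move=> mE mh h0.
have mAb := measurable_absorbed k.+1.
have mfp : measurable_fun setT (fun w => (f p * edisc rho (sigma' w))%:E).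
  apply/measurable_EFinP; apply: measurable_funM => //.
  by apply/measurable_EFinP; exact: (measurable_edisc_at SM st').
have fp0 w : 0 <= (f p * edisc rho (sigma' w))%:E by rewrite lee_fin mulr_ge0// edisc_ge0.
have U : E `&` grid_alive k =
    (E `&` grid_alive k `&` [set w | sigma' w <= grid_time k.+1 w]) `|` (E `&` grid_alive k.+1).
  apply/seteqP; split => w /=.
    by move=> [Ew al]; have [?|?] := leP (sigma' w) (grid_time k.+1 w); [left|right].
  by move=> [[]//|[Ew /grid_aliveS]].
rewrite [in LHS]U ge0_integral_setU//.
- congr (_ + _); apply: eq_integral => w; rewrite inE.
    by move=> [_ /= ->].
  by move=> [_ al]; rewrite leNgt al.
- by apply: measurableI => //; exact: aliveI.
- exact: aliveI.
- apply: measurable_funTS; apply: measurable_fun_ifT => //.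
  apply: (@measurable_fun_lee _ T R setT); first exact: (stopping_time_measurable mX st').
  exact: (stopping_time_measurable mX (stopping_time_grid _)).
- by move=> w _; case: ifPn.
- by apply/disj_setPS => w [[_ /= s1] [_ s2]]; have := lt_le_trans s2 s1; rewrite ltxx.
Qed.

Lemma integral_split_stop (h h' : T -> \bar R) k E (A : set T) :
  measurable E -> measurable A ->
  measurable_fun setT h -> (forall w, 0 <= h w) ->
  measurable_fun setT h' -> (forall w, 0 <= h' w) ->
  \int[P x]_(w in E `&` grid_alive k) (if w \in A then h w else h' w) =
  \int[P x]_(w in E `&` A `&` grid_alive k) h w +
  \int[P x]_(w in (E `\` A) `&` grid_alive k) h' w.
Proof.
move=> mE mA mh h0 mh' h'0.
have U : E `&` grid_alive k = (E `&` A `&` grid_alive k) `|` ((E `\` A) `&` grid_alive k).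
  by rewrite -setIUl setUIDK.
rewrite [in LHS]U ge0_integral_setU//.
- congr (_ + _); apply: eq_integral => w; rewrite inE.
    by move=> [[_ Aw] _]; rewrite mem_set.
  by move=> [[_ Aw] _]; rewrite memNset.
- by apply: aliveI; exact: measurableI.
- by apply: aliveI; exact: measurableD.
- apply: measurable_funTS; apply: measurable_fun_ifT => //.
  exact: measurable_mem_set.
- by move=> w _; case: ifPn.
- by apply/disj_setPS => w [[[_ ?] _] [[_ ?] _]].
Qed.

(** Backward induction over the steps left. The rule [A] may use the whole past of each grid time;
    the event [E] is arbitrary so that the induction can continue on the part of it where [A] does
    not stop. *)
Lemma reward_le_snell A N k E :
  (forall N k, stopped_sigma_algebra X (grid_time k) (A N k)) ->
  stopped_sigma_algebra X (grid_time k) E ->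
  \int[P x]_(w in E `&` grid_alive k) reward A N k w <=
  \int[P x]_(w in E `&` grid_alive k) value_at (snell N) k w.
Proof.
move=> sA; have mA N' k' : measurable (A N' k') by exact: (stopped_measurable mX (sA N' k')).
elim: N k E => [|N IH] k E sE; have mE := stopped_measurable mX sE.
  by under eq_integral do rewrite /= /stop_value EFinM.
have [v0 mv] := snell_ge0_measurable N; have [v0' mv'] := snell_ge0_measurable N.+1.
rewrite /= integral_split_stop//; last 4 first.
- exact: measurable_stop_value.
- by move=> w; exact: stop_value_ge0.
- apply: measurable_fun_ifT; last exact: measurable_reward.
    apply: (@measurable_fun_lee _ T R setT); first exact: (stopping_time_measurable mX st').
    exact: (stopping_time_measurable mX (stopping_time_grid _)).
  apply/measurable_EFinP; apply: measurable_funM => //.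
  by apply/measurable_EFinP; exact: (measurable_edisc_at SM st').
- move=> w; case: ifPn => _; last exact: reward_ge0.
  by rewrite lee_fin mulr_ge0// edisc_ge0.
have sE' : stopped_sigma_algebra X (grid_time k) (E `\` A N.+1 k).
  exact: (sigma_algebraD (stopped_sa (stopping_time_grid k))).
have mE' := stopped_measurable mX sE'.
have -> : \int[P x]_(w in E `&` grid_alive k) value_at (snell N.+1) k w =
    \int[P x]_(w in E `&` A N.+1 k `&` grid_alive k) value_at (snell N.+1) k w +
    \int[P x]_(w in (E `\` A N.+1 k) `&` grid_alive k) value_at (snell N.+1) k w.
  rewrite -integral_split_stop//.
  - by apply: eq_integral => w _; case: ifPn.
  - exact: measurable_value_at.
  - by move=> w; exact: value_at_ge0.
  - exact: measurable_value_at.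
  - by move=> w; exact: value_at_ge0.
apply: leeD.
  apply: ge0_le_integral => //.
  - by apply: aliveI; exact: measurableI.
  - by move=> w _; exact: stop_value_ge0.
  - by apply: measurable_funTS; exact: measurable_stop_value.
  - by apply: measurable_funTS; exact: measurable_value_at.
  - move=> w _; rewrite /stop_value EFinM /value_at lee_wpmul2l ?lee_fin ?edisc_ge0//.
    by rewrite /= le_max lexx.
apply: (@le_trans _ _ (\int[P x]_(w in (E `\` A N.+1 k) `&` grid_alive k)
    value_at (step_expectation (snell N)) k w)); last first.
  apply: ge0_le_integral => //.
  - exact: aliveI.
  - by move=> w _; apply: value_at_ge0 => y; exact: step_expectation_ge0.
  - by apply: measurable_funTS; apply: measurable_value_at; exact: measurable_step_expectation.
  - by apply: measurable_funTS; exact: measurable_value_at.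
  - move=> w _; rewrite /value_at lee_wpmul2l ?lee_fin ?edisc_ge0//.
    by rewrite /= le_max lexx orbT.
rewrite -grid_step// integral_split_step//; last 2 first.
- exact: measurable_reward.
- by move=> w; exact: reward_ge0.
rewrite integral_split_step//; last 2 first.
- exact: measurable_value_at.
- by move=> w; exact: value_at_ge0.
rewrite leeD2l//; apply: IH.
by apply: (stopped_mono (stopping_time_grid k.+1) _ sE') => w; exact: grid_time_le.
Qed.

(** Stop when the gain is at least the value of continuing; with [N] steps left, [N.-1] remain after
    the next one. Besides [N] and the grid time, only the current position enters. *)
Definition snell_stop (N k : nat) : set T :=
  [set w | step_expectation (snell N.-1) (X (fine (grid_time k w)) w) <=
           (f (X (fine (grid_time k w)) w))%:E].

(** The same induction, now with equality at each choice: where the rule stops, the maximum in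
    [snell] is the gain, and elsewhere it is the value of continuing. *)
Lemma snell_le_reward N k E :
  (forall N k, stopped_sigma_algebra X (grid_time k) (snell_stop N k)) ->
  stopped_sigma_algebra X (grid_time k) E ->
  \int[P x]_(w in E `&` grid_alive k) value_at (snell N) k w <=
  \int[P x]_(w in E `&` grid_alive k) reward snell_stop N k w.
Proof.
move=> sA; have mA N' k' : measurable (snell_stop N' k').
  exact: (stopped_measurable mX (sA N' k')).
elim: N k E => [|N IH] k E sE; have mE := stopped_measurable mX sE.
  by under [leRHS]eq_integral do rewrite /= /stop_value EFinM.
have [v0 mv] := snell_ge0_measurable N; have [v0' mv'] := snell_ge0_measurable N.+1.
rewrite [leRHS]/= [leRHS]integral_split_stop//; last 4 first.
- exact: measurable_stop_value.
- by move=> w; exact: stop_value_ge0.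
- apply: measurable_fun_ifT; last exact: measurable_reward.
    apply: (@measurable_fun_lee _ T R setT); first exact: (stopping_time_measurable mX st').
    exact: (stopping_time_measurable mX (stopping_time_grid _)).
  apply/measurable_EFinP; apply: measurable_funM => //.
  by apply/measurable_EFinP; exact: (measurable_edisc_at SM st').
- move=> w; case: ifPn => _; last exact: reward_ge0.
  by rewrite lee_fin mulr_ge0// edisc_ge0.
have sE' : stopped_sigma_algebra X (grid_time k) (E `\` snell_stop N.+1 k).
  exact: (sigma_algebraD (stopped_sa (stopping_time_grid k))).
have mE' := stopped_measurable mX sE'.
have -> : \int[P x]_(w in E `&` grid_alive k) value_at (snell N.+1) k w =
    \int[P x]_(w in E `&` snell_stop N.+1 k `&` grid_alive k) value_at (snell N.+1) k w +
    \int[P x]_(w in (E `\` snell_stop N.+1 k) `&` grid_alive k) value_at (snell N.+1) k w.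
  rewrite -integral_split_stop//.
  - by apply: eq_integral => w _; case: ifPn.
  - exact: measurable_value_at.
  - by move=> w; exact: value_at_ge0.
  - exact: measurable_value_at.
  - by move=> w; exact: value_at_ge0.
apply: leeD.
  rewrite le_eqVlt; apply/orP; left; apply/eqP; apply: eq_integral => w.
  rewrite inE => -[[_ sw] _]; rewrite /stop_value EFinM /value_at /=.
  by rewrite max_l.
apply: (@le_trans _ _ (\int[P x]_(w in (E `\` snell_stop N.+1 k) `&` grid_alive k)
    value_at (step_expectation (snell N)) k w)).
  rewrite le_eqVlt; apply/orP; left; apply/eqP; apply: eq_integral => w.
  rewrite inE => -[[_ sw] _]; rewrite /value_at /=.
  by rewrite max_r// leNgt; apply/negP => /ltW.
rewrite -grid_step// integral_split_step//; last 2 first.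
- exact: measurable_value_at.
- by move=> w; exact: value_at_ge0.
rewrite integral_split_step//; last 2 first.
- exact: measurable_reward.
- by move=> w; exact: reward_ge0.
rewrite leeD2l//; apply: IH.
by apply: (stopped_mono (stopping_time_grid k.+1) _ sE') => w; exact: grid_time_le.
Qed.

End grid.

Arguments snell {R d T} D X P rho f p delta N y.
Arguments grid_time {R d T} delta sigma k w.
Arguments grid_alive {R d T} X p delta sigma k w.
Arguments reward {R d T} X rho f p delta sigma A N k w.
Arguments snell_stop {R d T} D X P rho f p delta sigma N k w.
Arguments stop_value {R d T} X rho f delta sigma k w.
Arguments step_expectation {R d T} D X P rho f p delta v y.

(** * From excessivity to the Snell envelope *)

Section crossing_down.
Context {R : realType} {d : measure_display} {T : measurableType d}.
Context {D : set R} {X : R -> T -> R} {P : R -> probability T R} {rho : R}.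
Hypothesis mD : measurable D.
Hypothesis SM : strong_markov_family D X P.
Hypothesis rho0 : 0 < rho.
Context {f : R -> R}.
Hypothesis mf : measurable_fun setT f.
Hypothesis f0 : forall y, 0 <= f y.
Local Open Scope ereal_scope.

Let mX := smf_measurable SM.
Let cX : forall w, continuous_path (X ^~ w) := fun w => smf_continuous SM (w := w).

Lemma stopped_cst_preimage s (G : set R) : (0 <= s)%R -> measurable G ->
  stopped_sigma_algebra X (fun=> s%:E) (X s @^-1` G).
Proof.
move=> s0 mG.
have nfG t : (s <= t)%R -> natural_filtration X t (X s @^-1` G).
  by move=> st; apply: natural_filtration_preimage; rewrite ?s0.
split; first by apply: natural_filtration_generated; exact: (nfG s).
move=> t t0; have [st|st] := leP s t.
  rewrite (_ : [set w | _] = setT) ?setIT; first exact: nfG.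
  by apply/seteqP; split => w //= _; rewrite lee_fin.
rewrite (_ : [set w | _] = set0) ?setI0; first by case: (@natural_filtration_sa _ _ _ X t).
by apply/seteqP; split => w //=; rewrite lee_fin leNgt st.
Qed.

Section snell_bound.
Variables (p delta q : R).
Hypothesis delta0 : (0 < delta)%R.
Hypothesis Dq : D q.
Hypothesis qp : q != p.

Let sigma : T -> \bar R := fun=> 0.
Let A := snell_stop D X P rho f p delta sigma.
Let g := grid_time delta sigma.
Let Tp w := hit_after p 0 (X ^~ w).

Let sg k : stopping_time X (g k).
Proof. by apply: stopping_time_grid => //; exact: stopping_time0. Qed.

(** Here [sigma] is 0, so the grid times are deterministic and the rule is a condition on the
    position at a fixed time. *)
Let stopped_A N k : stopped_sigma_algebra X (g k) (A N k).
Proof.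
have gE : g k = fun=> (k%:R * delta)%:E.
  by apply/funext => w; rewrite /g /grid_time add0e.
have [v0 mv] := snell_ge0_measurable (rho := rho) (p := p) mD SM mf f0 delta0 N.-1.
have mG : measurable [set y | step_expectation D X P rho f p delta
    (snell D X P rho f p delta N.-1) y <= (f y)%:E].
  rewrite -[Z in measurable Z]setTI; apply: measurable_lee => //.
    exact: (measurable_step_expectation mD SM f0 delta0 v0 mv).
  exact/measurable_EFinP.
have := stopped_cst_preimage (mulr_ge0 (ler0n R k) (ltW delta0)) mG.
rewrite -gE; congr (stopped_sigma_algebra _ _ _).
apply/funext => w; rewrite /A /snell_stop /preimage /mkset.
by have -> : grid_time delta sigma k w = (k%:R * delta)%:E by rewrite /grid_time add0e.
Qed.

Fixpoint snell_time N k w : \bar R :=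
  if N is N'.+1 then if w \in A N k then g k w else snell_time N' k.+1 w
  else g k w.

Let snell_time_ge N k w : g k w <= snell_time N k w.
Proof.
elim: N k => [|N IH] k //=; case: ifPn => // _.
by apply: le_trans (IH k.+1); exact: grid_time_le.
Qed.

Lemma stopping_time_snell N k : stopping_time X (snell_time N k).
Proof.
split; first by move=> w; apply: le_trans (snell_time_ge N k w); case: (sg k).
elim: N k => [|N IH] k t t0 /=; first by case: (sg k) => _; exact.
have [_ nA] := stopped_A N.+1 k.
have [_ nAC] : stopped_sigma_algebra X (g k) (~` A N.+1 k).
  exact: (sigma_algebraC (stopped_sa (sg k))).
rewrite (_ : mkset _ = (A N.+1 k `&` [set w | g k w <= t%:E]) `|`
  ((~` A N.+1 k `&` [set w | g k w <= t%:E]) `&` [set w | snell_time N k.+1 w <= t%:E])).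
  apply: (sigma_algebraU (natural_filtration_sa t)); first exact: nA.
  apply: (sigma_algebraI (natural_filtration_sa t)); first exact: nAC.
  exact: IH.
apply/seteqP; split => w /=.
- case: ifPn => [/set_mem ? ?|]; first by left.
  rewrite notin_setE => ? le; right; split => //; split => //.
  apply: le_trans le; apply: le_trans (snell_time_ge N k.+1 w).
  exact: grid_time_le.
- by case=> [[Aw le]|[[Aw _] le]]; [rewrite mem_set|rewrite memNset].
Qed.

Lemma reward_payoff N k w : grid_alive X p delta sigma k w ->
  reward X rho f p delta sigma A N k w =
  (payoff X rho f (fun w => Order.min (snell_time N k w) (Tp w)) w)%:E.
Proof.
have stopE j : grid_alive X p delta sigma j w ->
    (payoff X rho f (fun w => Order.min (g j w) (Tp w)) w)%:E =
    stop_value X rho f delta sigma j w.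
  move=> al; rewrite payoffE /stop_value min_l; last exact: ltW.
  by rewrite mulrC.
elim: N k => [|N IH] k al /=; first by rewrite -stopE.
rewrite payoffE /=; case: ifPn => _; first by rewrite -stopE// payoffE.
case: ifPn => [le|]; last first.
  by rewrite -ltNge => lt; rewrite IH// payoffE.
rewrite min_r; last exact: (le_trans le (snell_time_ge N k.+1 w)).
have fin : Tp w < +oo.
  by apply: (le_lt_trans le); rewrite /grid_time add0e ltry.
by rewrite (@hit_after_at _ (X ^~ w) 0 p (@cX w) fin).
Qed.

(** For a start at [q], the optimal grid rule is realized by the stopping time [snell_time N 0], and
    excessivity is tested on it. A bound at the single point [q] is enough, because the process sits
    at [q] whenever a downward crossing begins. *)
Lemma snell_le N :
  (forall tau, stopping_time X tau ->
     \int[P q]_w (payoff X rho f (fun w => Order.min (tau w) (Tp w)) w)%:E <= (f q)%:E) ->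
  snell D X P rho f p delta N q <= (f q)%:E.
Proof.
move=> excessive.
have [v0 mv] := snell_ge0_measurable (rho := rho) (p := p) mD SM mf f0 delta0 N.
have st0 : stopping_time X sigma := stopping_time0.
have sT : stopped_sigma_algebra X (g 0%N) setT := sigma_algebraT (stopped_sa (sg 0%N)).
have sTp : stopping_time X Tp by apply: (stopping_time_hit SM); exact: stopping_time0.
have := snell_le_reward (rho := rho) (p := p) mD SM mf f0 delta0 st0 Dq N stopped_A sT.
rewrite setTI => le1.
have mal : measurable (grid_alive X p delta sigma 0).
  by apply: (stopped_measurable mX); exact: (stopped_grid_alive SM delta0 st0 0%N).
have stau := stopping_time_min (stopping_time_snell N 0) sTp.
apply: le_trans (excessive _ (stopping_time_snell N 0)).
apply: (@le_trans _ _ (\int[P q]_(w in grid_alive X p delta sigma 0)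
    reward X rho f p delta sigma A N 0 w)); last first.
  apply: (@le_trans _ _ (\int[P q]_(w in grid_alive X p delta sigma 0)
      (payoff X rho f (fun w => Order.min (snell_time N 0 w) (Tp w)) w)%:E)).
    rewrite le_eqVlt; apply/orP; left; apply/eqP.
    by apply: eq_integral => w /set_mem; exact: reward_payoff.
  apply: ge0_subset_integral => //; first exact: (measurable_payoff SM mf stau).
  by move=> w _; rewrite lee_fin payoff_ge0.
apply: le_trans le1.
have -> : snell D X P rho f p delta N q = \int[P q]_w (cst (snell D X P rho f p delta N q) w).
  by rewrite integral_cst//; rewrite [X in _ * X]probability_setT mule1.
rewrite [leRHS]integral_mkcond; apply: ae_ge0_le_integral => //.
- by move=> w _; exact: v0.
- move=> w _; apply: erestrict_ge0 => w' _.
  by rewrite mule_ge0// lee_fin edisc_ge0.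
- apply/(measurable_restrictT _ mal); apply: measurable_funTS.
  apply: emeasurable_funM; first exact: (measurable_grid_edisc SM delta0 st0).
  exact: (measurable_grid_value SM delta0 st0 _ mv).
apply: filterS (ae_start SM Dq) => w Xw _.
have g0 : grid_time delta sigma 0 w = 0 by rewrite grid_time0.
(* The process is alive at time 0 because it starts at [q != p]. *)
rewrite patchE mem_set; last first.
  rewrite /grid_alive /= g0 lt_neqAle first_after_ge0 andbT.
  apply/eqP => E0; have := first_after_attained (@continuous_dist_to _ p) (@cX w) (esym E0).
  by move=> [_ _]; rewrite dist_to_le0 Xw (negbTE qp).
by rewrite g0 edisc0 mul1e /= Xw.
Qed.

End snell_bound.

(** The discount is Lipschitz with constant [rho]: combine [1 + x <= expR x] with the discount being
    at most 1. *)
Lemma edisc_lower (t t' : R) : (0 <= t)%R -> (t <= t')%R ->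
  (edisc rho t%:E - rho * (t' - t) <= edisc rho t'%:E)%R.
Proof.
move=> t0 tt'.
have e1 : (edisc rho t%:E <= 1)%R by apply: edisc_le1; rewrite ?lee_fin.
have e0 : (0 <= edisc rho t%:E)%R := edisc_ge0 _ _.
have -> : t'%:E = t%:E + (t' - t)%:E by rewrite -EFinD addrC subrK.
rewrite ediscD.
have h : (1 - rho * (t' - t) <= edisc rho (t' - t)%:E)%R.
  by rewrite /edisc; apply: expR_ge1Dx.
have r0 : (0 <= rho * (t' - t))%R by rewrite mulr_ge0 ?subr_ge0// ltW.
apply: le_trans (ler_wpM2l e0 h).
by rewrite [leRHS]mulrBr mulr1 lerD2l lerN2 ler_piMl.
Qed.

Section reward_evaluation.
Variables (p delta : R) (tau sigma : T -> \bar R).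
(** The rule that rounds [tau] up to the grid. Rounding up keeps it adapted, whatever information
    [tau] uses. *)
Let A (_ k : nat) : set T := [set w | tau w <= grid_time delta sigma k w].
Let g := grid_time delta sigma.
Let sigma' w := hit_after p (sigma w) (X ^~ w).
Hypothesis delta0 : (0 < delta)%R.

Lemma reward_stop N n k w : (n <= N)%N ->
  (forall i, (i < n)%N -> g (k + i) w < tau w) ->
  tau w <= g (k + n) w -> g (k + n) w < sigma' w ->
  reward X rho f p delta sigma A N k w = stop_value X rho f delta sigma (k + n) w.
Proof.
elim: N n k => [|N IH] [|n] k //= nN lt le al; rewrite ?addn0//.
  by rewrite mem_set// /A /= -[k]addn0.
rewrite memNset; last first.
  by rewrite /A /=; apply/negP; rewrite -ltNge -[k]addn0; exact: lt.
rewrite ifF; last first.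
  apply/negbTE; rewrite -ltNge; apply: le_lt_trans al.
  by apply: grid_time_le => //; rewrite addnS ltnS leq_addr.
rewrite addnS -addSn; apply: IH => //; rewrite ?addSn -?addnS//.
by move=> i lin; rewrite addSn -addnS; exact: lt.
Qed.

Lemma reward_absorbed N n k w : (n < N)%N ->
  (forall i, (i <= n)%N -> g (k + i) w < tau w) ->
  g (k + n) w < sigma' w -> sigma' w <= g (k + n).+1 w ->
  reward X rho f p delta sigma A N k w = (f p * edisc rho (sigma' w))%:E.
Proof.
elim: N n k => [|N IH] [|n] k //= nN lt al le.
  rewrite addn0 in le; rewrite memNset ?ifT//.
  by rewrite /A /=; apply/negP; rewrite -ltNge -[k]addn0; exact: lt.
rewrite memNset; last first.
  by rewrite /A /=; apply/negP; rewrite -ltNge -[k]addn0; exact: lt.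
rewrite ifF; last first.
  apply/negbTE; rewrite -ltNge; apply: le_lt_trans al.
  by apply: grid_time_le => //; rewrite addnS ltnS leq_addr.
apply: (IH n) => //; rewrite ?addSn -?addnS//.
by move=> i lin; rewrite addSn -addnS; exact: lt.
by rewrite addnS.
Qed.

Lemma grid_round s t N w : sigma w = s%:E -> (s <= t)%R -> (t <= s + N%:R * delta)%R ->
  exists K, [/\ (K <= N)%N, forall i, (i < K)%N -> g i w < t%:E,
    t%:E <= g K w & g K w < (t + delta)%:E].
Proof.
move=> sE st tN.
have gE k : g k w = (s + k%:R * delta)%:E by rewrite /g /grid_time sE.
have ex : exists k, t%:E <= g k w by exists N; rewrite gE lee_fin.
case: (ex_minnP ex) => K tK Kmin; exists K; split => //.
- by apply: Kmin; rewrite gE lee_fin.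
- by move=> i iK; rewrite ltNge; apply/negP => /Kmin; rewrite leqNgt iK.
- case: K tK Kmin => [|K] tK Kmin.
    by rewrite gE lte_fin mul0r addr0 ltr_pwDr.
  have : g K w < t%:E by rewrite ltNge; apply/negP => /Kmin; rewrite ltnn.
  by rewrite !gE !lte_fin -natr1 mulrDl mul1r addrA ltrD2r.
Qed.

End reward_evaluation.

End crossing_down.

(** * The inequality for downward crossings *)

Section crossing_down_inequality.
Context {R : realType} {d : measure_display} {T : measurableType d}.
Context {D : set R} {X : R -> T -> R} {P : R -> probability T R} {rho : R}.
Hypothesis mD : measurable D.
Hypothesis SM : strong_markov_family D X P.
Hypothesis rho0 : 0 < rho.
Context {f : R -> R}.
Hypothesis mf : measurable_fun setT f.
Hypothesis f0 : forall y, 0 <= f y.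
Local Open Scope ereal_scope.

Let mX := smf_measurable SM.
Let cX : forall w, continuous_path (X ^~ w) := fun w => smf_continuous SM (w := w).

Variables (x p q : R) (tau sigma : T -> \bar R).
Hypothesis Dx : D x.
Hypothesis Dq : D q.
Hypothesis qp : q != p.
Hypothesis tt : stopping_time X tau.
Hypothesis st : stopping_time X sigma.

Let sigma' w := hit_after p (sigma w) (X ^~ w).

(** Lower semicontinuity along the path and from the right in time only, since the grid rule stops
    slightly after [tau]. *)
Definition right_lsc_on_crossing w := forall t : R, sigma w <= t%:E -> t%:E < sigma' w ->
  forall e : R, (0 < e)%R -> exists2 eta : R, (0 < eta)%R &
    forall t', (t <= t' < t + eta)%R -> (f (X t w) - e <= f (X t' w))%R.

Let mesh m : R := m.+1%:R^-1.
Let mesh0 m : (0 < mesh m)%R. Proof. by rewrite invr_gt0. Qed.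
(** With mesh [1 / (m + 1)] these many steps cover a horizon of length [m + 1]: the mesh tends to 0
    while the horizon tends to infinity. *)
Let steps m : nat := (m.+1 * m.+1)%N.
Let horizon m : ((steps m)%:R * mesh m = m.+1%:R :> R)%R.
Proof. by rewrite /steps /mesh natrM mulfK. Qed.

Let A m (_ k : nat) : set T := [set w | tau w <= grid_time (mesh m) sigma k w].
Let rew m := reward X rho f p (mesh m) sigma (A m) (steps m) 0.

Let target w : R := if tau w < sigma' w then payoff X rho f tau w
  else (f p * edisc rho (sigma' w))%R.

(** The pointwise input for Fatou's lemma. If [tau] comes before absorption, so does its rounding on
    a fine grid, and only semicontinuity and the change of discount cost something; otherwise the
    absorption reward is collected exactly once the horizon is long enough. *)
Lemma reward_liminf w : sigma w <= tau w -> sigma w < sigma' w ->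
  right_lsc_on_crossing w -> (target w)%:E <= limn_einf (rew ^~ w).
Proof.
move=> st_w al lsc; apply: limn_einf_ge => e e0.
have s0 := st.1 w.
have [s sE] : exists s, sigma w = s%:E.
  by move: s0 al; case: (sigma w) => [s| |]// _; [exists s|rewrite ltNge leey].
have rew0 m : 0 <= rew m w by exact: reward_ge0.
have near (a : R) : exists M : nat, forall m, (M <= m)%N -> (a <= m.+1%:R :> R)%R.
  exists (Num.truncn a) => m Mm.
  by rewrite ltW// (lt_le_trans (truncnS_gt a))// ler_nat ltnS.
have mesh_small (a : R) : (0 < a)%R -> exists M : nat, forall m, (M <= m)%N -> (mesh m <= a)%R.
  move=> a0; have [M HM] := near (a^-1)%R; exists M => m /HM am.
  by rewrite /mesh invf_ple// posrE.
rewrite /target; case: ifPn => [lt|]; last first.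
  rewrite -leNgt => le.
  have [E|[u [E u0 su Xu]]] := first_after_case (sigma w) (@continuous_dist_to _ p) (@cX w).
    exists 0%N => m _; rewrite /sigma' E mulr0 sub0r.
    by apply: (@le_trans _ _ 0); rewrite // lee_fin oppr_le0 ltW.
  have lt_su : (s < u)%R by move: al; rewrite /sigma' E sE lte_fin.
  have [M HM] := near (u - s)%R; exists M => m /HM us.
  have sE' : (s <= u)%R by exact: ltW.
  have uN : (u <= s + (steps m)%:R * mesh m)%R by rewrite horizon -lerBlDl.
  have [K [KN Klt uK _]] := grid_round (delta := mesh m) (mesh0 m) sE sE' uN.
  have K0 : (0 < K)%N.
    case: K {KN Klt} uK => //; rewrite grid_time0 sE lee_fin.
    by rewrite leNgt lt_su.
  case: K K0 KN Klt uK => // K _ KN Klt uK.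
  rewrite /rew (@reward_absorbed _ _ _ X rho f p (mesh m) tau sigma (mesh0 m) (steps m) K 0).
  - by rewrite lee_fin gerBl ltW.
  - exact: KN.
  - move=> i iK; rewrite add0n; apply: lt_le_trans le; rewrite /sigma' E.
    exact: Klt.
  - by rewrite add0n E; exact: Klt.
  - by rewrite add0n E.
have t0 := tt.1 w.
have [t tE] : exists t, tau w = t%:E.
  by move: t0 lt; case: (tau w) => [t| |]// _; [exists t|rewrite ltNge leey].
have {}t0 : (0 <= t)%R by rewrite -lee_fin -tE.
have st_le : (s <= t)%R by rewrite -lee_fin -sE -tE.
have e20 : (0 < e / 2)%R by rewrite divr_gt0.
have le_st : sigma w <= t%:E by rewrite -tE.
have lt_ts : t%:E < sigma' w by rewrite -tE.
have [eta eta0 Heta] := lsc t le_st lt_ts _ e20.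
(* A mesh below [r0] prevents the rounded time from overshooting the absorption. *)
have [r0 r00 Hr] : exists2 r0 : R, (0 < r0)%R & (t + r0)%:E <= sigma' w.
  move: lt_ts; case: (sigma' w) => [u| |] // lt_ts.
    by exists (u - t)%R; rewrite ?subr_gt0// addrC subrK.
  by exists 1%R; rewrite ?leey.
have a0 := f0 (X t w); set a := f (X t w) in a0 Heta *.
(* Half of [e] pays for semicontinuity and half for discounting. A delay below [b] costs at most
   [a * rho * b <= e / 2]; the added 1 keeps the denominator positive when [a = 0]. *)
have b0 : (0 < a * rho + 1)%R by rewrite ltr_wpDl// mulr_ge0// ltW.
pose b := (e / 2 / (a * rho + 1))%R.
have bgt0 : (0 < b)%R by rewrite divr_gt0.
have [M1 HM1] := near (t - s)%R.
have [M2 HM2] := mesh_small _ eta0.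
have [M3 HM3] := mesh_small _ r00.
have [M4 HM4] := mesh_small _ bgt0.
exists (maxn (maxn M1 M2) (maxn M3 M4)) => m.
rewrite !geq_max => /andP[/andP[/HM1 m1 /HM2 m2] /andP[/HM3 m3 /HM4 m4]].
have tN : (t <= s + (steps m)%:R * mesh m)%R by rewrite horizon -lerBlDl.
have [K [KN Klt tK Kt]] := grid_round (delta := mesh m) (mesh0 m) sE st_le tN.
have Kal : grid_time (mesh m) sigma (0 + K) w < sigma' w.
  rewrite add0n; apply: (lt_le_trans Kt); apply: le_trans Hr.
  by rewrite lee_fin lerD2l.
rewrite /rew (@reward_stop _ _ _ X rho f p (mesh m) tau sigma (mesh0 m)
  (steps m) K 0)//; last 2 first.
- by move=> i iK; rewrite add0n tE; exact: Klt.
- by rewrite add0n tE.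
rewrite add0n payoffE /stop_value tE.
have gE : grid_time (mesh m) sigma K w = (s + K%:R * mesh m)%:E.
  by rewrite /grid_time sE.
move: tK Kt; rewrite gE !lee_fin lte_fin; set t' := (s + _)%R => tt' t't.
rewrite [fine _]/= [fine _]/=.
have d1 := edisc_lower rho0 t0 tt'.
have d0 : (edisc rho t'%:E <= 1)%R by apply: edisc_le1; rewrite // lee_fin (le_trans t0).
have d2 : (0 <= edisc rho t'%:E)%R := edisc_ge0 _ _.
have fl : (a - e / 2 <= f (X t' w))%R.
  by apply: Heta; rewrite tt' (lt_le_trans t't)// lerD2l.
have s1 : (a * (edisc rho t%:E - rho * (t' - t)) <= a * edisc rho t'%:E)%R.
  exact: ler_wpM2l.
have s2 : (edisc rho t'%:E * (a - e / 2) <= edisc rho t'%:E * f (X t' w))%R.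
  exact: ler_wpM2l.
have s3 : (a * (rho * (t' - t)) <= e / 2)%R.
  apply: (@le_trans _ _ ((a * rho + 1) * b)%R); last first.
    by rewrite /b mulrC divfK// gt_eqF.
  rewrite mulrA ler_pM//; [by rewrite mulr_ge0// ltW|by rewrite subr_ge0| |].
    by rewrite lerDl.
  by rewrite lerBlDl (le_trans (ltW t't))// lerD2l.
have s4 : (edisc rho t'%:E * (e / 2) <= e / 2)%R.
  by rewrite ler_piMl// ltW.
move: s1 s2 s3 s4; rewrite !mulrBr.
move: (edisc rho t'%:E * f _)%R (edisc rho t'%:E * (e / 2))%R
  (a * (rho * t'))%R (a * (rho * t))%R => B1 B2 B3 B4.
rewrite [(edisc rho t'%:E * a)%R]mulrC -/a.
by move: (a * edisc rho t%:E)%R (a * edisc rho t'%:E)%R => C1 C2; lra.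
Qed.

(** The reward of the rounded rule is at most the Snell envelope at time [sigma], hence at most
    [f q] times the discount there, uniformly in the mesh; Fatou's lemma turns this into the bound
    for [target]. *)
Lemma crossing_down :
  (forall tau, stopping_time X tau ->
     \int[P q]_w (payoff X rho f (fun w => Order.min (tau w) (hit_after p 0 (X ^~ w))) w)%:E
     <= (f q)%:E) ->
  {ae P x, forall w, sigma w < +oo -> X (fine (sigma w)) w = q} ->
  {ae P x, forall w, sigma w < +oo -> right_lsc_on_crossing w} ->
  crossing_inequality (rho := rho) (P := P) (X := X) x f tau sigma sigma' (f q) (f p).
Proof.
move=> excessive Xq lsc; rewrite /crossing_inequality.
have st' : stopping_time X sigma' by exact: (stopping_time_hit SM).
pose E := [set w | sigma w <= tau w]; pose L := [set w | sigma w < sigma' w].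
have sE : stopped_sigma_algebra X sigma E by exact: stopped_le_l.
have mE : measurable E by exact: (stopped_measurable mX sE).
have mL : measurable L by apply: (measurable_lt_times SM).
have mEL : measurable (E `&` L) by exact: measurableI.
have mC : measurable [set w | tau w < sigma' w] by apply: (measurable_lt_times SM).
have mB : measurable [set w | sigma' w <= tau w] by apply: (measurable_le_times SM).
have med s : stopping_time X s -> measurable_fun setT (fun w => (edisc rho (s w))%:E).
  exact: (measurable_edisc_at SM).
have ed0 s w : 0 <= (edisc rho (s w))%:E by move=> *; rewrite lee_fin edisc_ge0.
have alE m : grid_alive X p (mesh m) sigma 0 = L.
  by apply/seteqP; split => w; rewrite /grid_alive /= grid_time0.
have sA m N k : stopped_sigma_algebra X (grid_time (mesh m) sigma k) (A m N k).
  by apply: stopped_le_r => //; exact: (stopping_time_grid (mesh0 m) st).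
have mrew m : measurable_fun setT (rew m).
  apply: (measurable_reward SM mf (mesh0 m) st) => N k.
  exact: (stopped_measurable mX (sA m N k)).
have rew0 m w : 0 <= rew m w by exact: reward_ge0.
have bound m : \int[P x]_(w in E `&` L) rew m w <=
    (f q)%:E * \int[P x]_(w in E) (edisc rho (sigma w))%:E.
  have sE0 : stopped_sigma_algebra X (grid_time (mesh m) sigma 0) E.
    rewrite (_ : grid_time _ _ 0 = sigma)//.
    by apply/funext => w; exact: grid_time0.
  have := reward_le_snell (p := p) (rho := rho) mD SM mf f0 (mesh0 m) st Dx (steps m) (sA m) sE0.
  rewrite alE => /le_trans; apply.
  have [v0 mv] := snell_ge0_measurable (rho := rho) (p := p) mD SM mf f0 (mesh0 m) (steps m).
  have vq := snell_le mD SM mf f0 (mesh0 m) Dq qp (steps m) excessive.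
  rewrite -ge0_integralZl//; first last.
  - by rewrite lee_fin.
  - by apply: measurable_funTS; exact: med.
  apply: (@le_trans _ _ (\int[P x]_(w in E `&` L) ((f q)%:E * (edisc rho (sigma w))%:E))).
    apply: ae_ge0_le_integral => //.
    - by move=> w _; rewrite mule_ge0// lee_fin edisc_ge0.
    - apply: measurable_funTS; apply: emeasurable_funM.
        exact: (measurable_grid_edisc SM (mesh0 m) st).
      exact: (measurable_grid_value SM (mesh0 m) st _ mv).
    - by move=> w _; rewrite mule_ge0// lee_fin.
    - by apply: measurable_funTS; apply: measurable_funeM; exact: med.
    - apply: filterS Xq => w Xw [_ Lw]; rewrite grid_time0 Xw; last first.
        exact: (lt_le_trans Lw (leey _)).
      by rewrite muleC lee_wpmul2r.
  apply: ge0_subset_integral => //.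
  - by apply: measurable_funTS; apply: measurable_funeM; exact: med.
  - by move=> w _; rewrite mule_ge0// lee_fin.
have mtarget : measurable_fun setT (fun w => (target w)%:E).
  rewrite (_ : (fun w => _) = fun w => if tau w < sigma' w then (payoff X rho f tau w)%:E
    else (f p)%:E * (edisc rho (sigma' w))%:E); last first.
    by apply/funext => w; rewrite /target; case: ifPn.
  apply: measurable_fun_ifT.
  - by apply: (@measurable_fun_lte _ T R setT); exact: (stopping_time_measurable mX).
  - exact: (measurable_payoff SM mf tt).
  - by apply: measurable_funeM; exact: med.
have target0 w : 0 <= (target w)%:E.
  rewrite lee_fin /target; case: ifPn => _; first exact: payoff_ge0.
  by rewrite mulr_ge0// edisc_ge0.
have fat : \int[P x]_(w in E `&` L) (target w)%:E <=
    (f q)%:E * \int[P x]_(w in E) (edisc rho (sigma w))%:E.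
  apply: (@le_trans _ _ (\int[P x]_(w in E `&` L) limn_einf (rew ^~ w))).
    apply: ae_ge0_le_integral => //.
    - exact: measurable_funTS.
    - by move=> w _; apply: (limn_einf_ge (v := 0%R)) => e e0; exists 0%N => n _;
        apply: (@le_trans _ _ 0); rewrite // lee_fin sub0r oppr_le0 ltW.
    - under eq_fun do rewrite limn_einf_lim.
      apply: (emeasurable_fun_cvg (fun n w => einfs (rew ^~ w) n)).
        by move=> n; apply: measurable_fun_einfs => m; exact: measurable_funTS.
      by move=> w _; exact: is_cvg_einfs.
    - apply: filterS lsc => w lscw [Ew Lw]; apply: reward_liminf => //.
      by apply: lscw; exact: (lt_le_trans Lw (leey _)).
  have := fatou (P x) mEL (fun m => measurable_funTS (mrew m)) (fun m w _ => rew0 m w).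
  move=> /le_trans; apply.
  rewrite limn_einf_lim (cvg_lim _ (@cvg_einfs_sup _ _))//.
  apply: ge_ereal_sup => _ [n _ <-]; apply: le_trans (bound n).
  by apply: ereal_inf_lbound; exists n => /=.
apply: le_trans fat.
(* Off [L] the times [sigma] and [sigma'] coincide. If finite, the path would be at [q] and at [p]
   simultaneously; if infinite, the discount is 0. *)
have -> : \int[P x]_(w in [set w | sigma' w <= tau w]) (edisc rho (sigma' w))%:E =
    \int[P x]_(w in [set w | sigma' w <= tau w] `&` L) (edisc rho (sigma' w))%:E.
  transitivity (\int[P x]_(w in [set w | sigma' w <= tau w])
      (if sigma w < sigma' w then (edisc rho (sigma' w))%:E else 0)).
    apply: ge0_ae_eq_integral => //.
    - by apply: measurable_funTS; exact: med.
    - apply: measurable_funTS; apply: measurable_fun_ifT => //; last exact: med.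
      by apply: (@measurable_fun_lte _ T R setT); exact: (stopping_time_measurable mX).
    - by move=> w _; case: ifPn.
    - apply: filterS Xq => w Xw _; case: ifPn => //; rewrite -leNgt => le.
      have eq : sigma' w = sigma w.
        by apply/eqP; rewrite eq_le le; exact: first_after_ge.
      have [fin|] := ltP (sigma' w) +oo; last first.
        by rewrite leye_eq => /eqP ->.
      have := @hit_after_at _ (X ^~ w) (sigma w) p (@cX w) fin.
      rewrite -/(sigma' w) eq Xw -?eq// => qp'.
      by move: qp; rewrite qp' eqxx.
  rewrite (@integral_vanish _ _ _ _ L); last first.
    by move=> w _ nL; rewrite ifF//; apply/negP.
  by apply: eq_integral => w; rewrite inE => -[_ Lw]; rewrite ifT.
rewrite -ge0_integralZl//; first last.
- by rewrite lee_fin.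
- by apply: measurable_funTS; exact: med.
- exact: measurableI.
rewrite (_ : E `&` L = ([set w | sigma w <= tau w] `&` [set w | tau w < sigma' w]) `|`
   ([set w | sigma' w <= tau w] `&` L)).
  rewrite ge0_integral_setU//.
  - apply: leeD.
      rewrite le_eqVlt; apply/orP; left; apply/eqP; apply: eq_integral => w.
      by rewrite inE => -[_ /= lt]; rewrite /target lt.
    rewrite le_eqVlt; apply/orP; left; apply/eqP; apply: eq_integral => w.
    by rewrite inE => -[/= le _]; rewrite /target ltNge le EFinM.
  - exact: measurableI.
  - exact: measurableI.
  - exact: measurable_funTS.
  - by apply/disj_setPS => w [[_ /= s1] [/= s2 _]]; have := lt_le_trans s1 s2; rewrite ltxx.
apply/seteqP; split => w /=.
- by move=> [Ew Lw]; have [s1|s1] := leP (sigma' w) (tau w); [right|left].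
- case=> [[Ew lt]|[le Lw]]; first by split => //; exact: le_lt_trans lt.
  by split => //; apply: (le_trans (ltW Lw)).
Qed.

End crossing_down_inequality.

(** * Threshold stopping times *)

Section threshold_payoffs.
Context {R : realType} {d : measure_display} {T : measurableType d}.
Context {D : set R} {l r : \bar R} {a sigma : R -> R}.
Context {X : R -> T -> R} {P : R -> probability T R} {rho : R} {psi phi g : R -> R}.
Hypothesis RD : regular_diffusion D l r a sigma X P.
Hypothesis rho0 : 0 < rho.
Hypothesis FS : fundamental_solutions l r a sigma X P rho psi phi.
Hypothesis mg : measurable_fun D g.

Lemma regular_diffusion_markov : strong_markov_family D X P.
Proof. by case: RD. Qed.

Lemma regular_diffusion_sub x : open_itv l r x -> D x.
Proof. by case: RD => -[_ sub _] _ _ _; exact: sub. Qed.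

Lemma regular_diffusion_ends x : D x -> (l <= x%:E)%E /\ (x%:E <= r)%E.
Proof. by case: RD => -[_ _ sub] _ _ _ /sub. Qed.

Lemma open_itv_between x y z : D x -> D z -> x < y -> y < z -> open_itv l r y.
Proof.
move=> /regular_diffusion_ends[lx _] /regular_diffusion_ends[_ zr] xy yz; split.
  by apply: (le_lt_trans lx); rewrite lte_fin.
by apply: lt_le_trans zr; rewrite lte_fin.
Qed.

Lemma measurable_state_space : measurable D.
Proof.
apply: is_interval_measurable => x z Dx Dz y /andP[].
rewrite le_eqVlt => /predU1P[<-//|xy].
rewrite le_eqVlt => /predU1P[->//|yz].
exact/regular_diffusion_sub/(open_itv_between Dx Dz).
Qed.

Lemma exists_below x : open_itv l r x -> exists2 y, open_itv l r y & y < x.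
Proof.
move=> [lx xr]; suff [y [ly yx]] : exists y : R, (l < y%:E)%E /\ y < x.
  exists y => //; split => //; apply: lt_trans xr.
  by rewrite lte_fin.
case: (l) lx => [l'| |] //; last by exists (x - 1); rewrite ltNyr; split => //; lra.
by rewrite lte_fin => lx; exists ((l' + x) / 2); rewrite lte_fin; split; lra.
Qed.

Lemma exists_above x : open_itv l r x -> exists2 y, open_itv l r y & x < y.
Proof.
move=> [lx xr]; suff [y [yr xy]] : exists y : R, (y%:E < r)%E /\ x < y.
  exists y => //; split => //; apply: (lt_trans lx).
  by rewrite lte_fin.
case: (r) xr => [r'| |] //; last by exists (x + 1); rewrite ltry; split => //; lra.
by rewrite lte_fin => lx'; exists ((r' + x) / 2); rewrite lte_fin; split; lra.
Qed.

Let mD := measurable_state_space.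
Let SM := regular_diffusion_markov.
Let cX : forall w, continuous_path (X ^~ w) := fun w => smf_continuous SM (w := w).

Lemma payoff_restrict (k : R -> R) tau w : (0 <= tau w)%E ->
  payoff X rho (k \_ D) tau w = payoff X rho k tau w.
Proof.
move=> t0; rewrite !payoffE patchE mem_set//; apply: (smf_state SM).
exact: fine_ge0.
Qed.

Lemma measurable_payoff_on (k : R -> R) tau : measurable_fun D k -> stopping_time X tau ->
  measurable_fun setT (fun w => (payoff X rho k tau w)%:E).
Proof.
move=> mk st.
rewrite (_ : (fun w => _) = fun w => (payoff X rho (k \_ D) tau w)%:E).
  by apply: (measurable_payoff SM) => //; apply/(measurable_restrictT _ mD).
by apply/funext => w; rewrite payoff_restrict//; case: st.
Qed.

Lemma hit_expectationE z y :
  path_expectation X P (hit_functional rho z) y =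
  expected_payoff X P rho (fun=> 1) y (hitting_time X z).
Proof.
rewrite /expected_payoff unlock; apply: eq_integral => w _.
by rewrite payoffE mul1r hitting_timeE.
Qed.

Lemma hit_expectation_psi z y : open_itv l r y -> open_itv l r z -> y <= z ->
  path_expectation X P (hit_functional rho z) y = (psi y / psi z)%:E.
Proof.
move=> ly lz; rewrite le_eqVlt => /predU1P[->|yz]; rewrite hit_expectationE.
  (* The formula for [psi] asks for a strict inequality; at [y = z] the one for [phi] applies and
     both ratios are 1. *)
  rewrite (fs_phi_hit FS)// !divff ?gt_eqF//.
    exact: (fs_psi_pos FS).
  exact: (fs_phi_pos FS).
exact: (fs_psi_hit FS).
Qed.

Lemma hit_expectation_phi z y : open_itv l r y -> open_itv l r z -> z <= y ->
  path_expectation X P (hit_functional rho z) y = (phi y / phi z)%:E.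
Proof. by move=> ly lz zy; rewrite hit_expectationE (fs_phi_hit FS). Qed.

Lemma stopping_time_threshold p : stopping_time X (threshold_time X p).
Proof.
rewrite (_ : threshold_time X p = fun w => first_after (deficit p) 0%E (X ^~ w)).
  apply: stopping_time_first_after => //; first exact: continuous_deficit.
  exact: stopping_time0.
by apply/funext => w; exact: threshold_timeE.
Qed.

Lemma threshold_time_below p w : X 0 w < p ->
  threshold_time X p w = hit_after p 0%E (X ^~ w).
Proof.
move=> Xp; rewrite threshold_timeE; apply/eqP; rewrite eq_le; apply/andP; split.
- have [->|[t [-> t0 _]]] := first_after_case 0%E (@continuous_dist_to _ p) (@cX w).
    exact: leey.
  rewrite dist_to_le0 => /eqP Xt; apply: first_after_le => //.
  by rewrite deficit_le0 Xt.
- have [->|[t [-> t0 _]]] := first_after_case 0%E (@continuous_deficit _ p) (@cX w).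
    exact: leey.
  rewrite deficit_le0 => Xt; apply: (@hit_after_ivt _ (X ^~ w)) => //.
  by rewrite ge_min le_max (ltW Xp) Xt orbT.
Qed.

Lemma threshold_time_above p w : p <= X 0 w -> threshold_time X p w = 0%E.
Proof.
move=> pX; rewrite threshold_timeE; apply/eqP.
rewrite eq_le first_after_ge0 andbT first_after_le//.
by rewrite deficit_le0.
Qed.

Lemma threshold_payoff_above x p : open_itv l r x -> p <= x ->
  expected_payoff X P rho g x (threshold_time X p) = (g x)%:E.
Proof.
move=> lx px; rewrite /expected_payoff unlock.
have -> : (g x)%:E = (\int[P x]_w (cst (g x)%:E w))%E.
  by rewrite integral_cst//; rewrite [X in (_ * X)%E]probability_setT mule1.
apply: ae_eq_integral => //.
- exact: measurable_payoff_on mg (stopping_time_threshold p).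
- apply: filterS (ae_start SM (regular_diffusion_sub lx)) => w Xw _ /=.
  by rewrite payoffE threshold_time_above ?Xw// edisc0 mulr1.
Qed.

Lemma threshold_payoff_below x p : open_itv l r x -> open_itv l r p -> x < p ->
  expected_payoff X P rho g x (threshold_time X p) = (g p / psi p * psi x)%:E.
Proof.
move=> lx lp xp; rewrite /expected_payoff unlock.
pose Tp w := hit_after p 0%E (X ^~ w).
have sTp : stopping_time X Tp by apply: (stopping_time_hit SM); exact: stopping_time0.
have mTp := measurable_edisc_at (rho := rho) SM sTp.
transitivity (\int[P x]_w ((g p)%:E * (edisc rho (Tp w))%:E))%E.
  apply: ae_eq_integral => //.
  - exact: measurable_payoff_on mg (stopping_time_threshold p).
  - exact: measurable_funeM.
  - apply: filterS (ae_start SM (regular_diffusion_sub lx)) => w Xw _ /=.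
    rewrite payoffE threshold_time_below ?Xw// -/(Tp w) -EFinM.
    have [fin|] := ltP (Tp w) +oo%E.
      by rewrite (@hit_after_at _ (X ^~ w) 0%E p (@cX w) fin).
    by rewrite leye_eq => /eqP -> /=; rewrite !mulr0.
have [E E0 EE] := edisc_integral_fin rho0 (P x) mTp (fun w => sTp.1 w).
rewrite integralZl//; last first.
  apply/integrableP; split => //.
  under eq_integral do rewrite gee0_abs ?lee_fin ?edisc_ge0//.
  by rewrite EE ltry.
have := hit_expectation_psi lx lp (ltW xp); rewrite /path_expectation /hit_functional -/Tp => ->.
by rewrite -EFinM mulrAC mulrA.
Qed.

(** The integral is the difference of those of the positive and the negative part, so dropping the
    latter gives an upper bound even in the undefined case, where the value is [-oo]. *)
Lemma expected_payoff_le_pos x tau : stopping_time X tau ->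
  (expected_payoff X P rho g x tau <=
   \int[P x]_w (payoff X rho ((fun y => Num.max (g y) 0%R) \_ D) tau w)%:E)%E.
Proof.
move=> st; rewrite /expected_payoff unlock integralE.
have -> : (\int[P x]_w (fun w => (payoff X rho g tau w)%:E)^\+ w =
    \int[P x]_w (payoff X rho ((fun y => Num.max (g y) 0%R) \_ D) tau w)%:E)%E.
  apply: eq_integral => w _; rewrite funeposE -EFin_max; congr (_%:E).
  rewrite payoff_restrict; last by case: st.
  by rewrite !payoffE maxr_pMl ?edisc_ge0// mul0r.
have n0 : (0 <= \int[P x]_w (fun w => (payoff X rho g tau w)%:E)^\- w)%E.
  by apply: integral_ge0 => w _; exact: funeneg_ge0.
apply: (@le_trans _ _ (\int[P x]_w
    (payoff X rho ((fun y => Num.max (g y) 0%R) \_ D) tau w)%:E - 0)%E).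
  exact: leeB.
by rewrite sube0.
Qed.

Local Notation pos := ((fun y => Num.max (g y) 0) \_ D).

Lemma measurable_pos : measurable_fun setT pos.
Proof.
by apply/(measurable_restrictT _ mD); apply: measurable_maxr.
Qed.

Lemma pos_ge0 y : 0 <= pos y.
Proof. by rewrite patchE; case: ifPn => // _; rewrite le_max lexx orbT. Qed.

Lemma posE y : D y -> 0 <= g y -> pos y = g y.
Proof. by move=> Dy gy; rewrite patchE mem_set// max_l. Qed.

Lemma pos_le y c : D y -> 0 <= c -> g y <= c -> pos y <= c.
Proof. by move=> Dy c0 gc; rewrite patchE mem_set// ge_max gc c0. Qed.

(* Under the law of the process started at [q > p], the process absorbed at
   [p] stays above [p], where [g] is nonnegative. *)
Lemma excessive_pos p q tau : excessive_on_restriction D l r X P rho p g ->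
  open_itv l r q -> p < q -> stopping_time X tau ->
  (\int[P q]_w (payoff X rho pos
     (fun w => Order.min (tau w) (hit_after p 0%E (X ^~ w))) w)%:E <= (pos q)%:E)%E.
Proof.
move=> [g0 exc] lq pq st.
have Dq := regular_diffusion_sub lq.
rewrite posE//; last by apply: g0 => //; exact: ltW.
pose Tp w := hit_after p 0%E (X ^~ w).
have sTp : stopping_time X Tp by apply: (stopping_time_hit SM); exact: stopping_time0.
have smin := stopping_time_min st sTp.
have := exc q tau lq pq st; rewrite /expected_payoff unlock.
rewrite (_ : (fun w => Order.min (tau w) (hitting_time X p w)) =
    fun w => Order.min (tau w) (Tp w)); last first.
  by apply/funext => w; rewrite hitting_timeE.
apply: le_trans; rewrite le_eqVlt; apply/orP; left; apply/eqP.
apply: ae_eq_integral => //.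
- by apply: (measurable_payoff SM) => //; exact: measurable_pos.
- exact: measurable_payoff_on mg smin.
apply: filterS (ae_start SM Dq) => w Xw _; congr (_%:E); rewrite !payoffE.
case E : (Order.min _ _) => [t| |] /=; rewrite ?mulr0//.
congr (_ * _); rewrite -/(Tp w) in E.
have t0 : 0 <= t by rewrite -lee_fin -E; case: smin.
apply: posE; first exact: (smf_state SM).
apply: g0; first exact: (smf_state SM).
rewrite leNgt; apply/negP => Xp.
have tTp : (t%:E <= Tp w)%E by rewrite -E ge_min lexx orbT.
(* A position below [p] at time [t <= Tp w] would force the passage to occur exactly at [t], when
   the path is at [p]. *)
have Tpt : (Tp w <= t%:E)%E.
  apply: (@hit_after_ivt _ (X ^~ w)) => //.
  by rewrite Xw ge_min le_max (ltW Xp) (ltW pq) orbT.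
have TE : Tp w = t%:E by apply/eqP; rewrite eq_le Tpt tTp.
have [_ _] := first_after_attained (@continuous_dist_to _ p) (@cX w) TE.
by rewrite dist_to_le0 => /eqP Xt; rewrite Xt ltxx in Xp.
Qed.

End threshold_payoffs.

Section threshold_optimality.
Context {R : realType} {d : measure_display} {T : measurableType d}.
Context {D : set R} {l r : \bar R} {a sigma : R -> R}.
Context {X : R -> T -> R} {P : R -> probability T R} {rho : R} {psi phi g : R -> R}.
Hypothesis RD : regular_diffusion D l r a sigma X P.
Hypothesis rho0 : 0 < rho.
Hypothesis FS : fundamental_solutions l r a sigma X P rho psi phi.
Hypothesis mg : measurable_fun D g.
Context {pstar : R}.
Hypothesis lp : open_itv l r pstar.
Hypothesis opt : forall x, open_itv l r x ->
  optimal X P rho g (threshold_times l r X) x (threshold_time X pstar).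

Lemma threshold_payoff_max x p : open_itv l r x -> open_itv l r p ->
  (expected_payoff X P rho g x (threshold_time X p) <=
   expected_payoff X P rho g x (threshold_time X pstar))%E.
Proof.
move=> lx lp'; have [_ ->] := opt lx.
apply: ereal_sup_ubound; exists (threshold_time X p) => //.
by exists p.
Qed.

(** Compare the two thresholds from a starting point below both: the payoffs are the ratios times
    the same positive factor [psi x]. *)
Lemma threshold_ratio_max p : open_itv l r p -> g p / psi p <= g pstar / psi pstar.
Proof.
move=> lp'.
have [x [lx xp xps]] : exists x, [/\ open_itv l r x, x < p & x < pstar].
  have [pp|pp] := leP p pstar.
    by have [x lx xp] := exists_below lp'; exists x; split => //; exact: lt_le_trans pp.
  by have [x lx xp] := exists_below lp; exists x; split => //; exact: lt_trans pp.
have := threshold_payoff_max lx lp'.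
rewrite !(threshold_payoff_below RD rho0 FS mg lx)// lee_fin ler_pM2r//.
exact: (fs_psi_pos FS).
Qed.

(** From [y >= pstar] the optimal threshold stops at once and earns [g y], while threshold [x] earns
    the left-hand side. So [g / psi] is nonincreasing to the right of [pstar]. *)
Lemma threshold_ratio_decr y x : open_itv l r y -> open_itv l r x ->
  pstar <= y -> y <= x -> g x / psi x * psi y <= g y.
Proof.
move=> ly lx py; rewrite le_eqVlt => /predU1P[->|yx].
  by rewrite divfK// gt_eqF// (fs_psi_pos FS).
have := threshold_payoff_max ly lx.
rewrite (threshold_payoff_below RD rho0 FS mg ly)//.
by rewrite (threshold_payoff_above RD mg ly).
Qed.

Lemma threshold_value_pos : (exists2 x0, open_itv l r x0 & 0 < g x0) -> 0 < g pstar.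
Proof.
move=> [x0 lx0 gx0]; have := threshold_ratio_max lx0.
have px0 := fs_psi_pos FS lx0; have pp := fs_psi_pos FS lp.
move=> /(lt_le_trans (divr_gt0 gx0 px0)).
by rewrite pmulr_lgt0// invr_gt0.
Qed.

End threshold_optimality.

(** * The crossing inequalities for an optimal threshold *)

Section crossings.
Context {R : realType} {d : measure_display} {T : measurableType d}.
Context {D : set R} {l r : \bar R} {a sigma : R -> R}.
Context {X : R -> T -> R} {P : R -> probability T R} {rho : R} {psi phi g : R -> R}.
Hypothesis RD : regular_diffusion D l r a sigma X P.
Hypothesis rho0 : 0 < rho.
Hypothesis FS : fundamental_solutions l r a sigma X P rho psi phi.
Hypothesis mg : measurable_fun D g.
Hypothesis left_end : left_end_condition D l r X P g.
Context {p : R}.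
Hypothesis lp : open_itv l r p.
Hypothesis opt : forall x, open_itv l r x ->
  optimal X P rho g (threshold_times l r X) x (threshold_time X p).
Hypothesis gp : 0 < g p.

Local Notation pos := ((fun y => Num.max (g y) 0) \_ D).
Local Notation C := (g p / psi p).

Let mD := measurable_state_space RD.
Let SM := regular_diffusion_markov RD.
Let cX : forall w, continuous_path (X ^~ w) := fun w => smf_continuous SM (w := w).
Let mX := smf_measurable SM.
Let OD := @regular_diffusion_sub _ _ _ _ _ _ _ _ _ _ RD.

Let psi0 y : open_itv l r y -> 0 < psi y. Proof. exact: (fs_psi_pos FS). Qed.
Let C0 : 0 < C. Proof. by rewrite divr_gt0// psi0. Qed.
Let mpos : measurable_fun setT pos := measurable_pos RD mg.
Let pos0 : forall y, 0 <= pos y := @pos_ge0 _ D g.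

Lemma ratio_bound y : open_itv l r y -> g y <= C * psi y.
Proof.
move=> ly; have := threshold_ratio_max RD rho0 FS mg lp opt ly.
by rewrite ler_pdivrMr ?psi0.
Qed.

Lemma pos_bound y : open_itv l r y -> pos y <= C * psi y.
Proof.
move=> ly; apply: pos_le; [exact: OD|by rewrite mulr_ge0// ltW// psi0|exact: ratio_bound].
Qed.

(** On []y, z[] the gain is at most [C * psi], hence at most [C * psi z] by monotonicity, and
    [left_end_condition] carries the bound to [y]. *)
Lemma left_end_bound y z : y%:E = l -> D y ->
  (exists2 x, open_itv l r x & (0 < P x [set w | hitting_time X y w < +oo])%E) ->
  open_itv l r z -> pos y <= C * psi z.
Proof.
move=> yl Dy reach lz; apply: pos_le => //; first by rewrite mulr_ge0// ltW// psi0.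
rewrite -lee_fin; apply: (le_trans (left_end yl Dy reach)).
have yz : y < z by move: lz => [+ _]; rewrite -yl lte_fin.
apply: ereal_inf_le; exists (ereal_sup ((EFin \o g) @` `]y, z[%classic)).
  exists `]y, z[%classic => //.
  apply: filterS2 (nbhs_right_gt y) (nbhs_right_lt yz) => v yv vz.
  by rewrite /= in_itv/= yv vz.
apply: ge_ereal_sup => _ [v /= + <-]; rewrite in_itv/= => /andP[yv vz].
have lv : open_itv l r v by exact: (open_itv_between RD Dy (OD lz)).
rewrite lee_fin; apply: (le_trans (ratio_bound lv)).
by rewrite ler_pM2l// ltW// (fs_psi_incr FS).
Qed.

(** At an interior point the right-hand side equals [C * psi y]. At the left end there is no such
    formula, and the bound is a limit along interior points [y_ n], which requires that the end be
    reached from [x]. *)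
Lemma stop_below_bound x z y : open_itv l r x -> open_itv l r z -> D y -> y < z ->
  (y%:E = l -> (0 < P x [set w | hitting_time X y w < +oo])%E) ->
  ((pos y)%:E <= (C * psi z)%:E * path_expectation X P (hit_functional rho z) y)%E.
Proof.
move=> lx lz Dy yz reach.
have eqn v : open_itv l r v -> v <= z ->
    ((C * psi z)%:E * path_expectation X P (hit_functional rho z) v = (C * psi v)%:E)%E.
  move=> lv vz; rewrite (hit_expectation_psi FS lv lz vz) -EFinM.
  by rewrite -(mulrA C (psi z)) [psi z * _]mulrCA divff ?mulr1// gt_eqF ?psi0.
have [ly|] := eqVneq (y%:E) l; last first.
  move=> ly.
  have ly' : open_itv l r y.
    have [ly1 _] := regular_diffusion_ends RD Dy.
    split; first by rewrite lt_neqAle eq_sym ly ly1.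
    by case: lz => _; apply: lt_trans; rewrite lte_fin.
  by rewrite eqn//; [rewrite lee_fin pos_bound|exact: ltW].
have rx := reach ly.
have yx : y < x by case: lx => + _; rewrite -ly lte_fin.
(* The points must lie below [x], to be met on the way to the left end, and below [z], for the
   formula in terms of [psi]. *)
pose m := Num.min x z.
have ym : y < m by rewrite lt_min yx yz.
have my0 : 0 < m - y by rewrite subr_gt0.
pose y_ n := y + (m - y) / n.+2%:R.
have y_gt n : y < y_ n by rewrite ltrDl divr_gt0.
have y_lt n : y_ n < m.
  by rewrite /y_ -ltrBrDl ltr_pdivrMr// ltr_pMr// ltr1n.
have y_open n : open_itv l r (y_ n).
  apply: (open_itv_between RD Dy (OD lx) (y_gt n)).
  by apply: lt_le_trans (y_lt n) _; rewrite ge_min lexx.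
apply: (hit_expectation_limit (x0 := x) (y_ := y_) mD SM rho0) => //.
- exact: OD.
- by rewrite mulr_ge0 ?ltW ?psi0.
- move=> n; rewrite (ltW (y_gt n))/= (le_trans (ltW (y_lt n)))//.
  by rewrite ge_min lexx.
- move=> n k nk; rewrite lerD2l ler_pM2l// lef_pV2 ?posrE//.
  by rewrite ler_nat !ltnS.
- rewrite -[X in _ --> X]addr0; apply: cvgD; first exact: cvg_cst.
  rewrite -[X in _ --> X](mulr0 (m - y)%R); apply: cvgMl_tmp.
  by have := @cvg_harmonic R; rewrite -(cvg_shiftS (@harmonic R : nat -> R^o)).
- move=> n; rewrite eqn//; last first.
    by rewrite (le_trans (ltW (y_lt n)))// ge_min lexx orbT.
  rewrite lee_fin; apply: left_end_bound => //; by exists x.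
- move: rx; congr (0 < P x _)%E; apply/seteqP; split => w /=; by rewrite hitting_timeE.
Qed.

Lemma crossing_up_inequality x y z tau s : open_itv l r x -> open_itv l r y ->
  open_itv l r z -> y <= z -> stopping_time X tau -> stopping_time X s ->
  {ae P x, forall w, (s w < +oo)%E -> X (fine (s w)) w = y} ->
  crossing_inequality (P := P) (X := X) (rho := rho) x pos tau s
    (fun w => hit_after z (s w) (X ^~ w)) (C * psi y) (C * psi z).
Proof.
move=> lx ly lz yz tt ss Xy.
have Dx := OD lx.
apply: (crossing_up mD SM Dx (y := y)) => //.
- by rewrite mulr_ge0// ltW// psi0.
- by rewrite mulr_ge0// ltW// psi0.
- have reach : {ae P x, forall w v, v%:E = l ->
      (hit_after v 0 (X ^~ w) < +oo)%E ->
      (0 < P x [set w | hitting_time X v w < +oo])%E}.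
    have [[v vl]|nol] := pselect (exists v : R, v%:E = l); last first.
      by apply: aeW => w v vl; case: nol; exists v.
    have [Pv|Pv] := ltP 0%E (P x [set w | hitting_time X v w < +oo]%E).
      by apply: aeW => w v'; rewrite -vl => -[->].
    (* If the left end is reached with probability 0, the paths that reach it form the exceptional
       null set. *)
    exists [set w | hitting_time X v w < +oo]%E; split.
    + rewrite (_ : mkset _ = [set w | hit_after v 0 (X ^~ w) < +oo]%E).
        rewrite -[Z in measurable Z]setTI; apply: emeasurable_fun_infty_o => //.
        apply: (stopping_time_measurable mX); apply: (stopping_time_hit SM).
        exact: stopping_time0.
      by apply/funext => w; rewrite /mkset hitting_timeE.
    + by apply/eqP; rewrite eq_le Pv measure_ge0.
    + move=> w /= nw; rewrite hitting_timeE; apply: contrapT => fin.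
      by apply: nw => v'; rewrite -vl => -[->] /fin.
  apply: filterS2 Xy reach => w Xw rw s_t t_s.
  have t0 := tt.1 w.
  have [t tE] : exists t, tau w = t%:E.
    by move: t0 t_s; case: (tau w) => [t| |]// _; [exists t|rewrite ltNge leey].
  have s0 := ss.1 w.
  have [u uE] : exists u, s w = u%:E.
    by move: s0 s_t; rewrite tE; case: (s w) => [u| |]// _; exists u.
  move: t_s s_t s0 t0; rewrite tE uE !lee_fin => t_s ut u0 t0.
  have Xu : X u w = y by have := Xw; rewrite uE ltry => /(_ isT).
  (* A position at or above [z] would require a passage at [z] between [u] and [t]. *)
  have Xt : X t w < z.
    rewrite ltNge; apply/negP => zX.
    have : (hit_after z u%:E (X ^~ w) <= t%:E)%E.
      apply: (@hit_after_ivt _ (X ^~ w)) => //.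
      by rewrite Xu ge_min le_max yz zX orbT.
    by rewrite leNgt t_s.
  have DX : D (X t w) by exact: (smf_state SM).
  apply: (stop_below_bound lx lz DX Xt) => Xl; apply: (rw _ Xl).
  apply: (@le_lt_trans _ _ t%:E); last exact: ltry.
  by apply: first_after_le => //; rewrite dist_to_le0.
- rewrite (hit_expectation_psi FS ly lz yz) -EFinM; congr (_%:E).
  by rewrite -(mulrA C (psi z)) [psi z * _]mulrCA divff ?mulr1// gt_eqF ?psi0.
Qed.

Hypothesis exc : excessive_on_restriction D l r X P rho p g.

Let excpos q tau := @excessive_pos _ _ _ _ _ _ _ _ _ _ _ _ RD mg p q tau exc.

Let posg y : D y -> p <= y -> pos y = g y.
Proof. by move=> Dy py; apply: posE => //; apply: exc.1. Qed.

(* Excessivity with [tau] the hitting time of a lower point. *)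
Lemma ratio_phi_incr y x : open_itv l r y -> open_itv l r x -> p < y -> y <= x ->
  pos y * (phi x / phi y) <= pos x.
Proof.
move=> ly lx py yx; have px : p < x by exact: lt_le_trans yx.
pose Ty w := hit_after y 0%E (X ^~ w).
have sTy : stopping_time X Ty by apply: (stopping_time_hit SM); exact: stopping_time0.
have := excpos lx px sTy; rewrite -lee_fin; apply: le_trans.
rewrite EFinM -(hit_expectation_phi FS lx ly yx) /path_expectation -ge0_integralZl//; first last.
- by rewrite lee_fin.
- by move=> w _; rewrite lee_fin edisc_ge0.
- exact: (measurable_edisc_at SM sTy).
apply: ae_ge0_le_integral => //.
- by move=> w _; rewrite mule_ge0// lee_fin// edisc_ge0.
- apply: measurable_funeM; exact: (measurable_edisc_at SM sTy).
- by move=> w _; rewrite lee_fin payoff_ge0.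
- apply: (measurable_payoff SM mpos); apply: stopping_time_min => //.
  by apply: (stopping_time_hit SM); exact: stopping_time0.
apply: filterS (ae_start SM (OD lx)) => w Xw _.
rewrite payoffE min_l; last first.
  by apply: hit_after_between => //; rewrite Xw ge_min le_max (ltW py) yx orbT.
rewrite /hit_functional -EFinM lee_fin -/(Ty w).
have [fin|] := ltP (Ty w) +oo%E.
  by rewrite (@hit_after_at _ (X ^~ w) 0%E y (@cX w) fin).
by rewrite leye_eq => /eqP -> /=; rewrite !mulr0.
Qed.

Let ode_continuous (u k : R -> R) y : solves_ae l r a sigma u k -> open_itv l r y ->
  {for y, continuous u}.
Proof.
move=> [du _ _] ly; apply: differentiable_continuous.
exact/derivable1_diffP/du.
Qed.

(** The two sides have different causes. To the right of [y], excessivity bounds the gain below by a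
    multiple of [phi]; to the left, optimality among thresholds bounds it below by a multiple of
    [psi]. Both bounds are continuous and equal [pos y] at [y]. *)
Lemma pos_lsc_interior y : open_itv l r y -> p < y ->
  forall e, 0 < e -> exists2 eta, 0 < eta &
    forall y', D y' -> `|y' - y| < eta -> pos y - e <= pos y'.
Proof.
move=> ly py e e0.
have [z lz yz] := exists_above ly.
have c1 : (fun v => pos y * (psi v / psi y)) v @[v --> y] --> pos y * (psi y / psi y).
  apply: cvgMl_tmp; apply: cvgMr_tmp.
  exact: (ode_continuous (fs_psi_ode FS)).
have c2 : (fun v => pos y * (phi v / phi y)) v @[v --> y] --> pos y * (phi y / phi y).
  apply: cvgMl_tmp; apply: cvgMr_tmp.
  exact: (ode_continuous (fs_phi_ode FS)).
rewrite divff ?gt_eqF ?psi0// mulr1 in c1.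
rewrite divff ?gt_eqF ?(fs_phi_pos FS)// mulr1 in c2.
have /cvgrPdist_lt /(_ _ e0) /nbhs_ballP[d1 /= d10 H1] := c1.
have /cvgrPdist_lt /(_ _ e0) /nbhs_ballP[d2 /= d20 H2] := c2.
exists (Num.min (Num.min d1 d2) (Num.min (y - p) (z - y))).
  by rewrite !lt_min d10 d20 !subr_gt0 py yz.
move=> y' Dy'; rewrite !lt_min => /andP[/andP[yd1 yd2] /andP[yp yz']].
have py' : p < y' by move: yp; rewrite ltr_norml => /andP[+ _]; lra.
have y'z : y' < z by move: yz'; rewrite ltr_norml => /andP[_]; lra.
have ly' : open_itv l r y' by exact: (open_itv_between RD (OD lp) (OD lz)).
have [yy'|yy'] := leP y y'.
- apply: le_trans (ratio_phi_incr ly ly' py yy').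
  have := H2 y'; rewrite /ball/= distrC => /(_ yd2).
  rewrite ltr_norml => /andP[_]; rewrite ltrBlDl => h.
  by rewrite lerBlDr ltW.
- have := threshold_ratio_decr RD rho0 FS mg opt ly' ly (ltW py') (ltW yy').
  rewrite (posg Dy' (ltW py')); apply: le_trans.
  have := H1 y'; rewrite /ball/= distrC => /(_ yd1).
  have -> : g y / psi y * psi y' = pos y * (psi y' / psi y).
    by rewrite (posg (OD ly) (ltW py)) mulrAC -mulrA.
  rewrite ltr_norml => /andP[_]; rewrite ltrBlDl => h.
  by rewrite lerBlDr ltW.
Qed.

Lemma crossing_down_inequality x q tau s : open_itv l r x -> open_itv l r q ->
  p < q -> stopping_time X tau -> stopping_time X s ->
  {ae P x, forall w, (s w < +oo)%E -> X (fine (s w)) w = q} ->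
  crossing_inequality (P := P) (X := X) (rho := rho) x pos tau s
    (fun w => hit_after p (s w) (X ^~ w)) (pos q) (pos p).
Proof.
move=> lx lq pq tt ss Xq.
have Dx := OD lx; have Dq := OD lq.
apply: (crossing_down mD SM rho0 mpos pos0 Dx Dq _ tt ss) => //.
- by rewrite gt_eqF.
- by move=> tau'; exact: excpos.
pose E z y v := path_expectation X P (reach_functional rho z y) v.
(* If the right end cannot be reached from [q] before [p], the strong Markov property at [s] makes
   the expected discount of doing so vanish, and almost no path does it. *)
have reach : {ae P x, forall w, forall z, z%:E = r ->
    (hit_after z (s w) (X ^~ w) < hit_after p (s w) (X ^~ w))%E -> E z p q != 0%E}.
  have [[z zr]|nor] := pselect (exists z : R, z%:E = r); last first.
    by apply: aeW => w z zr; case: nor; exists z.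
  have [E0|En0] := eqVneq (E z p q) 0%E; last first.
    by apply: aeW => w z'; rewrite -zr => -[->].
  have sT : stopped_sigma_algebra X s setT := sigma_algebraT (stopped_sa ss).
  have pr := path_functional_reach rho z p.
  have sh v : stopping_time X (fun w => hit_after v (s w) (X ^~ w)).
    exact: (stopping_time_hit SM).
  have mif : measurable_fun setT (fun w =>
      if (hit_after z (s w) (X ^~ w) < hit_after p (s w) (X ^~ w))%E
      then (edisc rho (hit_after z (s w) (X ^~ w)))%:E else 0%E).
    apply: measurable_fun_ifT => //; last exact: (measurable_edisc_at SM (sh z)).
    apply: (@measurable_fun_lte _ T R setT); exact: (stopping_time_measurable mX (sh _)).
  have I0 := strong_markov_reach (rho := rho) mD SM z p Dx ss sT.
  rewrite [RHS](_ : _ = 0%E) in I0; last first.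
    transitivity (\int[P x]_w (cst 0%E w : \bar R))%E; last by rewrite integral0.
    apply: ge0_ae_eq_integral => //.
    - apply: emeasurable_funM; first exact: (measurable_edisc_at SM ss).
      exact: (measurable_functional_at mD SM pr ss).
    - move=> w _; rewrite mule_ge0 ?lee_fin ?edisc_ge0//.
      by apply: path_expectation_ge0; case: pr.
    - apply: filterS Xq => w Xw _ /=; case Es : (s w) => [u| |] /=; last 2 first.
      + by rewrite mul0e.
      + by rewrite mul0e.
      by move: Xw; rewrite Es ltry => /(_ isT) /= ->; move: E0; rewrite /E => ->; rewrite mule0.
  have : ae_eq (P x) setT (fun w =>
      if (hit_after z (s w) (X ^~ w) < hit_after p (s w) (X ^~ w))%E
      then (edisc rho (hit_after z (s w) (X ^~ w)))%:E else 0%E) (cst 0%E).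
    apply/(ae_eq_integral_abs _ measurableT mif); rewrite -[RHS]I0.
    apply: eq_integral => w _; rewrite gee0_abs//.
    by case: ifPn => // _; rewrite lee_fin edisc_ge0.
  apply: filterS => w /(_ I) /= + z' zr'; move: zr'; rewrite -zr => -[->] + lt.
  rewrite lt; have : (hit_after z (s w) (X ^~ w) < +oo)%E by exact: lt_le_trans lt (leey _).
  have := first_after_ge0 (dist_to z) (s w) (X ^~ w).
  case: (hit_after z _ _) => [v| |] // _ _ [] /eqP.
  by rewrite gt_eqF// expR_gt0.
apply: filterS2 Xq reach => w Xw rw fin t s_t t_s e e0.
have s0 := ss.1 w.
have [u uE] : exists u, s w = u%:E.
  by move: s0 fin; case: (s w) => [u| |]// _ _; exists u.
move: s_t; rewrite uE lee_fin => ut.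
have u0 : 0 <= u by rewrite -lee_fin -uE.
have t0 : 0 <= t by exact: le_trans ut.
have Xu : X u w = q by have := Xw fin; rewrite uE.
have pX : p < X t w.
  rewrite ltNge; apply/negP => Xp.
  have : (hit_after p u%:E (X ^~ w) <= t%:E)%E.
    apply: (@hit_after_ivt _ (X ^~ w)) => //.
    by rewrite Xu ge_min le_max (ltW pq) Xp !orbT.
  by rewrite leNgt -uE t_s.
have DX : D (X t w) by exact: (smf_state SM).
set v := X t w in pX DX *.
have [eta eta0 Heta] : exists2 eta, 0 < eta &
    forall y', D y' -> `|y' - v| < eta -> pos v - e <= pos y'.
  have [vr|vr] := eqVneq (v%:E) r; last first.
    apply: pos_lsc_interior => //; split.
      by case: lp => + _ => /lt_trans; apply; rewrite lte_fin.
    by rewrite lt_neqAle vr; have [] := regular_diffusion_ends RD DX.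
  have [c0|c0] := ltP (pos v - e) 0.
    by exists 1 => // y' _ _; rewrite (le_trans (ltW c0)).
  have qv : q < v by case: lq => _; rewrite -vr lte_fin.
  have pv : p != v by rewrite lt_eqF.
  have rv : E v p q != 0%E.
    apply: (rw v vr); apply: le_lt_trans t_s; rewrite uE.
    by apply: first_after_le => //; rewrite dist_to_le0.
  have cv : pos v - e < pos v by rewrite gtrBl.
  (* Excessivity applied to the hitting time of the right end [v], for starting points below it. *)
  have fy y : q < y < v -> ((pos v)%:E * E v p y <= (pos y)%:E)%E.
    move=> /andP[qy yv].
    have ly : open_itv l r y by exact: (open_itv_between RD Dq DX).
    have py : p < y by exact: lt_trans qy.
    pose Tv w := hit_after v 0%E (X ^~ w); pose Tp w := hit_after p 0%E (X ^~ w).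
    have sTv : stopping_time X Tv by apply: (stopping_time_hit SM); exact: stopping_time0.
    have sTp : stopping_time X Tp by apply: (stopping_time_hit SM); exact: stopping_time0.
    apply: le_trans (excpos ly py sTv).
    rewrite /path_expectation -ge0_integralZl//; first last.
    + by rewrite lee_fin.
    + by move=> w' _; case: (path_functional_reach rho v p).
    + exact: (path_functional_measurable SM (path_functional_reach rho v p)).
    apply: ge0_le_integral => //.
    + move=> w' _; rewrite mule_ge0 ?lee_fin//.
      by case: (path_functional_reach rho v p).
    + apply: measurable_funeM.
      exact: (path_functional_measurable SM (path_functional_reach rho v p)).
    + by apply: (measurable_payoff SM mpos); exact: stopping_time_min.
    move=> w' _; rewrite /reach_functional; case: ifPn => [lt|_]; last first.
      by rewrite mule0 lee_fin payoff_ge0.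
    rewrite /hit_functional -EFinM lee_fin payoffE min_l; last exact: ltW.
    have fin' : (Tv w' < +oo)%E by exact: lt_le_trans lt (leey _).
    by rewrite (@hit_after_at _ (X ^~ w') 0%E v (@cX w') fin').
  have [eta eta0 H] := reach_expectation_limit mD SM rho0 Dq qv pv c0 (pos0 v) fy rv cv.
  exists eta => // y' Dy' yv.
  have y'v : y' <= v by rewrite -lee_fin vr; have [] := regular_diffusion_ends RD Dy'.
  move: y'v; rewrite le_eqVlt => /predU1P[->|y'v]; first by rewrite gerBl ltW.
  by apply: H; move: yv; rewrite y'v ltr_norml andbT => /andP[+ _]; lra.
have [delta d0 Hd] := continuous_pathP (@cX w) t0 eta0.
exists delta => // t' /andP[tt' t'd].
have t'0 : 0 <= t' by exact: le_trans tt'.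
apply: Heta; first exact: (smf_state SM).
by apply: Hd => //; rewrite ger0_norm ?subr_ge0// ltrBlDl.
Qed.

End crossings.

(** * Chaining the crossings *)

Section chaining.
Context {R : realType} {d : measure_display} {T : measurableType d}.
Context {D : set R} {X : R -> T -> R} {P : R -> probability T R} {rho : R}.
Hypothesis SM : strong_markov_family D X P.
Context {f : R -> R}.
Hypothesis mf : measurable_fun setT f.
Hypothesis f0 : forall y, 0 <= f y.
Local Open Scope ereal_scope.

Let cX : forall w, continuous_path (X ^~ w) := fun w => smf_continuous SM (w := w).

(* [V] bounds the gain from stopping before [s] or continuing at [s] with the
   value [c]. *)
Definition gain_bound x tau s (c : R) (V : \bar R) :=
  \int[P x]_(w in [set w | tau w < s w]) (payoff X rho f tau w)%:E +
  c%:E * \int[P x]_(w in [set w | s w <= tau w]) (edisc rho (s w))%:E <= V.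

(** The telescoping step: stopping before [s'] means stopping before [s] or in between, and the
    crossing inequality exchanges the continuation at [s] for the latter and the continuation at
    [s']. *)
Lemma gain_bound_crossing x tau s s' c c' V :
  stopping_time X tau -> stopping_time X s -> stopping_time X s' ->
  (forall w, s w <= s' w) -> gain_bound x tau s c V ->
  crossing_inequality (P := P) (X := X) (rho := rho) x f tau s s' c c' ->
  gain_bound x tau s' c' V.
Proof.
move=> tt st st' ss' gb ci; apply: le_trans gb.
have m1 : measurable [set w | tau w < s w] := measurable_lt_times SM st tt.
have m2 : measurable [set w | tau w < s' w] := measurable_lt_times SM st' tt.
have m3 : measurable [set w | s w <= tau w] := measurable_le_times SM st tt.
rewrite (_ : [set w | tau w < s' w] =
  [set w | tau w < s w] `|` ([set w | s w <= tau w] `&` [set w | tau w < s' w])).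
  rewrite ge0_integral_setU//.
  - by rewrite -addeA leeD2l.
  - exact: measurableI.
  - apply: measurable_funTS; exact: (measurable_payoff SM mf tt).
  - by move=> w _; rewrite lee_fin payoff_ge0.
  - by apply/disj_setPS => w [/= h1 [/= h2 _]]; have := lt_le_trans h1 h2; rewrite ltxx.
apply/seteqP; split => w /=.
  by move=> lt; have [h|h] := leP (s w) (tau w); [right|left].
by move=> [lt|[]//]; exact: lt_le_trans (ss' w).
Qed.

Lemma crossing_inequalityW x tau s s' c1 c2 c' : (c1 <= c2)%R ->
  crossing_inequality (P := P) (X := X) (rho := rho) x f tau s s' c1 c' ->
  crossing_inequality (P := P) (X := X) (rho := rho) x f tau s s' c2 c'.
Proof.
move=> c12 /le_trans; apply; rewrite lee_wpmul2r ?lee_fin//.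
by apply: integral_ge0 => w _; rewrite lee_fin edisc_ge0.
Qed.

Variables p q : R.
Hypothesis pq : p != q.

Fixpoint crossing_time n w : \bar R :=
  if n is n'.+1 then
    hit_after p (hit_after q (crossing_time n' w) (X ^~ w)) (X ^~ w)
  else hit_after p 0 (X ^~ w).

Lemma stopping_time_crossing n : stopping_time X (crossing_time n).
Proof.
elim: n => [|n IH] /=; apply: (stopping_time_hit SM); first exact: stopping_time0.
exact: (stopping_time_hit SM).
Qed.

(* Otherwise the path would oscillate between [p] and [q] in finite time. *)
Lemma crossing_time_unbounded w t : exists n, t%:E < crossing_time n w.
Proof.
apply: contrapT => /forallNP no.
have Rt n : crossing_time n w <= t%:E by rewrite leNgt; apply/negP; exact: no.
pose r_ n := fine (crossing_time n w).
have rE n : crossing_time n w = (r_ n)%:E.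
  rewrite /r_; have := Rt n; have := (stopping_time_crossing n).1 w.
  by case: (crossing_time n w).
pose s_ n := fine (hit_after q (crossing_time n w) (X ^~ w)).
have le_s n : hit_after q (crossing_time n w) (X ^~ w) <= crossing_time n.+1 w.
  exact: first_after_ge.
have sE n : hit_after q (crossing_time n w) (X ^~ w) = (s_ n)%:E.
  rewrite /s_; have := le_trans (le_s n) (Rt n.+1).
  have := first_after_ge0 (dist_to q) (crossing_time n w) (X ^~ w).
  by case: (hit_after q _ _).
have rs n : (r_ n <= s_ n)%R by rewrite -lee_fin -rE -sE first_after_ge.
have sr n : (s_ n <= r_ n.+1)%R by rewrite -lee_fin -rE -sE le_s.
have r0 n : (0 <= r_ n)%R by rewrite -lee_fin -rE (stopping_time_crossing n).1.
have s0 n : (0 <= s_ n)%R by exact: le_trans (rs n).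
have Xr n : X (r_ n) w = p.
  have : crossing_time n w < +oo by rewrite rE ltry.
  by case: n {sE le_s} => [|n] fin; exact: (hit_after_at (@cX w) fin).
have Xs n : X (s_ n) w = q.
  by apply: (hit_after_at (@cX w)); rewrite sE ltry.
have cr : cvgn r_.
  apply: nondecreasing_is_cvgn.
    by apply/nondecreasing_seqP => n; exact: le_trans (sr n).
  by exists t => _ [n _ <-]; rewrite -lee_fin -rE.
have cr1 : r_ n.+1 @[n --> \oo] --> limn r_.
  by rewrite (cvg_shiftS (r_ : nat -> R^o)).
have cs : s_ n @[n --> \oo] --> limn r_.
  apply: (squeeze_cvgr _ cr cr1).
  by apply: nearW => n; rewrite rs sr.
have lp := continuous_path_lim (@cX w) r0 cr.
have lq := continuous_path_lim (@cX w) s0 cs.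
have pE : p = X (limn r_) w.
  apply: (cvg_unique _ _ lp) => //.
  by rewrite (_ : (fun n => _) = cst p); [exact: cvg_cst|apply/funext].
have qE : q = X (limn r_) w.
  apply: (cvg_unique _ _ lq) => //.
  by rewrite (_ : (fun n => _) = cst q); [exact: cvg_cst|apply/funext].
by move: pq; rewrite pE qE eqxx.
Qed.

Lemma crossing_time_le n w : crossing_time n w <= crossing_time n.+1 w.
Proof.
by apply: (@le_trans _ _ (hit_after q (crossing_time n w) (X ^~ w)));
  exact: first_after_ge.
Qed.

(** The continuation term is nonnegative and is dropped. The payoffs restricted to
    [tau < crossing_time n] converge to the whole payoff, as any finite [tau] is eventually
    exceeded, so Fatou's lemma applies. *)
Lemma gain_limit x tau (c : R) V : (0 <= c)%R -> stopping_time X tau ->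
  (forall n, gain_bound x tau (crossing_time n) c V) ->
  \int[P x]_w (payoff X rho f tau w)%:E <= V.
Proof.
move=> c0 tt gb.
pose h n w := if tau w < crossing_time n w then (payoff X rho f tau w)%:E else 0.
have mpay := measurable_payoff (rho := rho) SM mf tt.
have mh n : measurable_fun setT (h n).
  apply: measurable_fun_ifT => //.
  apply: (@measurable_fun_lte _ T R setT).
    exact: (stopping_time_measurable (smf_measurable SM) tt).
  exact: (stopping_time_measurable (smf_measurable SM) (stopping_time_crossing n)).
have h0 n w : 0 <= h n w by rewrite /h; case: ifPn => // _; rewrite lee_fin payoff_ge0.
have hV n : \int[P x]_w h n w <= V.
  rewrite (@integral_vanish _ _ _ _ [set w | tau w < crossing_time n w]); last first.
    by move=> w _ /negP/negbTE nlt; rewrite /h nlt.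
  rewrite setTI; apply: le_trans (gb n).
  rewrite -[leLHS]adde0; apply: leeD.
    rewrite le_eqVlt; apply/orP; left; apply/eqP; apply: eq_integral => w.
    by rewrite inE /h /= => ->.
  apply: mule_ge0; rewrite ?lee_fin//.
  by apply: integral_ge0 => w _; rewrite lee_fin edisc_ge0.
apply: (@le_trans _ _ (\int[P x]_w limn_einf (h ^~ w))).
  apply: ge0_le_integral => //.
  - by move=> w _; rewrite lee_fin payoff_ge0.
  - under eq_fun do rewrite limn_einf_lim.
    apply: (emeasurable_fun_cvg (fun n w => einfs (h ^~ w) n)).
      by move=> n; exact: measurable_fun_einfs.
    by move=> w _; exact: is_cvg_einfs.
  move=> w _; apply: limn_einf_ge => e e0.
  have [[t tE]|not] := pselect (exists t, tau w = t%:E); last first.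
    exists 0%N => n _; apply: le_trans (h0 n w).
    rewrite payoffE; case E : (tau w) not => [t| |] not /=.
    - by case: not; exists t.
    - by rewrite mulr0 sub0r lee_fin oppr_le0 ltW.
    - by rewrite mulr0 sub0r lee_fin oppr_le0 ltW.
  have [N tN] := crossing_time_unbounded w t; exists N => n Nn.
  rewrite /h ifT; first by rewrite lee_fin gerBl ltW.
  rewrite tE; apply: (lt_le_trans tN).
  elim: n Nn => [|n IH]; first by rewrite leqn0 => /eqP ->.
  rewrite leq_eqVlt => /predU1P[->//|]; rewrite ltnS => /IH h'.
  exact: (le_trans h' (crossing_time_le n w)).
apply: (le_trans (fatou (P x) measurableT mh (fun n w _ => h0 n w))).
rewrite limn_einf_lim (cvg_lim _ (@cvg_einfs_sup _ _))//.
apply: ge_ereal_sup => _ [n _ <-]; apply: le_trans (hV n).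
by apply: ereal_inf_lbound; exists n => /=.
Qed.

End chaining.

(** * The value over all stopping times *)

Section optimal_value.
Context {R : realType} {d : measure_display} {T : measurableType d}.
Context {D : set R} {l r : \bar R} {a sigma : R -> R}.
Context {X : R -> T -> R} {P : R -> probability T R} {rho : R} {psi phi g : R -> R}.
Hypothesis RD : regular_diffusion D l r a sigma X P.
Hypothesis rho0 : 0 < rho.
Hypothesis FS : fundamental_solutions l r a sigma X P rho psi phi.
Hypothesis mg : measurable_fun D g.
Hypothesis left_end : left_end_condition D l r X P g.
Context {p : R}.
Hypothesis lp : open_itv l r p.
Hypothesis opt : forall x, open_itv l r x ->
  optimal X P rho g (threshold_times l r X) x (threshold_time X p).
Hypothesis gp : 0 < g p.

Local Notation pos := ((fun y => Num.max (g y) 0) \_ D).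

Let SM := regular_diffusion_markov RD.
Let OD := @regular_diffusion_sub _ _ _ _ _ _ _ _ _ _ RD.

Lemma value_bound x tau : excessive_on_restriction D l r X P rho p g ->
  open_itv l r x -> stopping_time X tau ->
  (expected_payoff X P rho g x tau <=
   (if x < p then g p / psi p * psi x else g x)%:E)%E.
Proof.
move=> exc lx tt; apply: (le_trans (expected_payoff_le_pos RD x tt)).
have [q lq pq] := exists_above lp.
have mf := measurable_pos RD mg; have f0 := @pos_ge0 _ D g.
have posp : pos p = g p / psi p * psi p.
  by rewrite (posE (OD lp) (ltW gp)) divfK// gt_eqF// (fs_psi_pos FS).
have up := crossing_up_inequality RD rho0 FS mg left_end lp opt gp lx.
have down := crossing_down_inequality RD rho0 FS mg lp opt exc lx.
have st0 : stopping_time X (fun=> 0%E) := stopping_time0.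
have X0 y : x = y -> {ae P x, forall w, (0 < +oo :> \bar R)%E -> X (fine 0%E) w = y}.
  by move=> <-; apply: filterS (ae_start SM (OD lx)) => w Xw _ /=.
(* The gain bound at time 0 is trivial: nothing is earned before 0 and the discount there is 1. One
   crossing inequality from time 0 thus starts the chain. *)
have init c : crossing_inequality (P := P) (X := X) (rho := rho) x
      pos tau (fun=> 0%E)
      (fun w => hit_after p 0%E (X ^~ w)) c (g p / psi p * psi p) ->
    gain_bound (P := P) (X := X) (rho := rho) (f := pos) x tau
      (fun w => hit_after p 0%E (X ^~ w)) (g p / psi p * psi p) c%:E.
  move=> ci; apply: (gain_bound_crossing SM mf f0 tt st0 _ _ _ ci).
  - by apply: (stopping_time_hit SM).
  - by move=> w; exact: first_after_ge0.
  - rewrite /gain_bound (_ : [set w | (tau w < 0)%E] = set0); last first.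
      by apply/seteqP; split => w //=; rewrite ltNge tt.1.
    rewrite integral_set0 add0e (_ : [set w | (0 <= tau w)%E] = setT); last first.
      by apply/seteqP; split => w //= _; rewrite tt.1.
    under eq_integral do rewrite edisc0.
    by rewrite integral_cst//; rewrite [X in (_ * (_ * X))%E]probability_setT !mule1.
have base : gain_bound (P := P) (X := X) (rho := rho) (f := pos)
    x tau (fun w => hit_after p 0%E (X ^~ w)) (g p / psi p * psi p)
    (if x < p then g p / psi p * psi x else g x)%:E.
  (* The stretch before the first passage at [p] is of the upward type when [x <= p], with constant
     [C * psi x], and of the downward type when [x > p], with constant [g x]. *)
  have [xp|px] := leP x p; last rewrite ltNge (ltW px)/=.
    have -> : (if x < p then g p / psi p * psi x else g x) = g p / psi p * psi x.
      case: ifPn => //; rewrite -leNgt => px.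
      have -> : x = p by apply/eqP; rewrite eq_le xp px.
      by rewrite divfK// gt_eqF// (fs_psi_pos FS).
    by apply: init; apply: up => //; exact: X0.
  rewrite -(posE (OD lx) (exc.1 _ (OD lx) (ltW px))).
  by apply: init; rewrite -posp; apply: down => //; exact: X0.
apply: (@gain_limit _ _ _ _ _ _ _ SM _ mf f0 p q _ x tau (g p / psi p * psi p)) => //.
- by rewrite lt_eqF.
- by rewrite -posp f0.
elim=> [|n IH]; first exact: base.
pose Rn := crossing_time (X := X) p q n.
have sR : stopping_time X Rn := stopping_time_crossing SM p q n.
pose Sn w := hit_after q (Rn w) (X ^~ w).
have sS : stopping_time X Sn by exact: (stopping_time_hit SM).
have hitX z s : {ae P x, forall w, (hit_after z (s w) (X ^~ w) < +oo)%E ->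
    X (fine (hit_after z (s w) (X ^~ w))) w = z}.
  by apply: aeW => w; apply: hit_after_at; exact: (smf_continuous SM).
have XR : {ae P x, forall w, (Rn w < +oo)%E -> X (fine (Rn w)) w = p}.
  by rewrite /Rn; case: (n) => [|m]; exact: hitX.
apply: (gain_bound_crossing SM mf f0 tt sS _ _ _ (c := g p / psi p * psi q)).
- exact: (stopping_time_crossing SM p q n.+1).
- by move=> w; exact: first_after_ge.
- apply: (gain_bound_crossing SM mf f0 tt sR sS _ IH).
    by move=> w; exact: first_after_ge.
  by apply: up => //; exact: ltW.
(* The upward crossing ends with the value [C * psi q], whereas the downward one needs only [pos q];
   the surplus is given away here. *)
- apply: (crossing_inequalityW (c1 := pos q)).
    exact: (pos_bound RD rho0 FS mg lp opt gp lq).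
  rewrite -posp; apply: down => //; exact: hitX.
Qed.

Lemma threshold_payoff x : open_itv l r x ->
  expected_payoff X P rho g x (threshold_time X p) =
  (if x < p then g p / psi p * psi x else g x)%:E.
Proof.
move=> lx; case: ifPn => [xp|]; first exact: (threshold_payoff_below RD rho0 FS mg).
by rewrite -leNgt => px; exact: (threshold_payoff_above RD mg).
Qed.

End optimal_value.

Theorem theorem3 (R : realType) (d : measure_display) (T : measurableType d)
    (D : set R) (l r : \bar R) (a sigma : R -> R)
    (X : R -> T -> R) (P : R -> probability T R)
    (rho : R) (psi phi g : R -> R) (pstar : R) :
  regular_diffusion D l r a sigma X P ->
  0 < rho ->
  fundamental_solutions l r a sigma X P rho psi phi ->
  measurable_fun D g ->
  (exists2 x0, open_itv l r x0 & 0 < g x0) ->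
  left_end_condition D l r X P g ->
  let h := fun p => g p / psi p in
  open_itv l r pstar ->
  (forall x, open_itv l r x ->
     optimal X P rho g (threshold_times l r X) x (threshold_time X pstar)) ->
  (exists c : R, (g (pstar + t) - g pstar) / t @[t --> (0 : R)^'+] --> c) ->
  (forall x, D x -> pstar < x -> 0 <= g x) ->
  ((forall x, open_itv l r x ->
      optimal X P rho g (stopping_time X) x (threshold_time X pstar))
   <-> excessive_on_restriction D l r X P rho pstar g)
  /\
  ((forall x, open_itv l r x ->
      value X P rho g (stopping_time X) x
      = (if x < pstar then h pstar * psi x else g x)%:E)
   <-> excessive_on_restriction D l r X P rho pstar g).
Proof.
move=> RD rho0 FS mg gx0 le h lp opt _ g0.
have gp : 0 < g pstar := threshold_value_pos RD rho0 FS mg lp opt gx0.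
have pay x : open_itv l r x -> expected_payoff X P rho g x (threshold_time X pstar) =
    (if x < pstar then h pstar * psi x else g x)%:E.
  by move=> lx; rewrite (threshold_payoff RD rho0 FS mg lp lx).
have st := stopping_time_threshold RD pstar.
have optE : (forall x, open_itv l r x ->
      optimal X P rho g (stopping_time X) x (threshold_time X pstar)) <->
    (forall x, open_itv l r x -> value X P rho g (stopping_time X) x
      = (if x < pstar then h pstar * psi x else g x)%:E).
  split => H x lx; first by have [_ <-] := H x lx; rewrite pay.
  by split; rewrite // pay// H.
suff valueE : (forall x, open_itv l r x -> value X P rho g (stopping_time X) x
      = (if x < pstar then h pstar * psi x else g x)%:E) <->
    excessive_on_restriction D l r X P rho pstar g.
  by split => //; rewrite optE.
split => [H|exc x lx].
(* Necessity: stopping at the minimum of [tau] and the hitting time of [pstar] is admissible in the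
   full problem, whose value at [x > pstar] is [g x]. *)
- split => [x Dx|x tau lx px stau].
    by rewrite le_eqVlt => /predU1P[<-|/(g0 _ Dx)//]; exact: ltW.
  have := H x lx; rewrite ltNge (ltW px) /= => <-.
  apply: ereal_sup_ubound; exists (fun w => Order.min (tau w) (hitting_time X pstar w)) => //.
  apply: stopping_time_min => //.
  rewrite (_ : hitting_time X pstar = fun w => hit_after pstar 0%E (X ^~ w)).
    apply: (stopping_time_hit (regular_diffusion_markov RD)); exact: stopping_time0.
  by apply/funext => w; exact: hitting_timeE.
(* Sufficiency: the chained crossings give the upper bound, and the threshold time attains it. *)
- apply/eqP; rewrite eq_le; apply/andP; split.
    apply: ge_ereal_sup => _ [tau stau <-].
    exact: (value_bound RD rho0 FS mg le lp opt gp exc lx stau).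
  by rewrite -pay//; apply: ereal_sup_ubound; exists (threshold_time X pstar).
Qed.
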